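(* Let $r=p^\nu$ be a prime power ($p$ prime, $\nu\ge1$), let $G=(\mathbb{Z}_p)^\nu$ act freely and transitively by permutations on a set $\Pi$ of $r$ plates, and let $\mathcal{C}_r$ be the natural configuration space (defined in the context) with $G$-action $\sigma(x,\alpha)=(x,\sigma\circ\alpha)$. Let $(A^j_i)_{i\in\Pi}^{j\in[r+1]}$ be a matrix of subsets $A^j_i\subseteq\mathcal{C}_r$ which are closed, covering (for each $j\in[r+1]$, $\bigcup_{i\in\Pi}A^j_i=\mathcal{C}_r$) and equivariant (for all $\sigma\in G$, $i,j$: $(x,\alpha)\in A^j_i\iff\sigma(x,\alpha)\in A^j_{\sigma(i)}$). Then one can choose for each $i\in\Pi$ two distinct elements $u_i,v_i\in[r+1]$ such that (1) the sets $e_i=\{u_i,v_i\}$, $i\in\Pi$, form the edge set of a tree on the vertex set $[r+1]$, and (2) $\bigcap_{i\in\Pi}\big(A^{u_i}_i\cap A^{v_i}_i\big)\neq\emptyset$.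
   Context: A proper cut of $[0,1]$ with tile number $k$ ($1\le k\le r$) is a sequence $x=(0=x_0<x_1<\dots<x_k=1)$ with tiles $I_i(x)=[x_{i-1},x_i]$, $i\in[k]$. The natural configuration space $\mathcal{C}_r$ is the set of pairs $(x,\alpha)$ with $x$ a proper cut of tile number $k\le r$ and $\alpha:[k]\to\Pi$ injective. A proper cut is identified with the finite set $\{x_0,\dots,x_k\}$. $\mathcal{C}_r$ carries the topology in which $(x^n,\alpha_n)\to(x,\alpha)$ (with $x$ of tile number $k$) iff (1) the cut-point sets of $x^n$ converge to that of $x$ in the Hausdorff metric on subsets of $[0,1]$, and (2) there is $n_0$ such that for all $n\ge n_0$ and $i\in[k]$ the tile of $x^n$ containing the midpoint of $I_i(x)$ is assigned by $\alpha_n$ to plate $\alpha(i)$. ''Closed'' refers to this topology. *)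

(* Defs.v *)
From HB Require Import structures.
From mathcomp Require Import all_boot all_order all_algebra all_fingroup.
From mathcomp Require Import all_classical all_reals.
From mathcomp Require Import topology normedtype lra.

Set Implicit Arguments.
Unset Strict Implicit.
Unset Printing Implicit Defensive.
Import Order.TTheory GRing.Theory Num.Theory numFieldNormedType.Exports.
Local Open Scope classical_set_scope.
Local Open Scope ring_scope.

(* Proper cuts 0 = x_0 < ... < x_k = 1 with k <= r tiles, together with an
   injective assignment of plates to tiles; tiles are indexed from 0. *)
Record config (R : realType) (r : nat) (Pi : finType) := Config {
  ntiles : nat;
  cutpt : 'I_ntiles.+1 -> R;
  plate : 'I_ntiles -> Pi;
  ntiles_bounds : (1 <= ntiles <= r)%N;
  cutpt_first : cutpt ord0 = 0;
  cutpt_last : cutpt ord_max = 1;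
  cutpt_incr : forall i j : 'I_ntiles.+1, (i < j)%N -> cutpt i < cutpt j;
  plate_inj : injective plate
}.
Arguments cutpt {R r Pi} c _.
Arguments plate {R r Pi} c _.

HB.instance Definition _ (R : realType) (r : nat) (Pi : finType) :=
  gen_eqMixin (config R r Pi).
HB.instance Definition _ (R : realType) (r : nat) (Pi : finType) :=
  gen_choiceMixin (config R r Pi).

Section Config.
Variables (R : realType) (r : nat) (Pi : finType).
Implicit Types c p : config R r Pi.

Definition cutset c : set R := range (cutpt c).

Definition tile_left c (i : 'I_(ntiles c)) : R :=
  cutpt c (widen_ord (leqnSn (ntiles c)) i).

Definition tile_right c (i : 'I_(ntiles c)) : R := cutpt c (lift ord0 i).

Definition tile c (i : 'I_(ntiles c)) : set R :=
  [set t | tile_left i <= t <= tile_right i].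

Definition midpoint c (i : 'I_(ntiles c)) : R :=
  (tile_left i + tile_right i) / 2.

End Config.

(* The Hausdorff distance of two nonempty bounded sets. *)
Definition hausdorff_dist (R : realType) (A B : set R) : R :=
  inf [set e : R | [/\ 0 <= e,
    forall a, A a -> exists2 b, B b & `|a - b| <= e &
    forall b, B b -> exists2 a, A a & `|a - b| <= e]].

(* When a midpoint of p is a cut point of u n it lies in two tiles of u n, and
   both are constrained. This can only happen for finitely many n if the cut
   sets converge. *)
Definition config_cvg (R : realType) (r : nat) (Pi : finType)
    (u : nat -> config R r Pi) (p : config R r Pi) : Prop :=
  (fun n => hausdorff_dist (cutset (u n)) (cutset p)) @ \oo --> (0 : R) /\
  exists n0 : nat, forall n, (n0 <= n)%N ->
    forall (i : 'I_(ntiles p)) (j : 'I_(ntiles (u n))),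
      tile j (midpoint i) -> plate (u n) j = plate p i.

Definition config_open (R : realType) (r : nat) (Pi : finType)
    (U : set (config R r Pi)) : Prop :=
  forall u p, config_cvg u p -> U p -> \forall n \near \oo, U (u n).

Section ConfigTopology.
Variables (R : realType) (r : nat) (Pi : finType).

Lemma config_openT : config_open [set: config R r Pi].
Proof. by move=> u p _ _; apply: nearW. Qed.

Lemma config_openI : setI_closed (@config_open R r Pi).
Proof.
move=> U V oU oV u p up [Up Vp].
by apply: filterS2 (oU u p up Up) (oV u p up Vp) => n.
Qed.

Lemma config_open_bigU (I : Type) (f : I -> set (config R r Pi)) :
  (forall i, config_open (f i)) -> config_open (\bigcup_i f i).
Proof.
move=> of_ u p up [i _ fip].
by apply: filterS (of_ i u p up fip) => n; exists i.
Qed.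

End ConfigTopology.

(* The sequential topology generated by config_cvg: by config_cvgP below its
   convergent sequences are those of config_cvg, and by config_closedP its
   closed sets are the sequentially closed ones. *)
HB.instance Definition _ (R : realType) (r : nat) (Pi : finType) :=
  isOpenTopological.Build (config R r Pi)
    (@config_openT R r Pi) (@config_openI R r Pi) (@config_open_bigU R r Pi).

Section ConfigTopologyTheory.
Variables (R : realType) (r : nat) (Pi : finType).
Implicit Types c p q : config R r Pi.

Lemma config_openE (U : set (config R r Pi)) : open U = config_open U.
Proof. by []. Qed.

Let close (A B : set R) (e : R) : Prop :=
  [/\ 0 <= e,
    forall a, A a -> exists2 b, B b & `|a - b| <= e &
    forall b, B b -> exists2 a, A a & `|a - b| <= e].

Let close_triangle (A B C : set R) (d e : R) :
  close A B d -> close B C e -> close A C (d + e).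
Proof.
move=> [d0 AB BA] [e0 BC CB]; split; first exact: addr_ge0.
  move=> a /AB[b /BC[c Cc bc] ab]; exists c => //.
  by rewrite (le_trans (ler_distD b _ _))// lerD.
move=> c /CB[b /BA[a Aa ab] bc]; exists a => //.
by rewrite (le_trans (ler_distD b _ _))// lerD.
Qed.

Let cutpt_le c (i j : 'I_(ntiles c).+1) : (i <= j)%N -> cutpt c i <= cutpt c j.
Proof.
rewrite leq_eqVlt => /orP[/eqP/val_inj ->//|ij].
exact/ltW/cutpt_incr.
Qed.

Let cut_bounds c x : cutset c x -> 0 <= x <= 1.
Proof.
move=> [i _ <-]; rewrite -(cutpt_first c) -(cutpt_last c).
by rewrite !cutpt_le// -ltnS.
Qed.

Let cut0 c : cutset c 0.
Proof. by exists ord0; rewrite ?cutpt_first. Qed.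

Let close1 c q : close (cutset c) (cutset q) 1.
Proof.
split=> // [a /cut_bounds /andP[a0 a1]|a /cut_bounds /andP[a0 a1]].
  by exists 0; [exact: cut0|rewrite subr0 ger0_norm].
by exists 0; [exact: cut0|rewrite sub0r normrN ger0_norm].
Qed.

Let hd_lt c q e : hausdorff_dist (cutset c) (cutset q) < e ->
  exists2 d, close (cutset c) (cutset q) d & d < e.
Proof. by move/inf_lt => H; apply: H; exists 1; exact: close1. Qed.

Let hd_le c q d : close (cutset c) (cutset q) d ->
  hausdorff_dist (cutset c) (cutset q) <= d.
Proof. by move=> H; apply: ge_inf => //; exists 0 => e []. Qed.

Let hd_ge0 c q : 0 <= hausdorff_dist (cutset c) (cutset q).
Proof. by apply: lb_le_inf; [exists 1; exact: close1|move=> e []]. Qed.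

Let tile_lt c (i : 'I_(ntiles c)) : tile_left i < tile_right i.
Proof. by apply: cutpt_incr; rewrite /= /bump leq0n. Qed.

(* No cut point lies in the interior of a tile. *)
Let cut_tile c (i : 'I_(ntiles c)) x : cutset c x ->
  x <= tile_left i \/ tile_right i <= x.
Proof.
move=> [l _ <-]; case: (leqP l i) => li; [left|right]; apply: cutpt_le => //.
Qed.

Let tile_ex c x : 0 <= x <= 1 -> exists j : 'I_(ntiles c), tile j x.
Proof.
move=> /andP[x0 x1]; have /andP[k0 _] := ntiles_bounds c.
pose P (j : 'I_(ntiles c)) := tile_left j <= x.
have P0 : P (Ordinal k0).
  by rewrite /P /tile_left (_ : widen_ord _ _ = ord0) ?cutpt_first//; exact: val_inj.
case: (arg_maxnP (fun j : 'I_(ntiles c) => j : nat) P0) => j Pj jmax.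
rewrite /P in Pj; exists j; rewrite /tile /= Pj /=.
have [jk|jk] := ltnP j.+1 (ntiles c).
  case: leP => // rx; have : P (Ordinal jk).
    rewrite /P/tile_left (_ : widen_ord _ _ = lift ord0 j) ?(ltW rx)//.
    exact: val_inj.
  by move/jmax; rewrite /= ltnn.
rewrite /tile_right (_ : lift ord0 j = ord_max) ?cutpt_last//.
apply: val_inj => /=; apply/eqP; rewrite eqn_leq jk /bump leq0n add1n.
by rewrite ltn_ord.
Qed.

Let tile_midpoint c (i j : 'I_(ntiles c)) : tile j (midpoint i) -> i = j.
Proof.
have := tile_lt i; rewrite /tile /midpoint /= => lti /andP[lj rj].
apply: val_inj; apply/eqP; rewrite eqn_leq; apply/andP; split; rewrite leqNgt.
- apply/negP => ji; have : tile_right j <= tile_left i by exact: cutpt_le.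
  by lra.
- apply/negP => ji; have : tile_right i <= tile_left j by exact: cutpt_le.
  by lra.
Qed.

(* A tile contains every point that no cut separates from one of its points. *)
Let tile_extend c (j : 'I_(ntiles c)) (a b x y : R) :
  (forall t, cutset c t -> t < a \/ b < t) -> a <= x <= b -> a <= y <= b ->
  tile j x -> tile j y.
Proof.
move=> nocut /andP[ax xb] /andP[ay yb] /andP[lx xr]; apply/andP; split.
  by have [|] := nocut (tile_left j) (ex_intro2 _ _ _ I erefl); lra.
by have [|] := nocut (tile_right j) (ex_intro2 _ _ _ I erefl); lra.
Qed.

Let config_cvg_close (u : nat -> config R r Pi) p e : config_cvg u p -> 0 < e ->
  \forall n \near \oo,
    exists2 d, close (cutset (u n)) (cutset p) d & d < e.
Proof.
move=> [/cvgr0Pnorm_lt up _] /up; apply: filterS => n.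
by rewrite ger0_norm ?hd_ge0// => /hd_lt.
Qed.

(* If x is not a cut point of q and c_n -> q, then eventually the tiles of c_n
   at x carry the plate that q has at x. *)
Let plate_eventually (w : nat -> config R r Pi) q (j : 'I_(ntiles q)) x :
  config_cvg w q -> tile_left j < x < tile_right j ->
  \forall n \near \oo, forall l : 'I_(ntiles (w n)),
    tile l x -> plate (w n) l = plate q j.
Proof.
move=> wq /andP[lx xr].
pose d := Num.min ((tile_right j - tile_left j) / 2)
            (Num.min (x - tile_left j) (tile_right j - x)).
have ltj := tile_lt j.
have d0 : 0 < d.
  by rewrite !lt_min subr_gt0 lx subr_gt0 xr !andbT; lra.
have [d1 d2 d3] : [/\ d <= (tile_right j - tile_left j) / 2,
    d <= x - tile_left j & d <= tile_right j - x].
  by split; rewrite /d !ge_min lexx ?orbT.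
have [_ [n0 wn0]] := wq.
near=> n => l lxn; apply: (wn0 n); first by near: n; exists n0.
have [e ewq ed] : exists2 e, close (cutset (w n)) (cutset q) e & e < d.
  by near: n; exact: config_cvg_close.
apply: (@tile_extend _ l (tile_left j + d) (tile_right j - d) x) => //; last 2 first.
- by lra.
- by rewrite /midpoint; lra.
move=> t; case: ewq => _ H _ => /H[s sq]; rewrite ler_norml.
by have [|] := cut_tile j sq; [left|right]; lra.
Unshelve. all: by end_near. Qed.

Let basic p (e : R) : set (config R r Pi) := [set c |
  (exists2 d, close (cutset c) (cutset p) d & d < e) /\
  forall (i : 'I_(ntiles p)) (j : 'I_(ntiles c)),
    tile j (midpoint i) -> plate c j = plate p i].

Let basic_open p e :
  (forall i : 'I_(ntiles p), e <= (tile_right i - tile_left i) / 2) ->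
  open (basic p e).
Proof.
rewrite config_openE => eP w q wq [[d qp de] platesq].
have A : \forall n \near \oo, exists2 d', close (cutset (w n)) (cutset q) d' & d' < e - d.
  by apply: config_cvg_close => //; rewrite subr_gt0.
have B : \forall n \near \oo, forall (i : 'I_(ntiles p)) (j : 'I_(ntiles (w n))),
    tile j (midpoint i) -> plate (w n) j = plate p i.
  apply: filter_forall => i.
  have mi : 0 <= midpoint i <= 1.
    have /cut_bounds := ex_intro2 _ _ _ I erefl : cutset p (tile_left i).
    have /cut_bounds := ex_intro2 _ _ _ I erefl : cutset p (tile_right i).
    by rewrite /midpoint; lra.
  have [j jmi] := tile_ex q mi.
  rewrite -(platesq i j jmi); apply: plate_eventually => //.
  have ei := eP i; move: jmi => /andP[lj rj].
  have nocut s : cutset q s -> s != midpoint i.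
    case: qp => _ H _ /H[t tp]; rewrite ler_norml => st.
    apply/eqP => sE; move: st; rewrite sE /midpoint.
    by have [|] := cut_tile i tp; lra.
  rewrite !lt_neqAle lj rj !andbT nocut//=; last by exists (widen_ord (leqnSn _) j).
  by rewrite eq_sym nocut//; exists (lift ord0 j).
near=> n; split; last by near: n.
have [d' d'1 d'2] : exists2 d', close (cutset (w n)) (cutset q) d' & d' < e - d by near: n.
by exists (d' + d); [exact: close_triangle d'1 qp|lra].
Unshelve. all: by end_near. Qed.

Lemma config_cvgP (u : nat -> config R r Pi) p :
  u @ \oo --> p <-> config_cvg u p.
Proof.
split=> [up|up]; last first.
  move=> U; rewrite nbhsE => -[V [oV Vp] VU].
  by apply: filterS (oV u p up Vp) => n; exact: VU.
pose h := \big[Num.min/1]_(i < ntiles p) ((tile_right i - tile_left i) / 2).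
have h0 : 0 < h.
  apply: lt_bigmin => // i _.
  by have := tile_lt i; lra.
have near_basic e : 0 < e -> \forall n \near \oo, basic p (Num.min e h) (u n).
  move=> e0; apply: up; apply: open_nbhs_nbhs; split.
    apply: basic_open => i; rewrite ge_min; apply/orP; right.
    exact: bigmin_le.
  split; last by move=> i j /tile_midpoint ->.
  exists 0; last by rewrite lt_min e0.
  by split => // a pa; exists a; rewrite // subrr normr0.
split.
  apply/cvgr0Pnorm_lt => e /near_basic; apply: filterS => n [[d cd de] _].
  rewrite ger0_norm ?hd_ge0// (le_lt_trans (hd_le cd))//.
  by move: de; rewrite lt_min => /andP[].
have [n0 _ n0P] := near_basic 1 ltr01.
by exists n0 => n /n0P[].
Qed.

Lemma config_closedP (A : set (config R r Pi)) :
  closed A <-> forall u p, config_cvg u p -> (forall n, A (u n)) -> A p.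
Proof.
split=> [cA u p up Au|cA].
  apply: (@closed_cvg _ _ \oo _ u A cA) (iffRL (config_cvgP u p) up).
  exact: nearW.
rewrite -openC config_openE => u p [up [n0 n0P]] nAp.
apply: contrapT => H; apply: nAp.
have ex N : exists n, (N <= n)%N /\ A (u n).
  apply: contrapT => H'; apply: H; exists N => // n /= Nn An.
  by apply: H'; exists n.
have [f fP] := choice ex.
apply: (cA (u \o f)) => [|n]; last exact: (fP n).2.
split; last first.
  by exists n0 => n nn0 i j; apply: n0P; rewrite (leq_trans nn0)// (fP n).1.
have foo : f @ \oo --> \oo.
  move=> S [N _ NS]; exists N => // n /= Nn; apply: NS => /=.
  by rewrite (leq_trans Nn)// (fP n).1.
exact: cvg_comp foo up.
Qed.

End ConfigTopologyTheory.

Definition act_config (R : realType) (r : nat) (Pi : finType)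
    (aT : finGroupType) (to : {action aT &-> Pi}) (s : aT)
    (c : config R r Pi) : config R r Pi :=
  Config (ntiles_bounds c) (cutpt_first c) (cutpt_last c) (@cutpt_incr _ _ _ c)
    (inj_comp (act_inj to s) (@plate_inj _ _ _ c)).

Definition free_action (aT : finGroupType) (T : finType)
    (to : {action aT &-> T}) : Prop :=
  forall (x : T) (s : aT), to x s = x -> s = 1%g.

(* Finite simple graphs on V, given by their set of edges (2-subsets of V). *)
Definition edge_rel (V : finType) (E : {set {set V}}) : rel V :=
  [rel x y | (x != y) && ([set x; y]%SET \in E)].

(* Connected, and without cycles of length at least 3. *)
Definition is_tree (V : finType) (E : {set {set V}}) : Prop :=
  [/\ forall e, e \in E -> #|e| = 2%N,
      forall x y : V, connect (edge_rel E) x y &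
      forall s : seq V, ucycle (edge_rel E) s -> (size s < 3)%N].

(* Main.v *)
Require Import Defs.
From HB Require Import structures.
From mathcomp Require Import all_boot all_order all_algebra all_fingroup.
From mathcomp Require Import all_classical all_reals.
From mathcomp Require Import topology normedtype sequences.
From mathcomp Require Import finmap.
From mathcomp Require Import -(notations) monalg.
From mathcomp Require Import zify ring lra.

Set Implicit Arguments.
Unset Strict Implicit.
Unset Printing Implicit Defensive.
Import Order.TTheory GRing.Theory Num.Theory numFieldNormedType.Exports.

(** The complex of cells of the configuration space is the complex of injective
words on Pi: a configuration is an injective word together with the vector of
its tile lengths, a point of a simplex.

An equivariant chain map [phi] from injective words to chains of arbitrary
words on Pi, over F_p, must produce a word containing every letter.
Injective words are exact in degrees < r, so they carry a family x_a of
chains, indexed by multi-indices a with |a| < r, whose boundaries are those of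
the tensor product of nu periodic resolutions of Z/p. The image of this family
is followed through complexes of words meeting every block of finer and
finer partitions of Pi, where the group acts through fewer and fewer factors.
A block is cut into p parts along one coordinate by comparison with an explicit
family for Z/p, whose top class has the value ((p-1)/2)! <> 0; on the partition
into singletons the surviving nonzero value counts the full words.

Choose labels lam_j equivariantly with (x, alpha) in A^j_(lam_j). Subdivide the
cells finely, send each vertex to the average over j of the r+1 unit vectors
e_(lam_j), subdivide again, and label by a largest coordinate; this is [phi].
A full word gives a small simplex of configurations on which every coordinate
of the average is almost 1/r, hence any set I of plates is used by more than
|I| of the columns. By Lovasz's theorem this strengthened Hall condition gives
a tree whose edges join columns using a common plate, and the mesh tends to 0. *)

(** * Free modules *)

(** The range |a| < r is exactly enough. The tracked index [b] starts at 0 with one block, and every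
    cut adds p - 1 both to |b| and to the number of blocks, so |b| = r - 1 when the blocks have
    become singletons. All entries of [b] stay divisible by p - 1, which makes the signs trivial in
    F_p and matches the period of the resolution at each cut. The obstacle for nu > 1 is that after
    a cut along one coordinate the blocks are only permuted, no longer fixed, by the corresponding
    generator. Before the next coordinate the family is therefore changed by a homotopy until it
    vanishes below [b] in the used direction; on the slab up to [b] that generator then acts only on
    zeros and may be declared trivial. Coefficients in F_p make homotopies invisible: on scalars T -
    1 is 0 and the norm is p = 0, so an invariant functional that kills boundaries does not change.
    Two subdivisions are used because the average is defined at vertices only and extended affinely:
    the first brings the configurations close together, the second makes the extended coordinates
    nearly constant on a simplex. *)

Section LinearClosure.
Local Open Scope ring_scope.
Variables (F : fieldType) (U V W : lmodType F).

Lemma linear_idf : linear (fun z : U => z). Proof. by []. Qed.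

Lemma linear_zerof : linear (fun _ : U => 0 : V).
Proof. by move=> a u v; rewrite scaler0 addr0. Qed.

Lemma linear_addf (f g : U -> V) :
  linear f -> linear g -> linear (fun z => f z + g z).
Proof. by move=> lf lg a u v; rewrite lf lg scalerDr addrACA. Qed.

Lemma linear_oppf (f : U -> V) : linear f -> linear (fun z => - f z).
Proof. by move=> lf a u v; rewrite lf opprD scalerN. Qed.

Lemma linear_scalef (c : F) (f : U -> V) : linear f -> linear (fun z => c *: f z).
Proof. by move=> lf a u v; rewrite lf scalerDr !scalerA mulrC. Qed.

Lemma linear_sumf (I : Type) (r : seq I) (P : pred I) (f : I -> U -> V) :
  (forall i, linear (f i)) -> linear (fun z => \sum_(i <- r | P i) f i z).
Proof.
move=> lf a u v; rewrite scaler_sumr -big_split /=.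
by apply: eq_bigr => i _; exact: lf.
Qed.

Lemma linear_compf (h : {linear V -> W}) (f : U -> V) :
  linear f -> linear (fun z => h (f z)).
Proof. by move=> lf a u v; rewrite lf linearP. Qed.

End LinearClosure.

Ltac lin := repeat first
  [ exact: linear_idf | exact: linear_zerof | apply: linear_oppf
  | apply: linear_addf | apply: linear_scalef
  | apply: linear_sumf => ? | apply: linear_compf ].

(** Linear extension from the generators of a free module. The sum over the support stays locked;
    later arguments use [lift_gen] and linearity. *)
HB.lock Definition lift (F : fieldType) (K : choiceType) (M : lmodType F)
    (f : K -> M) (z : malg K F) : M :=
  (\sum_(k <- finmap.enum_fset (msupp z)) mcoeff k z *: f k)%R.

Section FreeModule.
Local Open Scope ring_scope.
Variable F : fieldType.

Definition gen (K : choiceType) (k : K) : malg K F := mkmalgU k 1.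

(** Subcomplexes appear as support conditions inside one ambient module of chains, and quotient
    complexes through [restr]. *)
Definition spt (K : choiceType) (P : K -> Prop) (z : malg K F) : Prop :=
  forall k, mcoeff k z != 0 -> P k.

Section Basics.
Variables (K : choiceType).
Implicit Types (z : malg K F) (P : K -> Prop).

Lemma mcoeff_gen (k k' : K) : mcoeff k' (gen k) = (k == k')%:R.
Proof. exact: mcoeffU. Qed.

Lemma chainE z :
  z = \sum_(k <- finmap.enum_fset (msupp z)) mcoeff k z *: gen k.
Proof.
rewrite [LHS]monalgE; apply: eq_bigr => k _.
by apply/malgP => k'; rewrite mcoeffZ !mcoeffU mulrnAr mulr1.
Qed.

Lemma liftEw (M : lmodType F) (f : K -> M) (r : seq K) z : uniq r ->
  {subset finmap.enum_fset (msupp z) <= r} ->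
  lift f z = \sum_(k <- r) mcoeff k z *: f k.
Proof.
move=> ur sub; rewrite unlock.
rewrite [RHS](bigID (fun k => k \in finmap.enum_fset (msupp z))) /=.
rewrite [X in _ + X]big1 ?addr0; last first.
  by move=> k /mcoeff_outdom ->; rewrite scale0r.
rewrite -[RHS]big_filter; apply: perm_big.
apply: uniq_perm; [exact: finmap.fset_uniq|exact: filter_uniq|].
by move=> k; rewrite mem_filter; case: (boolP (k \in _)) => // /sub ->.
Qed.

Lemma lift_linear (M : lmodType F) (f : K -> M) : linear (lift f).
Proof.
move=> a x y.
pose r := undup (finmap.enum_fset (msupp x) ++ finmap.enum_fset (msupp y)
   ++ finmap.enum_fset (msupp (a *: x + y))).
have rE k : k \in r = [|| k \in finmap.enum_fset (msupp x),
   k \in finmap.enum_fset (msupp y) | k \in finmap.enum_fset (msupp (a *: x + y))].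
  by rewrite mem_undup !mem_cat.
rewrite !(@liftEw M f r) ?undup_uniq//; try by move=> k; rewrite rE => ->; rewrite ?orbT.
rewrite scaler_sumr -big_split /=; apply: eq_bigr => k _.
by rewrite mcoeffD mcoeffZ scalerDl scalerA.
Qed.

HB.instance Definition _ (M : lmodType F) (f : K -> M) :=
  GRing.isLinear.Build F (malg K F) M *:%R (lift f) (lift_linear f).

Lemma lift_gen (M : lmodType F) (f : K -> M) k : lift f (gen k) = f k.
Proof.
rewrite (@liftEw M f [:: k]) // ?big_seq1 ?mcoeff_gen ?eqxx ?scale1r //.
move=> k'; rewrite -[k' \in _]/(k' \in msupp _) -mcoeff_neq0 mcoeff_gen mem_seq1.
by rewrite (eq_sym k'); case: (k == k'); rewrite ?eqxx.
Qed.

Lemma spt0 P : spt P 0.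
Proof. by move=> k; rewrite mcoeff0 eqxx. Qed.

Lemma sptD P x y : spt P x -> spt P y -> spt P (x + y).
Proof.
move=> px py k; rewrite mcoeffD; have [x0|/px //] := eqVneq (mcoeff k x) 0.
by rewrite x0 add0r => /py.
Qed.

Lemma sptZ P a x : spt P x -> spt P (a *: x).
Proof. by move=> px k; rewrite mcoeffZ mulf_eq0 negb_or => /andP[_ /px]. Qed.

Lemma sptN P x : spt P x -> spt P (- x).
Proof. by move=> px; rewrite -scaleN1r; exact: sptZ. Qed.

Lemma sptB P x y : spt P x -> spt P y -> spt P (x - y).
Proof. by move=> px py; apply: sptD => //; exact: sptN. Qed.

Lemma spt_sum P (I : Type) (r : seq I) (Q : pred I) (f : I -> malg K F) :
  (forall i, Q i -> spt P (f i)) -> spt P (\sum_(i <- r | Q i) f i).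
Proof. by move=> H; elim/big_rec: _ => [|i x Qi]; [exact: spt0|apply: sptD; exact: H]. Qed.

Lemma spt_gen P (k : K) : P k -> spt P (gen k).
Proof. by move=> Pk k'; rewrite mcoeff_gen; have [<-//|_] := eqVneq k k'; rewrite eqxx. Qed.

Lemma spt_sub P Q z : (forall k, P k -> Q k) -> spt P z -> spt Q z.
Proof. by move=> PQ Pz k /Pz/PQ. Qed.

Lemma sptI P Q z : spt P z -> spt Q z -> spt (fun k => P k /\ Q k) z.
Proof. by move=> Pz Qz k nz; split; [exact: Pz|exact: Qz]. Qed.

Lemma sptT P z : (forall k, P k) -> spt P z.
Proof. by move=> H k _. Qed.

Lemma chain_ind P (C : malg K F -> Prop) : C 0 ->
  (forall a k z, P k -> C z -> C (a *: gen k + z)) ->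
  forall z, spt P z -> C z.
Proof.
move=> C0 CS z Pz; rewrite [z]chainE big_seq; elim/big_rec: _ => // k y.
by rewrite -[k \in _]/(k \in msupp z) -mcoeff_neq0 => /Pz; exact: CS.
Qed.

Lemma spt_eq0 z : spt (fun=> False) z -> z = 0.
Proof.
move=> H; apply/malgP => k; rewrite mcoeff0; apply/eqP/negPn/negP.
exact: H.
Qed.

Lemma lin_extP P (M : lmodType F) (f g : malg K F -> M) : linear f -> linear g ->
  (forall k, P k -> f (gen k) = g (gen k)) -> forall z, spt P z -> f z = g z.
Proof.
move=> lf lg fg; apply: chain_ind => [|a k z /fg e IH].
  have f0 : f 0 = 0.
    by have := lf (-1) 0 0; rewrite scaler0 addr0 scaleN1r addNr.
  have g0 : g 0 = 0.
    by have := lg (-1) 0 0; rewrite scaler0 addr0 scaleN1r addNr.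
  by rewrite f0 g0.
by rewrite lf lg e IH.
Qed.

Lemma lin_ext (M : lmodType F) (f g : malg K F -> M) : linear f -> linear g ->
  (forall k, f (gen k) = g (gen k)) -> f =1 g.
Proof. by move=> lf lg fg z; apply: (lin_extP (P := fun=> True)) => //; exact: sptT. Qed.

End Basics.

Lemma spt_lift (K K' : choiceType) (P : K -> Prop) (Q : K' -> Prop)
    (f : K -> malg K' F) z :
  (forall k, P k -> spt Q (f k)) -> spt P z -> spt Q (lift f z).
Proof.
move=> fQ; move: z; apply: chain_ind => [|a k z Pk IH].
  by rewrite linear0; exact: spt0.
rewrite linearP /= lift_gen; apply: sptD => //; apply: sptZ; exact: fQ.
Qed.

End FreeModule.
Arguments gen {F K} k.

(** * Chains of words *)

Section Words.
Local Open Scope ring_scope.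
Variable F : fieldType.
Variable Y : choiceType.
Local Notation T := (malg (seq Y) F).
Implicit Types (z : T) (f g : Y -> F) (y : Y) (w : seq Y).

Definition cons_ch y : T -> T := lift (fun w => gen (y :: w)).
HB.instance Definition _ y := GRing.Linear.on (cons_ch y).

Lemma cons_gen y w : cons_ch y (gen w) = gen (y :: w).
Proof. exact: lift_gen. Qed.

(* Contraction with the weight [f]; for f = 1 this is the simplicial boundary,
   augmented by the empty word in degree -1. *)
Fixpoint iota_word f w : T :=
  if w is y :: w' then f y *: gen w' - cons_ch y (iota_word f w') else 0.

Definition iota_ch f : T -> T := lift (iota_word f).
HB.instance Definition _ f := GRing.Linear.on (iota_ch f).

Definition bd : T -> T := iota_ch (fun=> 1).
HB.instance Definition _ := GRing.Linear.on bd.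

Definition restr (P : pred (seq Y)) : T -> T :=
  lift (fun w => if P w then gen w else 0).
HB.instance Definition _ P := GRing.Linear.on (restr P).

Definition cnil : T -> F^o := lift (fun w => (w == [::])%:R).
HB.instance Definition _ := GRing.Linear.on cnil.

Lemma iota_gen f w : iota_ch f (gen w) = iota_word f w.
Proof. exact: lift_gen. Qed.

Lemma iota_nil f : iota_ch f (gen [::]) = 0.
Proof. exact: lift_gen. Qed.

Lemma cnil_gen w : cnil (gen w) = (w == [::])%:R.
Proof. exact: lift_gen. Qed.

Lemma restr_gen P w : restr P (gen w) = if P w then gen w else 0.
Proof. exact: lift_gen. Qed.

Lemma iota_cons f y z : iota_ch f (cons_ch y z) = f y *: z - cons_ch y (iota_ch f z).
Proof.
move: z; apply: lin_ext => [||w]; [lin|lin|].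
by rewrite cons_gen !iota_gen.
Qed.

(** The cone formula: prepending a fixed letter is a contracting homotopy of the complex of all
    words. Both exactness results below, for blocks and for injective words, rest on it. *)
Lemma bd_cons y z : bd (cons_ch y z) = z - cons_ch y (bd z).
Proof. by rewrite /bd iota_cons scale1r. Qed.

Lemma bd_nil : bd (gen [::]) = 0. Proof. exact: iota_nil. Qed.

(** Contractions are antiderivations of the word algebra, so the anticommutator of two of them is a
    derivation that vanishes on letters. *)
Lemma iota_iota f g z : iota_ch f (iota_ch g z) = - iota_ch g (iota_ch f z).
Proof.
move: z; apply: lin_ext => [||w]; [lin|lin|].
elim: w => [|y w IH]; first by rewrite !iota_nil !linear0 ?oppr0.
rewrite -!cons_gen !iota_cons !linearB !linearZ /= !iota_cons IH.
by rewrite !linearN /= !opprK opprD addrA [RHS]addrA (addrC (g y *: _)).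
Qed.

(** Proved on its own, since in characteristic 2 it does not follow from anticommutation. *)
Lemma iota_sq f z : iota_ch f (iota_ch f z) = 0.
Proof.
move: z; apply: (lin_ext (g := fun=> 0)) => [||w]; [lin|lin|].
elim: w => [|y w IH]; first by rewrite !iota_nil linear0.
by rewrite -cons_gen iota_cons linearB linearZ /= iota_cons IH linear0 subr0 addrN.
Qed.

Lemma bd_bd z : bd (bd z) = 0. Proof. exact: iota_sq. Qed.

Lemma eq_iota f g z : f =1 g -> iota_ch f z = iota_ch g z.
Proof. by move=> /funext ->. Qed.

Lemma iota_suml (I : Type) (r : seq I) (f : I -> Y -> F) z :
  iota_ch (fun y => \sum_(i <- r) f i y) z = \sum_(i <- r) iota_ch (f i) z.
Proof.
move: z; apply: lin_ext => [||w]; [lin|lin|].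
elim: w => [|y w IH].
  by rewrite iota_nil big1 // => i _; rewrite iota_nil.
rewrite -cons_gen iota_cons IH scaler_suml (linear_sum (cons_ch y)) /= -sumrB.
by apply: eq_bigr => i _; rewrite iota_cons.
Qed.

Lemma spt_cons (P Q : seq Y -> Prop) y z :
  (forall w, P w -> Q (y :: w)) -> spt P z -> spt Q (cons_ch y z).
Proof. by move=> H; apply: spt_lift => w /H; exact: spt_gen. Qed.

Lemma spt_restr (P : seq Y -> Prop) (Q : pred (seq Y)) z :
  spt P z -> spt (fun w => P w /\ Q w) (restr Q z).
Proof.
apply: spt_lift => w Pw; case: ifP => Qw; [exact: spt_gen|exact: spt0].
Qed.

Lemma restr_id (Q : pred (seq Y)) z : spt (fun w => Q w) z -> restr Q z = z.
Proof.
move: z; apply: lin_extP => [||w Qw]; [lin|lin|].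
by rewrite restr_gen Qw.
Qed.

Lemma restr0 (Q : pred (seq Y)) z : spt (fun w => ~~ Q w) z -> restr Q z = 0.
Proof.
move: z; apply: (lin_extP (g := fun=> 0)) => [||w Qw]; [lin|lin|].
by rewrite restr_gen (negbTE Qw).
Qed.

Lemma spt_iota (P Q : seq Y -> Prop) f z :
  (forall w1 y w2, P (w1 ++ y :: w2) -> f y != 0 -> Q (w1 ++ w2)) ->
  spt P z -> spt Q (iota_ch f z).
Proof.
move=> H; apply: spt_lift => w; elim: w P Q H => [|y w IH] P Q H Pw /=.
  exact: spt0.
apply: sptB.
  have [fy|fy] := eqVneq (f y) 0; first by rewrite fy scale0r; exact: spt0.
  by apply: sptZ; apply: spt_gen; exact: (H [::] y w).
apply: (spt_cons (P := fun v => Q (y :: v))) => //.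
apply: (IH (fun v => P (y :: v))) => // w1 y' w2; exact: (H (y :: w1)).
Qed.

Lemma spt_bd (P Q : seq Y -> Prop) z :
  (forall w1 y w2, P (w1 ++ y :: w2) -> Q (w1 ++ w2)) ->
  spt P z -> spt Q (bd z).
Proof. by move=> H; apply: spt_iota => w1 y w2 /H. Qed.

End Words.
Arguments iota_ch {F Y} f z.
Arguments bd {F Y} z.
Arguments cnil {F Y} z.

Section MapWords.
Local Open Scope ring_scope.
Variables (F : fieldType) (X Y Z : choiceType).

Definition map_ch (g : X -> Y) : malg (seq X) F -> malg (seq Y) F :=
  lift (fun w => gen (map g w)).
HB.instance Definition _ g := GRing.Linear.on (map_ch g).

Lemma map_gen g w : map_ch g (gen w) = gen (map g w).
Proof. exact: lift_gen. Qed.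

Lemma map_cons g y z : map_ch g (cons_ch y z) = cons_ch (g y) (map_ch g z).
Proof.
move: z; apply: lin_ext => [||w]; [lin|lin|].
by rewrite cons_gen !map_gen cons_gen.
Qed.

Lemma iota_map f g z : iota_ch f (map_ch g z) = map_ch g (iota_ch (f \o g) z).
Proof.
move: z; apply: lin_ext => [||w]; [lin|lin|].
elim: w => [|y w IH]; first by rewrite map_gen !iota_nil linear0.
by rewrite -cons_gen map_cons !iota_cons IH linearB linearZ /= map_cons.
Qed.

Lemma bd_map g z : bd (map_ch g z) = map_ch g (bd z).
Proof. exact: iota_map. Qed.

Lemma spt_map (P : seq X -> Prop) (Q : seq Y -> Prop) g z :
  (forall w, P w -> Q (map g w)) -> spt P z -> spt Q (map_ch g z).
Proof. by move=> H; apply: spt_lift => w /H; exact: spt_gen. Qed.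

Lemma eq_map_ch (P : seq X -> Prop) g g' z :
  (forall w, P w -> {in w, g =1 g'}) -> spt P z -> map_ch g z = map_ch g' z.
Proof.
move=> H; move: z; apply: lin_extP => [||w /H/eq_in_map e]; [lin|lin|].
by rewrite !map_gen e.
Qed.

Lemma cnil_map g z : cnil (map_ch g z) = cnil z.
Proof.
move: z; apply: lin_ext => [||w]; [lin|lin|].
by rewrite map_gen !cnil_gen; case: w.
Qed.

End MapWords.

Lemma map_comp_ch (F : fieldType) (X Y Z : choiceType) (g : Y -> Z) (f : X -> Y)
  (z : malg (seq X) F) : map_ch g (map_ch f z) = map_ch (g \o f) z.
Proof.
move: z; apply: lin_ext => [||w]; [lin|lin|].
by rewrite !map_gen map_comp.
Qed.

Lemma map_id_ch (F : fieldType) (X : choiceType) (z : malg (seq X) F) : map_ch id z = z.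
Proof.
move: z; apply: lin_ext => [||w]; [lin|lin|].
by rewrite map_gen map_id.
Qed.

(** * Words hitting the blocks of a partition *)

Section Blocks.
Local Open Scope ring_scope.
Variable F : fieldType.
Variable Y : finType.
Local Notation T := (malg (seq Y) F).
Implicit Types (z : T) (y : Y) (w : seq Y) (A : {set Y}) (s t : seq {set Y}).

Definition ind A : Y -> F := fun y => (y \in A)%:R.

Fixpoint iotas s z : T := if s is A :: s' then iotas s' (iota_ch (ind A) z) else z.

Lemma iotas_linear s : linear (iotas s).
Proof. by elim: s => [//|A s IH] a u v /=; rewrite linearP IH. Qed.
HB.instance Definition _ s := GRing.isLinear.Build F T T *:%R (iotas s) (iotas_linear s).

(* Words with exactly one letter in each block of [s], counted with the sign of
   the order in which the blocks occur. *)
Definition eps s : T -> F^o := fun z => cnil (iotas s z).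
HB.instance Definition _ s := GRing.isLinear.Build F T F^o *:%R (eps s)
  (linear_compf cnil (iotas_linear s)).

Definition hits s w := all (fun A => has (mem A) w) s.

Lemma iota0 (f : Y -> F) z : spt (fun w => {in w, forall y, f y = 0}) z -> iota_ch f z = 0.
Proof.
move: z; apply: (lin_extP (g := fun=> 0)) => [||w]; [lin|lin|].
elim: w => [|y w IH] H; first by rewrite iota_nil.
have e : iota_ch f (gen w) = 0 by apply: IH => x xw; apply: H; rewrite inE xw orbT.
by rewrite -cons_gen iota_cons H ?mem_head // e linear0 scale0r subr0.
Qed.

Lemma cnil0 z : spt (fun w => w != [::]) z -> cnil z = 0 :> F^o.
Proof.
move: z; apply: (lin_extP (g := fun=> 0)) => [||w]; [lin|lin|].
by rewrite cnil_gen => /negbTE ->.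
Qed.

Lemma spt_iota_sub (P : seq Y -> Prop) (f : Y -> F) z :
  (forall w1 y w2, P (w1 ++ y :: w2) -> f y != 0 -> P (w1 ++ w2)) ->
  spt P z -> spt P (iota_ch f z).
Proof. by move=> H; exact: spt_iota. Qed.

Lemma ind_neq0 A y : ind A y != 0 -> y \in A.
Proof. by rewrite /ind; case: (y \in A); rewrite ?eqxx. Qed.

(** Deleting letters never creates a letter of a missing block, so the contraction by that block
    finds nothing. *)
Lemma iotas_nothit s z : spt (fun w => ~~ hits s w) z -> iotas s z = 0.
Proof.
move: z; apply: (lin_extP (g := fun=> 0)) => [||w]; [lin|lin|].
move=> /allPn[A As nA].
have : spt (F := F) (fun w => ~~ has (mem A) w) (gen w) by exact: spt_gen.
move: (gen w); elim: s As => [//|B s IH]; rewrite inE => /orP[/eqP <-|As] z Pz /=.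
  rewrite (iota0 (z := z)) ?linear0 //.
  by apply: spt_sub Pz => v /hasPn H y /H; rewrite /ind /= => /negbTE ->.
apply: (IH As); apply: spt_iota_sub Pz => w1 y w2.
by rewrite !has_cat /= !negb_or => /and3P[-> _ ->].
Qed.

Lemma eps_nothit s z : spt (fun w => ~~ hits s w) z -> eps s z = 0.
Proof. by move=> /iotas_nothit e; rewrite /eps e linear0. Qed.

Lemma spt_iotas (P : seq Y -> Prop) s z :
  (forall A w1 y w2, A \in s -> P (w1 ++ y :: w2) -> y \in A -> P (w1 ++ w2)) ->
  spt P z -> spt P (iotas s z).
Proof.
elim: s z => [//|A s IH] z H Pz /=; apply: IH.
  by move=> B w1 y w2 Bs; apply: (H B); rewrite inE Bs orbT.
apply: spt_iota_sub Pz => w1 y w2 Pw /ind_neq0; apply: (H A) => //.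
exact: mem_head.
Qed.

Lemma eps_eq_ind (I : Type) (r : seq I) (f g : I -> {set Y}) z :
  spt (all (fun y => all (fun i => (y \in f i) == (y \in g i)) r)) z ->
  eps [seq f i | i <- r] z = eps [seq g i | i <- r] z.
Proof.
rewrite /eps; elim: r z => [//|i r IH] z Pz /=.
have -> : iota_ch (ind (f i)) z = iota_ch (ind (g i)) z.
  move: z Pz; apply: lin_extP => [||w]; [lin|lin|].
  elim: w => [|y w IHw]; first by rewrite !iota_nil.
  rewrite /= => /andP[/andP[/eqP fg _] Hw]; have e : ind (f i) y = ind (g i) y :> F by rewrite /ind fg.
  by rewrite -cons_gen !iota_cons IHw // e.
apply: IH; apply: spt_iota Pz => w1 y w2 /allP H _; apply/allP => x xw.
have /H /= /andP[_ //] : x \in w1 ++ y :: w2.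
by move: xw; rewrite !mem_cat inE => /orP[->|->]; rewrite ?orbT.
Qed.

(** A letter outside all blocks is never contracted, so the empty word is not reached. *)
Lemma eps_outside s z :
  spt (fun w => has (fun y => all (fun A => y \notin A) s) w) z -> eps s z = 0.
Proof.
elim: s z => [|A s IH] z Pz.
  by rewrite /eps /= cnil0 //; apply: spt_sub Pz; case.
rewrite /eps /=; apply: IH; apply: spt_iota Pz => w1 y w2 /= H /ind_neq0 yA.
move: H; rewrite !has_cat /= yA /= => /orP[] /hasP[x xw /andP[_ xs]]; apply/orP; [left|right].
  by apply/hasP; exists x.
by apply/hasP; exists x.
Qed.

Lemma eps_size s z : spt (fun w => size w != size s) z -> eps s z = 0.
Proof.
elim: s z => [|A s IH] z Pz.
  by rewrite /eps /= cnil0 //; apply: spt_sub Pz; case.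
rewrite /eps /=; apply: IH; apply: spt_iota Pz => w1 y w2 /= H _.
by move: H; rewrite !size_cat /= addnS eqSS.
Qed.

(** Anticommutation brings the new contraction next to its copy in [s], where the square
    vanishes. *)
Lemma iotas_iota s A z : A \in s -> iotas s (iota_ch (ind A) z) = 0.
Proof.
elim: s z => [//|B s IH] z; rewrite inE /=.
have [->|neq] /= := eqVneq A B; first by move=> _; rewrite iota_sq !linear0.
by move=> As; rewrite iota_iota !linearN /= (IH _ As) oppr0.
Qed.

Lemma eps_iota s A z : A \in s -> eps s (iota_ch (ind A) z) = 0.
Proof. by move=> As; rewrite /eps iotas_iota // linear0. Qed.

Lemma iotas_anti s f z :
  iotas s (iota_ch f z) = (-1) ^+ size s *: iota_ch f (iotas s z).
Proof.
elim: s z => [|B s IH] z /=; first by rewrite scale1r.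
by rewrite iota_iota linearN /= IH exprS mulN1r scaleNr.
Qed.

Lemma iotas_cat s t z : iotas (s ++ t) z = iotas t (iotas s z).
Proof. by elim: s z => [//|A s IH] z /=. Qed.

Lemma restr_restr (P Q : pred (seq Y)) z :
  restr P (restr Q z) = restr (fun w => P w && Q w) z.
Proof.
move: z; apply: lin_ext => [||w]; [lin|lin|].
by rewrite !restr_gen; case: (Q w); rewrite ?linear0 ?restr_gen ?andbT ?andbF.
Qed.

Lemma eq_restr (P Q : pred (seq Y)) z : P =1 Q -> restr P z = restr Q z.
Proof. by move=> /funext ->. Qed.

Lemma restr_split (P Q : pred (seq Y)) z :
  restr P z = restr (fun w => P w && Q w) z + restr (fun w => P w && ~~ Q w) z.
Proof.
move: z; apply: lin_ext => [||w]; [lin|lin|].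
by rewrite !restr_gen /=; case: (P w); case: (Q w); rewrite ?addr0 ?add0r.
Qed.

Lemma spt_restrP (P : pred (seq Y)) z : spt (fun w => P w) (restr P z).
Proof.
apply: (spt_lift (P := fun=> True)) => [w _|]; last exact: sptT.
by case: ifP => Pw; [exact: spt_gen|exact: spt0].
Qed.

Lemma chain_split (P : pred (seq Y)) z : z = restr P z + restr (fun w => ~~ P w) z.
Proof.
move: z; apply: lin_ext => [||w]; [lin|lin|].
by rewrite !restr_gen /=; case: (P w); rewrite ?addr0 ?add0r.
Qed.

Lemma eps_restr s z : eps s (restr (hits s) z) = eps s z.
Proof.
rewrite [in RHS](chain_split (hits s) z) linearD /= [X in _ + X]eps_nothit ?addr0 //.
exact: (spt_restrP (P := fun w => ~~ hits s w)).
Qed.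

Lemma hits_del s w1 y w2 : hits s (w1 ++ w2) -> hits s (w1 ++ y :: w2).
Proof.
by apply: sub_all => A; rewrite !has_cat /= => /orP[->|->]; rewrite ?orbT.
Qed.

Lemma restr_bd_restr s z :
  restr (hits s) (bd (restr (hits s) z)) = restr (hits s) (bd z).
Proof.
rewrite [in RHS](chain_split (hits s) z) !linearD /= [X in _ = _ + X]restr0 ?addr0 //.
apply: (spt_bd (P := fun w => ~~ hits s w)).
  by move=> w1 y w2; apply: contra; exact: hits_del.
exact: (spt_restrP (P := fun w => ~~ hits s w)).
Qed.

Definition once s y := count (fun A => y \in A) s == 1%N.

(** The indicators of the blocks sum to the constant weight 1, and contraction is additive in the
    weight. *)
Lemma bd_iota s z : spt (all (once s)) z ->
  bd z = \sum_(A <- s) iota_ch (ind A) z.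
Proof.
move=> zs; rewrite -iota_suml; move: z zs; apply: lin_extP => [||w]; [lin|lin|].
elim: w => [|y w IH]; first by rewrite bd_nil iota_nil.
move=> /= /andP[ys ws]; rewrite -cons_gen bd_cons iota_cons IH //.
have -> : \sum_(A <- s) ind A y = 1 :> F; last by rewrite scale1r.
rewrite /ind -natr_sum -[RHS]/(1%:R); congr _%:R.
by rewrite -(eqP ys) -sum1_count [RHS]big_mkcond.
Qed.

Lemma eps_bd s z : spt (all (once s)) z -> eps s (bd z) = 0.
Proof.
move=> /bd_iota ->; rewrite linear_sum big_seq big1 // => A As.
exact: eps_iota.
Qed.

Definition disj s := forall y, (count (fun A => (y : Y) \in A) s <= 1)%N.

Lemma count_gt0 s A y : A \in s -> y \in A -> (0 < count (fun A => y \in A) s)%N.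
Proof. by move=> As yA; rewrite -has_count; apply/hasP; exists A. Qed.

(** Consider words on the blocks [t :: s] that hit [s]. They form a contractible complex, because
    prepending a letter of [t] does not affect which blocks of [s] are hit. Its subcomplex without
    letters of [t] is the complex of [s], and the quotient is that of [t :: s]. The induction
    carries out the connecting homomorphism by hand; composing it with [eps s] gives
    [eps (t :: s)]. *)
Lemma blocks_exact s z : disj s -> (forall A, A \in s -> exists y, y \in A) ->
  spt (fun w => hits s w /\ all (once s) w) z ->
  restr (hits s) (bd z) = 0 -> eps s z = 0 ->
  exists2 u, spt (fun w => hits s w /\ all (once s) w) u &
    restr (hits s) (bd u) = z.
Proof.
elim: s z => [|t s IH] z.
  (* Without blocks [once] fails on every letter, so only the empty word can occur in [z]. *)
  move=> _ _ Pz _ e0; exists 0; first exact: spt0.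
  rewrite !linear0; apply/esym.
  have -> : z = cnil z *: gen [::].
    move: z Pz {e0}; apply: lin_extP => [||w [_]]; [lin| |].
      by move=> a u v; rewrite linearP /= scalerDl scalerA.
    by case: w => //= _; rewrite cnil_gen scale1r.
  by move: e0; rewrite /eps /= => ->; rewrite scale0r.
move=> dj ne Pz dz ez.
have dj' : disj s by move=> y; apply: leq_trans (dj y); rewrite /= leq_addl.
have tNs y A : y \in t -> A \in s -> y \notin A.
  move=> yt As; apply/negP => yA; have := dj y; rewrite /= yt.
  by rewrite leqNgt ltnS (count_gt0 As yA).
have once_t y : once (t :: s) y -> y \notin t -> once s y.
  by rewrite /once /= => /eqP <- /negbTE ->.
pose x := restr (hits s) (bd z).
have hE w : hits (t :: s) w = has (mem t) w && hits s w by [].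
have bz : spt (all (once (t :: s))) (bd z).
  apply: (spt_bd (P := all (once (t :: s)))).
    by move=> w1 y w2; rewrite !all_cat /= => /and3P[-> _ ->].
  by apply: spt_sub Pz => w [].
have xP : spt (fun w => hits s w /\ all (once s) w) x.
  rewrite /x (restr_split _ (fun w => has (mem t) w)).
  rewrite [X in X + _](_ : _ = 0) ?add0r; last first.
    by rewrite -[RHS]dz; apply: eq_restr => w; exact: andbC.
  apply: spt_sub (spt_restr bz) => w [ow /= /andP[hw tw]]; split => //.
  apply/allP => y yw; apply: once_t; first exact: (allP ow).
  by move/hasPn: tw => /(_ _ yw).
have dx : restr (hits s) (bd x) = 0.
  by rewrite /x restr_bd_restr bd_bd linear0.
have ex : eps s x = 0.
  rewrite /x eps_restr (bd_iota (s := t :: s)); last by apply: spt_sub Pz => w [].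
  rewrite big_cons linearD /= -[eps s _]/(eps (t :: s) z) ez add0r.
  by rewrite linear_sum big_seq big1 // => A As; exact: eps_iota.
have ne' A : A \in s -> exists y, y \in A by move=> As; apply: ne; rewrite inE As orbT.
have [u' Pu' du'] := IH x dj' ne' xP dx ex.
have [e et] := ne t (mem_head _ _).
pose v := z - u'.
have Pv : spt (fun w => hits s w /\ all (once (t :: s)) w) v.
  apply: sptB; first by apply: spt_sub Pz => w []; rewrite hE => /andP[].
  apply: spt_sub Pu' => w [hw /allP ow]; split=> //; apply/allP => y /ow.
  rewrite /once /= => /eqP oy; rewrite oy; case: (boolP (y \in t)) => // yt.
  by have := dj y; rewrite /= oy yt.
have dv : restr (hits s) (bd v) = 0 by rewrite /v !linearB /= du' -/x subrr.
have rcons q : restr (hits s) (cons_ch e q) = cons_ch e (restr (hits s) q).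
  move: q; apply: lin_ext => [||w]; [lin|lin|].
  rewrite cons_gen !restr_gen (_ : hits s (e :: w) = hits s w).
    by case: ifP; rewrite ?cons_gen ?linear0.
  by apply: eq_in_all => A As /=; rewrite (negbTE (tNs _ _ et As)).
have du : restr (hits s) (bd (cons_ch e v)) = v.
  rewrite bd_cons linearB /= rcons dv linear0 subr0 restr_id //.
  by apply: spt_sub Pv => w [].
exists (restr (hits (t :: s)) (cons_ch e v)).
  have Pu : spt (all (once (t :: s))) (cons_ch e v).
    apply: (spt_cons (P := all (once (t :: s)))); last by apply: spt_sub Pv => w [].
    move=> w /= ->; rewrite andbT /once /= et add1n eqSS; apply/eqP.
    by apply/eqP; rewrite -leqn0; have := dj e; rewrite /= et add1n ltnS.
  by apply: spt_sub (spt_restr Pu) => w [].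
rewrite restr_bd_restr.
have rr (q : T) : restr (hits (t :: s)) q = restr (hits (t :: s)) (restr (hits s) q).
  by rewrite restr_restr; apply: eq_restr => w /=; rewrite -andbA andbb.
rewrite rr du /v linearB /= restr_id; last by apply: spt_sub Pz => w [].
rewrite restr0 ?subr0 //; apply: spt_sub Pu' => w [hw /allP ow].
rewrite hE hw andbT; apply/hasPn => y /ow /eqP oy; apply/negP => /= yt.
by have := dj y; rewrite /= oy yt.
Qed.

Lemma iotas_rem s A : A \in s -> exists b : bool, forall z,
  iotas s z = (-1) ^+ b *: iotas (A :: rem A s) z.
Proof.
elim: s => [//|B s IH]; rewrite inE /=.
have [->|neq] /= := eqVneq A B.
  by exists false => z; rewrite scale1r.
move=> /IH[b bE]; exists (~~ b) => z.
by rewrite bE /= iota_iota !linearN /= signrN scaleNr.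
Qed.

Lemma iotas_perm s t : perm_eq s t -> exists b : bool, forall z,
  iotas s z = (-1) ^+ b *: iotas t z.
Proof.
elim: s t => [|A s IH] t st.
  exists false => z; rewrite scale1r; move: st; rewrite perm_sym => /perm_nilP ->.
  by [].
have At : A \in t by rewrite -(perm_mem st) mem_head.
have [b bE] := iotas_rem At.
have /IH[c cE] : perm_eq s (rem A t).
  by rewrite -(perm_cons A); apply: perm_trans st _; exact: perm_to_rem.
exists (b (+) c) => z; rewrite bE /= cE scalerA signr_addb mulrAC -expr2 sqrr_sign.
by rewrite mul1r.
Qed.

Lemma eps_perm s t : perm_eq s t -> exists b : bool, forall z,
  eps s z = (-1) ^+ b * eps t z.
Proof. by move=> /iotas_perm[b bE]; exists b => z; rewrite /eps bE linearZ. Qed.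

End Blocks.
Arguments eps {F Y} s z.
Arguments iotas {F Y} s z.
Arguments ind {F Y} A _.

Section BlocksMap.
Local Open Scope ring_scope.
Variable F : fieldType.

Section Map.
Variables X Y : finType.
Variable (g : X -> Y).
Implicit Types (z : malg (seq X) F) (s : seq {set Y}).

Lemma iotas_map s z :
  iotas s (map_ch g z) = map_ch g (iotas [seq g @^-1: A | A : {set Y} <- s] z).
Proof.
elim: s z => [//|A s IH] z /=; rewrite -IH iota_map; congr (iotas _ (map_ch _ _)).
by apply: eq_iota => y; rewrite /ind /= inE.
Qed.

Lemma eps_map s z :
  eps s (map_ch g z) = eps [seq g @^-1: A | A : {set Y} <- s] z.
Proof. by rewrite /eps iotas_map cnil_map. Qed.

Lemma hits_map s w :
  hits s (map g w) = hits [seq g @^-1: A | A : {set Y} <- s] w.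
Proof.
rewrite /hits all_map; apply: eq_all => A /=; rewrite has_map.
by apply: eq_has => y /=; rewrite inE.
Qed.

End Map.

Section Perm.
Variable Y : finType.
Implicit Types (z : malg (seq Y) F) (s : seq {set Y}).

(** Permuting the blocks costs a sign e. Iterating p times brings [g] back to the identity, so e^p
    acts as 1; in characteristic p, Frobenius gives e^p = e. *)
Lemma iotas_map_inv (p : nat) (g : Y -> Y) s z : p \in [pchar F] ->
  (forall y, iter p g y = y) -> perm_eq [seq g @^-1: A | A : {set Y} <- s] s ->
  iotas s (map_ch g z) = map_ch g (iotas s z).
Proof.
move=> charFp gp /(@iotas_perm F)[b bE].
have gb (x : malg (seq Y) F) : iotas s (map_ch g x) = (-1) ^+ b *: map_ch g (iotas s x).
  by rewrite iotas_map bE linearZ.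
have gk k (x : malg (seq Y) F) : iotas s (map_ch (iter k g) x) = ((-1) ^+ b) ^+ k *: map_ch (iter k g) (iotas s x).
  elim: k => [|k IH].
    by rewrite scale1r (_ : iter 0 g = id) ?map_id_ch.
  rewrite (_ : iter k.+1 g = g \o iter k g); last exact/funext.
  by rewrite -!(map_comp_ch g (iter k g)) gb IH (linearZZ (map_ch g)) /= scalerA exprS.
have idp : iter p g = id by apply/funext => y; rewrite gp.
have sp : ((-1) ^+ b) ^+ p = (-1) ^+ b :> F.
  rewrite -exprM mulnC exprM (_ : (-1) ^+ p = -1 :> F) //.
  by rewrite -pFrobenius_autE rmorphN1.
by have := gk p z; rewrite idp !map_id_ch sp gb -(linearZZ (map_ch g)) /= => <-.
Qed.

Lemma eps_map_inv (p : nat) (g : Y -> Y) s z : p \in [pchar F] ->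
  (forall y, iter p g y = y) -> perm_eq [seq g @^-1: A | A : {set Y} <- s] s ->
  eps s (map_ch g z) = eps s z.
Proof. by move=> ? ? ?; rewrite /eps (@iotas_map_inv p) // cnil_map. Qed.

Lemma hits_perm s t (w : seq Y) : perm_eq s t -> hits s w = hits t w.
Proof. by move=> st; rewrite /hits (perm_all _ st). Qed.

Lemma restr_hits_map (g : Y -> Y) s z :
  perm_eq [seq g @^-1: A | A : {set Y} <- s] s ->
  restr (hits s) (map_ch g z) = map_ch g (restr (hits s) z).
Proof.
move=> gs; move: z; apply: lin_ext => [||w]; [lin|lin|].
rewrite map_gen !restr_gen hits_map (hits_perm _ gs).
by case: ifP => _; rewrite ?map_gen ?linear0.
Qed.

End Perm.
End BlocksMap.

(** * Tensor products of periodic resolutions *)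

Section MultiIndex.
Local Open Scope ring_scope.
Variables (F : fieldType) (p nu : nat).
Local Notation idx := {ffun 'I_nu -> nat}.
Implicit Types (a b : idx) (i j : 'I_nu).

Definition mabs a : nat := (\sum_i a i)%N.

(** The truncation at 0 is harmless: [decr i a] is read through [theta] in degree [a i], and [theta]
    is zero in degree 0. *)
Definition decr i a : idx := [ffun j => (a j - (j == i))%N].

Lemma decr_eq i a : decr i a i = (a i).-1.
Proof. by rewrite ffunE eqxx subn1. Qed.

Lemma decr_neq i j a : j != i -> decr i a j = a j.
Proof. by move=> /negbTE ji; rewrite ffunE ji subn0. Qed.

Lemma decrC i j a : decr i (decr j a) = decr j (decr i a).
Proof. by apply/ffunP => k; rewrite !ffunE subnAC. Qed.

Lemma mabs_decr i a : (0 < a i)%N -> (mabs (decr i a)).+1 = mabs a.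
Proof.
move=> ai; rewrite /mabs (bigD1 i) //= [RHS](bigD1 i) //= decr_eq -addSn prednK //.
by congr addn; apply: eq_bigr => j ji; rewrite decr_neq.
Qed.

Definition sg i a : F := (-1) ^+ (\sum_(j < nu | (j < i)%N) a j)%N.

Lemma sg_decr i j a : i != j -> (0 < a i)%N ->
  sg j (decr i a) = (if (i < j)%N then -1 else 1) * sg j a.
Proof.
move=> ij ai; rewrite /sg; case: ifP => [lij|lij]; last first.
  rewrite mul1r; congr (_ ^+ _); apply: eq_bigr => k kj; rewrite decr_neq //.
  by apply: contraFneq lij => <-.
rewrite -[-1 in RHS]expr1 -exprD (bigD1 i) //= [in RHS](bigD1 i) //=.
rewrite decr_eq addnA (@eq_bigr _ _ _ _ _ _ _ a); last first.
  by move=> k /andP[_ ki]; rewrite decr_neq.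
rewrite -[in RHS](prednK ai) add1n addSn [in RHS]exprS [in RHS]addSn [in RHS]exprS.
by rewrite mulrA mulrNN !mul1r.
Qed.

Section Operators.
Variables (M : lmodType F) (T : 'I_nu -> M -> M).

(* The maps of the periodic resolution of Z/p: T - 1 in odd degrees and the
   norm 1 + T + ... + T^(p-1) in even positive degrees. *)
Definition theta i (k : nat) (x : M) : M :=
  if k == 0%N then 0 else if odd k then T i x - x
  else \sum_(j < p) iter j (T i) x.

(** If [y a] is the image of the free generator of multidegree [a], this is the image of the
    boundary of that generator. Thus [D (y a) = dtot T y a] says that [y] is an equivariant chain
    map out of the tensor product of resolutions. *)
Definition dtot (y : idx -> M) a : M :=
  \sum_i sg i a *: theta i (a i) (y (decr i a)).

Lemma theta_k0 i x : theta i 0 x = 0. Proof. by []. Qed.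

Hypothesis T_lin : forall i, linear (T i).

Lemma iterT_lin i k : linear (iter k (T i)).
Proof. by elim: k => [//|k IH] c x y; rewrite !iterS IH T_lin. Qed.

Lemma theta_lin i k : linear (theta i k).
Proof.
rewrite /theta; case: (k == 0%N); first exact: linear_zerof.
case: (odd k).
  by apply: linear_addf; [exact: T_lin|apply: linear_oppf; exact: linear_idf].
by apply: linear_sumf => j; exact: iterT_lin.
Qed.

Lemma theta0 i k : theta i k 0 = 0.
Proof. by have := theta_lin i k (-1) 0 0; rewrite scaler0 addr0 scaleN1r addNr. Qed.

Lemma thetaZ i k c x : theta i k (c *: x) = c *: theta i k x.
Proof. by have := theta_lin i k c x 0; rewrite theta0 !addr0. Qed.

Lemma thetaD i k x y : theta i k (x + y) = theta i k x + theta i k y.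
Proof. by have := theta_lin i k 1 x y; rewrite !scale1r. Qed.

Lemma thetaN i k x : theta i k (- x) = - theta i k x.
Proof. by rewrite -scaleN1r thetaZ scaleN1r. Qed.

Lemma theta_sum i k (I : Type) (r : seq I) (P : pred I) (f : I -> M) :
  theta i k (\sum_(j <- r | P j) f j) = \sum_(j <- r | P j) theta i k (f j).
Proof.
elim: r => [|j r IH]; first by rewrite !big_nil theta0.
by rewrite !big_cons; case: (P j); rewrite ?thetaD IH.
Qed.

Lemma eq_dtot (y y' : idx -> M) a :
  (forall i, (0 < a i)%N -> y (decr i a) = y' (decr i a)) -> dtot y a = dtot y' a.
Proof.
move=> H; apply: eq_bigr => i _; congr (_ *: _).
have [->|ai] := posnP (a i); first by rewrite /theta.
by rewrite H.
Qed.

Lemma dtotB (y y' : idx -> M) a : dtot (fun b => y b - y' b) a = dtot y a - dtot y' a.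
Proof.
by rewrite -sumrB; apply: eq_bigr => i _; rewrite thetaD thetaN scalerBr.
Qed.

Lemma dtot0 a : dtot (fun=> 0) a = 0.
Proof. by apply: big1 => i _; rewrite theta0 scaler0. Qed.

End Operators.

Lemma theta_morph (M N : lmodType F) (T : 'I_nu -> M -> M) (T' : 'I_nu -> N -> N)
    (h : M -> N) i k x : linear h -> (forall x, h (T i x) = T' i (h x)) ->
  h (theta T i k x) = theta T' i k (h x).
Proof.
move=> lh hT; pose H : {linear M -> N} := HB.pack h (GRing.isLinear.Build F M N *:%R h lh).
rewrite -[h]/(H : M -> N) /theta; case: eqP => _; first by rewrite linear0.
case: (odd k); first by rewrite linearB /= hT.
rewrite linear_sum; apply: eq_bigr => j _ /=.
by elim: (j : nat) => [//|m IH]; rewrite !iterS hT IH.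
Qed.

Lemma dtot_morph (M N : lmodType F) (T : 'I_nu -> M -> M) (T' : 'I_nu -> N -> N)
    (h : M -> N) y a : linear h -> (forall i x, h (T i x) = T' i (h x)) ->
  h (dtot T y a) = dtot T' (h \o y) a.
Proof.
move=> lh hT; pose H : {linear M -> N} := HB.pack h (GRing.isLinear.Build F M N *:%R h lh).
rewrite -[h]/(H : M -> N) linear_sum; apply: eq_bigr => i _.
by rewrite linearZ; congr (_ *: _); exact: theta_morph.
Qed.

(** For the trivial action T - 1 is zero and the norm is multiplication by p. *)
Lemma theta_id (N : lmodType F) i k (x : N) : p \in [pchar F] ->
  theta (fun _ => id) i k x = 0.
Proof.
move=> charFp; rewrite /theta; case: eqP => // _; case: (odd k); first by rewrite subrr.
rewrite (eq_bigr (fun=> x)); last by move=> j _; elim: (j : nat).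
by rewrite sumr_const card_ord -scaler_nat pcharf0 // scale0r.
Qed.

Lemma dtot_id (N : lmodType F) (y : idx -> N) a : p \in [pchar F] ->
  dtot (fun _ => id) y a = 0.
Proof. by move=> charFp; apply: big1 => i _; rewrite theta_id // scaler0. Qed.

Section Square.
Variables (M : lmodType F) (T : 'I_nu -> M -> M).
Hypothesis T_lin : forall i, linear (T i).
Hypothesis TC : forall i j x, T i (T j x) = T j (T i x).
Hypothesis Tp : forall i x, iter p (T i) x = x.

Lemma theta_comm i j k l x : theta T i k (theta T j l x) = theta T j l (theta T i k x).
Proof.
apply: theta_morph => [|{}x]; first exact: theta_lin.
by apply/esym/theta_morph.
Qed.

Lemma theta_sq i k x : theta T i k (theta T i k.-1 x) = 0.
Proof.
(* The product of T - 1 with the norm telescopes to T^p - 1. *)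
have N0 z : T i (\sum_(j < p) iter j (T i) z) - \sum_(j < p) iter j (T i) z = 0.
  have -> : T i (\sum_(j < p) iter j (T i) z) = \sum_(j < p) iter j.+1 (T i) z.
    pose H : {linear M -> M} := HB.pack (T i) (GRing.isLinear.Build F M M *:%R (T i) (T_lin i)).
    by rewrite -[T i]/(H : M -> M) linear_sum.
  by rewrite -(big_mkord xpredT (fun m : nat => iter m.+1 (T i) z))
     -(big_mkord xpredT (fun m : nat => iter m (T i) z)) -sumrB telescope_sumr //= Tp subrr.
case: k => [//|[|k]]; first by rewrite [theta T i 0 x]/theta /= theta0.
rewrite /=.
have [kodd|keven] := boolP (odd k).
  by rewrite {1}/theta /= kodd /theta /= kodd /= N0.
by rewrite theta_comm {1}/theta /= (negbTE keven) /= /theta /= (negbTE keven) /= N0.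
Qed.

Lemma dtot_dtot (y : idx -> M) a : dtot T (dtot T y) a = 0.
Proof.
pose G i j : M := sg i a *: theta T i (a i)
   (sg j (decr i a) *: theta T j (decr i a j) (y (decr j (decr i a)))).
have -> : dtot T (dtot T y) a = \sum_i \sum_j G i j.
  by apply: eq_bigr => i _; rewrite theta_sum // scaler_sumr.
have Gii i : G i i = 0.
  by rewrite /G thetaZ // decr_eq theta_sq // !scaler0.
have Gij i j : (i < j)%N -> G i j = - G j i.
  move=> ij; have nij : i != j by apply: contraTneq ij => ->; rewrite ltnn.
  have nji : j != i by rewrite eq_sym.
  rewrite /G !thetaZ // !decr_neq // !scalerA decrC theta_comm.
  have [ai0|ai] := posnP (a i).
    by rewrite ai0 !theta_k0 ?theta0 // !scaler0 oppr0.
  have [aj0|aj] := posnP (a j).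
    by rewrite aj0 !theta_k0 ?theta0 // !scaler0 oppr0.
  rewrite !sg_decr // ij ltnNge (ltnW ij) /= mul1r mulN1r mulrN scaleNr.
  by rewrite (mulrC (sg i a)).
rewrite (eq_bigr (fun i => \sum_(j : 'I_nu | (i < j)%N) G i j + \sum_(j : 'I_nu | (j < i)%N) G i j)).
  rewrite big_split /= [X in _ + X](exchange_big_dep xpredT) //= -big_split /=.
  apply: big1 => i _; rewrite -big_split /=; apply: big1 => j ij.
  by rewrite Gij // addNr.
move=> i _; rewrite (bigID (fun j : 'I_nu => (i < j)%N)) /=; congr (_ + _).
rewrite (bigD1 i) ?ltnn //= Gii add0r; apply: eq_bigl => j.
by rewrite -leqNgt ltn_neqAle andbC.
Qed.

End Square.

Section Lift.
Variables (M : lmodType F) (T : 'I_nu -> M -> M) (D : M -> M) (e : M -> F^o).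
Hypothesis charFp : p \in [pchar F].
Hypothesis T_lin : forall i, linear (T i).
Hypothesis TC : forall i j x, T i (T j x) = T j (T i x).
Hypothesis Tp : forall i x, iter p (T i) x = x.
Hypothesis D_lin : linear D.
Hypothesis DT : forall i x, D (T i x) = T i (D x).
Hypothesis e_lin : linear e.
Hypothesis eT : forall i x, e (T i x) = e x.
Variables (deg : nat -> M -> Prop) (r : nat).
Hypothesis deg0 : forall n, deg n 0.
Hypothesis degZD : forall n c x y, deg n x -> deg n y -> deg n (c *: x + y).
Hypothesis degT : forall n i x, deg n x -> deg n (T i x).
Hypothesis D_exact : forall n z, (n < r)%N -> deg n z -> D z = 0 -> e z = 0 ->
  exists2 u, deg n.+1 u & D u = z.
Variable S : idx -> Prop.
Hypothesis S_down : forall a i, S a -> (0 < a i)%N -> S (decr i a).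
Hypothesis S_bnd : forall a, S a -> (mabs a < r)%N.

Let degD n x y : deg n x -> deg n y -> deg n (x + y).
Proof. by move=> dx dy; rewrite -(scale1r x); exact: degZD. Qed.

Let degZ n c x : deg n x -> deg n (c *: x).
Proof. by move=> dx; rewrite -(addr0 (_ *: _)); exact: degZD. Qed.

Let deg_sum n (I : Type) (s : seq I) (f : I -> M) :
  (forall k, deg n (f k)) -> deg n (\sum_(i <- s) f i).
Proof. by move=> H; elim/big_rec: _ => // k x _; exact: degD. Qed.

Let deg_theta n i k x : deg n x -> deg n (theta T i k x).
Proof.
move=> dx; rewrite /theta; case: eqP => // _; case: (odd k).
  by apply: degD; [exact: degT|rewrite -scaleN1r; exact: degZ].
by apply: deg_sum => j; elim: (j : nat) => [//|m IH]; rewrite iterS; exact: degT.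
Qed.

(** The comparison theorem for free resolutions: a chain map not detected by [e] is null-homotopic.
    The homotopy is built by recursion on the total degree; the obstruction [g a - dtot T h a] is a
    cycle by [dtot_dtot], and [e] kills it because [e] is invariant and the action on scalars is
    trivial. The predicate [deg] is abstract: it is the word length for injective words, and a
    support condition independent of the degree for blocks. *)
Lemma lift_family (g : idx -> M) :
  (forall a, S a -> deg (mabs a) (g a)) ->
  (forall a, S a -> D (g a) = dtot T g a) ->
  (forall a, S a -> e (g a) = 0) ->
  exists h : idx -> M, forall a, S a ->
    deg (mabs a).+1 (h a) /\ D (h a) = g a - dtot T h a.
Proof.
move=> dg Dg eg.
suff main n : exists h : idx -> M, forall a, S a -> (mabs a < n)%N ->
    deg (mabs a).+1 (h a) /\ D (h a) = g a - dtot T h a.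
  by have [h hP] := main r; exists h => a Sa; apply: hP => //; exact: S_bnd.
elim: n => [|n [h hP]]; first by exists (fun=> 0).
have step a : exists u, S a -> mabs a = n ->
    deg (mabs a).+1 u /\ D u = g a - dtot T h a.
  have [[Sa an]|nS] := pselect (S a /\ mabs a = n); last first.
    by exists 0 => Sa an; case: nS.
  have lt i : (0 < a i)%N -> (mabs (decr i a) < n)%N by rewrite -an => /mabs_decr <-.
  have [||||u du Du] := @D_exact (mabs a) (g a - dtot T h a).
  - exact: S_bnd.
  - apply: degD; first exact: dg.
    rewrite -scaleN1r; apply: degZ; apply: deg_sum => i; apply: degZ.
    have [->|ai] := posnP (a i); first by rewrite /theta /=.
    apply: deg_theta; rewrite -(mabs_decr ai).
    by case: (hP (decr i a) (S_down Sa ai) (lt i ai)).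
  - rewrite (_ : D _ = D (g a) - D (dtot T h a)); last first.
      by rewrite addrC -scaleN1r D_lin scaleN1r addrC.
    rewrite Dg // (dtot_morph (T' := T)) //.
    rewrite (@eq_dtot _ _ (D \o h) (fun b => g b - dtot T h b)); last first.
      by move=> i ai /=; case: (hP (decr i a) (S_down Sa ai) (lt i ai)).
    by rewrite dtotB // dtot_dtot // subr0 subrr.
  - rewrite (_ : e _ = e (g a) - e (dtot T h a)); last first.
      by rewrite addrC -scaleN1r e_lin scaleN1r addrC.
    by rewrite eg // (dtot_morph (T' := fun _ => id)) // dtot_id // subrr.
  by exists u => _ _.
have [u uP] := choice step.
(* Only total degree n is overwritten. In degrees at most n, [dtot] reads strictly lower ones, so
   the equations already obtained persist. *)
exists (fun a => if mabs a == n then u a else h a) => a Sa.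
rewrite ltnS leq_eqVlt.
have dE : (mabs a <= n)%N ->
    dtot T (fun b => if mabs b == n then u b else h b) a = dtot T h a.
  move=> an; apply: eq_dtot => i ai; rewrite ifN //.
  by move: an; rewrite -(mabs_decr ai) => /ltn_eqF ->.
case: eqVneq => [an _|an /= lan]; first by rewrite (dE (eq_leq an)); exact: uP.
by rewrite (dE (ltnW lan)); exact: hP.
Qed.

End Lift.
End MultiIndex.

(** * The explicit family for Z/p *)

Section CyclicFamily.
Local Open Scope ring_scope.
Variables (F : fieldType) (p : nat).
Hypothesis p_prime : prime p.
Hypothesis charFp : p \in [pchar F].
Variables (C : finType) (o : C) (sh : C -> C).
Local Notation T := (malg (seq C) F).
Local Notation pt k := (iter k sh o).
Hypothesis cardC : #|C| = p.
Hypothesis pt_inj : forall k l, (k < p)%N -> (l < p)%N -> (pt k == pt l) = (k == l).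
Hypothesis sh_inj : injective sh.

Let p_gt1 : (1 < p)%N. Proof. exact: prime_gt1. Qed.

Lemma pt_perm : perm_eq [seq pt j | j <- iota 0 p] (enum C).
Proof.
have pt_uniq : uniq [seq pt j | j <- iota 0 p].
  rewrite map_inj_in_uniq ?iota_uniq // => k l; rewrite !mem_iota !add0n => kp lp.
  by move/eqP; rewrite pt_inj // => /eqP.
apply: uniq_perm => //; first exact: enum_uniq.
have [| |//] := uniq_min_size pt_uniq (s2 := enum C); first by move=> c _; rewrite mem_enum.
by rewrite -cardE cardC size_map size_iota.
Qed.

Lemma sum_pt (M : nmodType) (f : C -> M) : \sum_(j < p) f (pt j) = \sum_(c : C) f c.
Proof.
rewrite -(big_mkord xpredT (fun j : nat => f (pt j))) /index_iota subn0 -(big_map _ xpredT).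
by rewrite -[RHS]big_enum; apply: perm_big; exact: pt_perm.
Qed.

(* [eta m] is the m-fold concatenation of the cycle of edges of a p-gon, and
   [cyc] the lift of the periodic resolution built from it. *)
Definition etaL (z : T) : T := \sum_(c : C) cons_ch c (cons_ch (sh c) z).

Lemma etaL_linear : linear etaL.
Proof. rewrite /etaL; lin. Qed.
HB.instance Definition _ := GRing.isLinear.Build F T T *:%R etaL etaL_linear.

Definition eta m : T := iter m etaL (gen [::]).

Definition cyc (k : nat) : T :=
  if odd k then cons_ch o (cons_ch (sh o) (eta k./2)) else cons_ch o (eta k./2).

Lemma map_eta m : map_ch sh (eta m) = eta m.
Proof.
elim: m => [|m IH]; first exact: map_gen.
rewrite /eta iterS -/(eta m) linear_sum [RHS](reindex_inj sh_inj) /=.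
by apply: eq_bigr => c _; rewrite !map_cons IH.
Qed.

Lemma iota_etaL A z : iota_ch (ind A) (etaL z) =
  \sum_(c : C) ind A c *: cons_ch (sh c) z - \sum_(c : C) ind A (sh c) *: cons_ch c z +
  etaL (iota_ch (ind A) z).
Proof.
rewrite linear_sum -sumrB -big_split /=; apply: eq_bigr => c _.
by rewrite !iota_cons linearB linearZ /= opprB addrA addrAC.
Qed.

(** Each polygon is closed: its end points cancel its starting points after reindexing by [sh]. *)
Lemma bd_eta m : bd (eta m) = 0.
Proof.
elim: m => [|m IH]; first exact: bd_nil.
have e z : bd (etaL z) = etaL (bd z).
  rewrite linear_sum /= (eq_bigr (fun c : C => cons_ch (sh c) z - cons_ch c z
     + cons_ch c (cons_ch (sh c) (bd z)))); last first.
    by move=> c _; rewrite !bd_cons (linearB (cons_ch c)) /= opprB addrA addrAC.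
  by rewrite big_split sumrB /= [X in _ - X](reindex_inj sh_inj) /= subrr add0r.
by rewrite /eta iterS -/(eta m) e IH linear0.
Qed.

(** The boundary without augmentation: hitting the single block of all letters means being
    nonempty. *)
Definition bd1 (z : T) : T := restr (hits [:: [set: C]%SET]) (bd z).

Lemma hits1 (w : seq C) : hits [:: [set: C]%SET] w = (w != [::]).
Proof. by case: w => //= c w; rewrite finset.in_setT. Qed.

Lemma spt_size_eta m : spt (fun w => size w = m.*2) (eta m).
Proof.
elim: m => [|m IH]; first exact: spt_gen.
rewrite /eta iterS; apply: spt_sum => c _.
apply: (spt_cons (P := fun w => size w = m.*2.+1)); first by move=> w /= ->.
by apply: (spt_cons (P := fun w => size w = m.*2)) => // w /= ->.
Qed.

Lemma spt_size_cyc k : spt (fun w => size w = k.+1) (cyc k).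
Proof.
rewrite /cyc -[in X in spt X]( odd_double_half k); case: (odd k).
  apply: (spt_cons (P := fun w => size w = k./2.*2.+1)); first by move=> w /= ->.
  by apply: (spt_cons (P := fun w => size w = k./2.*2)); [move=> w /= ->|exact: spt_size_eta].
by apply: (spt_cons (P := fun w => size w = k./2.*2)); [move=> w /= ->|exact: spt_size_eta].
Qed.

(** The boundary of a cone over the closed chain [eta m], m > 0, is its base, the norm of one edge
    joined to [eta m.-1]. The boundary of an edge joined to [eta m] is the difference of the cones
    at its two ends. *)
Lemma bd1_cyc nu (U : 'I_nu -> T -> T) i k : U i =1 map_ch sh ->
  bd1 (cyc k) = theta p U i k (cyc k.-1).
Proof.
move=> /funext UE; rewrite /theta.
case: k => [|k] /=.
  by rewrite /bd1 /cyc bd_cons [bd _]bd_nil linear0 subr0 restr_gen hits1.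
rewrite /bd1 /cyc /= uphalf_half; case: (boolP (odd k)) => k_odd /=.
  rewrite add0n -[etaL _]/(eta k./2.+1) bd_cons bd_eta linear0 subr0 restr_id; last first.
    by apply: spt_sub (spt_size_eta (m := k./2.+1)) => w; rewrite hits1; case: w.
  rewrite -[LHS]/(etaL (eta k./2)) /etaL.
  rewrite -(sum_pt (fun c => cons_ch c (cons_ch (sh c) (eta k./2)))).
  apply: eq_bigr => c _; rewrite UE.
  by elim: (c : nat) => [//|j IH]; rewrite [RHS]iterS -IH !map_cons map_eta.
rewrite add0n !bd_cons bd_eta linear0 subr0 UE map_cons map_eta restr_id //.
by apply: sptB; apply: (spt_cons (P := fun=> True)) => [w _|]; rewrite ?hits1 //; exact: sptT.
Qed.

Definition singles l n : seq {set C} := [seq [set pt k]%SET | k <- iota l n].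

Lemma notin_singles m l n : (m < l)%N -> (l + n <= p)%N ->
  all (fun A : {set C} => pt m \notin A) (singles l n).
Proof.
move=> ml lp; apply/allP => A /mapP[k]; rewrite mem_iota => /andP[lk kl] ->.
rewrite finset.in_set1 pt_inj ?neq_ltn ?(leq_trans ml lk) //.
  exact: leq_trans ml (leq_trans (ltnW (leq_ltn_trans lk kl)) lp).
exact: leq_trans kl lp.
Qed.

(** If the leading [pt l] is not the letter contracted first, it stays for good, since it lies in
    none of the later singletons. *)
Lemma eps_single_cons (l n : nat) (z : T) : (l + n.+1 <= p)%N ->
  eps (singles l n.+1) (cons_ch (pt l) z) = eps (singles l.+1 n) z.
Proof.
move=> lp; rewrite -[LHS]/(eps (singles l.+1 n) (iota_ch (ind [set pt l]%SET) _)).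
rewrite iota_cons {1}/ind finset.in_set1 eqxx scale1r linearB /= [X in _ - X]eps_outside ?subr0 //.
apply: (spt_cons (P := fun=> True)); last exact: sptT.
by move=> w _ /=; rewrite notin_singles // addSnnS.
Qed.

(* Words containing a letter that no later contraction can remove are
   negligible; modulo these, contracting a consecutive pair [l, sh l] acts on
   [eta] like a derivation. *)
Section Pair.
Variable (l : C) (B : pred C).
Hypothesis (Bl : B l) (Bl1 : B (sh l)) (Bl2 : B (sh (sh l))) (lneq : l != sh (sh l)).
Let neg (z : T) := spt (fun w => has B w) z.

Let neg_cons c z : B c -> neg (cons_ch c z).
Proof.
move=> Bc; apply: (spt_cons (P := fun=> True)); last exact: sptT.
by move=> w _ /=; rewrite Bc.
Qed.

Let neg_cons' c z : neg z -> neg (cons_ch c z).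
Proof. by apply: spt_cons => w /= ->; rewrite orbT. Qed.

Let neg_etaL z : neg z -> neg (etaL z).
Proof. by move=> nz; apply: spt_sum => c _; do 2!apply: neg_cons'. Qed.

Let sum_ind (a : C) (f : C -> T) : \sum_(c : C) ind [set a]%SET c *: f c = f a.
Proof.
rewrite (bigD1 a) //= big1 ?addr0 => [|c ca]; rewrite /ind finset.in_set1 ?eqxx ?scale1r //.
by rewrite (negbTE ca) scale0r.
Qed.

Let iota1_etaL (a : C) z : iota_ch (ind [set sh a]%SET) (etaL z) =
  cons_ch (sh (sh a)) z - cons_ch a z + etaL (iota_ch (ind [set sh a]%SET) z).
Proof.
rewrite iota_etaL; congr (_ - _ + _); first exact: (sum_ind (sh a) (fun c => cons_ch (sh c) z)).
transitivity (\sum_(c : C) ind [set a]%SET c *: cons_ch c z); last exact: sum_ind.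
by apply: eq_bigr => c _; rewrite /ind !finset.in_set1 (inj_eq sh_inj).
Qed.

Let neg_iota m : neg (iota_ch (ind [set sh l]%SET) (eta m)).
Proof.
elim: m => [|m IH]; first by rewrite iota_nil; exact: spt0.
rewrite /eta iterS -/(eta m) iota1_etaL; apply: sptD; last exact: neg_etaL.
by apply: sptB; exact: neg_cons.
Qed.

(** Both letters have to come from the same polygon, where the edge from [sh l] to [sh (sh l)]
    contributes 1; there are m polygons. All other terms keep a letter of [B]. For m = 0 the
    coefficient makes the value of [m.-1] irrelevant. *)
Lemma iota_pair_eta m : neg (iota_ch (ind [set sh (sh l)]%SET)
  (iota_ch (ind [set sh l]%SET) (eta m)) - m%:R *: eta m.-1).
Proof.
elim: m => [|m IH]; first by rewrite iota_nil linear0 scale0r subr0; exact: spt0.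
set i1 := iota_ch _ in IH *; set i0 := iota_ch _ in IH *.
have i1D x y : i1 (x + y) = i1 x + i1 y by exact: linearD.
have i1B x y : i1 (x - y) = i1 x - i1 y by exact: linearB.
have mE : m%:R *: eta m = etaL (m%:R *: eta m.-1).
  rewrite (linearZZ etaL) /=; case: (m) => [|n]; last by [].
  by rewrite !scale0r.
rewrite -natr1 scalerDl scale1r mE.
have -> : i1 (i0 (eta m.+1)) - (etaL (m%:R *: eta m.-1) + eta m) =
  - cons_ch (sh (sh l)) (i1 (eta m)) + cons_ch l (i1 (eta m)) +
  cons_ch (sh (sh (sh l))) (i0 (eta m)) - cons_ch (sh l) (i0 (eta m)) +
  etaL (i1 (i0 (eta m)) - m%:R *: eta m.-1).
  rewrite -[eta m.+1]/(etaL (eta m)) [i0 (etaL _)]iota1_etaL -/i0 i1D i1B.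
  rewrite [i1 (etaL _)]iota1_etaL -/i1 [i1 (cons_ch (sh (sh l)) _)]iota_cons -/i1.
  rewrite [i1 (cons_ch l _)]iota_cons -/i1 /ind !finset.in_set1 eqxx (negbTE lneq).
  rewrite scale1r scale0r sub0r opprK (linearB etaL) /=.
  rewrite opprD (addrC (- etaL _)) -!addrA addrC -!addrA.
  by do 5!congr (_ + _); rewrite [- eta m + _]addrC addrK.
apply: sptD; last exact: neg_etaL.
apply: sptB; last exact: neg_cons.
apply: sptD; last by apply: neg_cons'; exact: neg_iota.
by apply: sptD; [apply: sptN|]; exact: neg_cons.
Qed.

End Pair.

(** Each pair of consecutive singletons uses up one polygon, chosen among those that are left, hence
    the factorial. The condition 0 < l keeps the predecessor [pt l.-1] outside the singletons. *)
Lemma eps_eta l m : (0 < l)%N -> (l + m.*2 = p)%N ->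
  eps (singles l m.*2) (eta m) = (m`!)%:R.
Proof.
elim: m l => [|m IH] l l0 lp.
  by rewrite [LHS]cnil_gen.
have lt : (l.+2 + m.*2 = p)%N by rewrite -lp doubleS !addSn !addnS.
have lp' : (l.+2 <= p)%N by rewrite -lt leq_addr.
rewrite doubleS -[LHS]/(eps (singles l.+2 m.*2) (iota_ch (ind [set pt l.+1]%SET)
  (iota_ch (ind [set pt l]%SET) (eta m.+1)))).
(* These letters can no longer be contracted: [pt l.-1] precedes the range, and the contractions by
   [pt l] and [pt l.+1] are used here. *)
pose B : pred C := [pred c | [|| c == pt l.-1, c == pt l | c == pt l.+1]].
have ltl : (l.-1 < p)%N := leq_ltn_trans (leq_pred _) (ltnW lp').
have := @iota_pair_eta (pt l.-1) B; rewrite -!iterS (prednK l0) /B /= !eqxx !orbT.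
rewrite -[sh (pt l)]/(pt l.+1) -[etaL (eta m)]/(eta m.+1).
move=> /(_ isT isT isT); rewrite pt_inj //.
rewrite neq_ltn (leq_ltn_trans (leq_pred _)) // => /(_ isT m.+1) nB.
have : eps (singles l.+2 m.*2) (iota_ch (ind [set pt l.+1]%SET)
  (iota_ch (ind [set pt l]%SET) (eta m.+1)) - m.+1%:R *: eta m) = 0.
  apply: eps_outside; apply: spt_sub nB => w; apply: sub_has => c /or3P cE.
  have [k kl ->] : exists2 k, (k < l.+2)%N & c = pt k.
    case: cE => /eqP ->; [exists l.-1|exists l|exists l.+1] => //.
    by rewrite (leq_ltn_trans (leq_pred _)) // ltnW.
  by apply: notin_singles => //; rewrite lt.
rewrite linearB linearZ /= IH // => /eqP; rewrite subr_eq0 => /eqP ->.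
by rewrite factS natrM.
Qed.

(** By length only k = p - 1 can contribute. Its value is a factorial of a number below p, hence
    nonzero in characteristic p. *)
Lemma eps_cyc : exists2 v : F, v != 0 &
  forall k, eps (singles 0 p) (cyc k) = if k == p.-1 then v else 0.
Proof.
have fact_neq0 m : (m < p)%N -> (m`!)%:R != 0 :> F.
  move=> mp; rewrite -(dvdn_pcharf charFp).
  elim: m mp => [|m IH] mp; first by rewrite fact0 dvdn1 neq_ltn p_gt1 orbT.
  by rewrite factS Euclid_dvdM // negb_or gtnNdvd //= IH // ltnW.
have main : exists2 v : F, v != 0 & eps (singles 0 p) (cyc p.-1) = v.
  rewrite -{1}(prednK (ltnW p_gt1)).
  (* For p = 2 the top index 1 is odd, so [cyc] is a single edge instead of a cone over polygons. *)
  have [p_eq2|p_gt2] := eqVneq p 2.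
    exists 1; first exact: oner_neq0.
    rewrite p_eq2 /= /cyc /= -[o]/(pt 0) eps_single_cons ?p_eq2 //.
    rewrite -[sh _]/(pt 1) eps_single_cons ?p_eq2 //.
    by rewrite [LHS]cnil_gen.
  have {}p_gt2 : (2 < p)%N by rewrite ltn_neqAle eq_sym p_gt2.
  have p_odd : odd p by case: (even_prime p_prime) p_gt2 => // ->.
  have pE : (1 + p.-1./2.*2 = p)%N.
    rewrite -[RHS](prednK (ltnW p_gt1)) add1n; congr S.
    rewrite -[RHS]odd_double_half -[in odd _]subn1 oddB ?p_odd //.
    exact: ltnW.
  exists (p.-1./2)`!%:R; first by apply: fact_neq0; rewrite -[X in (_ < X)%N]pE add1n ltnS -addnn leq_addr.
  rewrite /cyc (_ : odd p.-1 = false); last first.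
    by rewrite -subn1 oddB ?p_odd // ltnW.
  rewrite -[o]/(pt 0) eps_single_cons ?prednK // ?(ltnW p_gt1) //.
  have e : p.-1 = p.-1./2.*2 by rewrite -[in LHS]pE.
  by rewrite [X in singles 1 X]e eps_eta.
have [v v0 ve] := main; exists v => // k; case: eqP => [->//|kp].
apply: eps_size; apply: spt_sub (spt_size_cyc (k := k)) => w ->.
by rewrite size_map size_iota; apply/eqP => kE; apply: kp; rewrite -kE.
Qed.

End CyclicFamily.

(** * Splitting the blocks coordinate by coordinate *)

Section Coordinates.
Local Open Scope ring_scope.
Variables (F : fieldType) (p : nat).
Hypothesis p_prime : prime p.
Hypothesis charFp : p \in [pchar F].
Variables (C : finType) (o : C) (sh : C -> C).
Hypothesis cardC : #|C| = p.
Hypothesis pt_inj : forall k l, (k < p)%N -> (l < p)%N ->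
  (iter k sh o == iter l sh o) = (k == l).
Hypothesis sh_inj : injective sh.
Hypothesis sh_p : forall c, iter p sh c = c.
Variables (nu : nat) (Y : finType) (tau : 'I_nu -> Y -> Y) (crd : 'I_nu -> Y -> C).
Hypothesis crd_tau : forall i j y,
  crd i (tau j y) = if i == j then sh (crd i y) else crd i y.
Hypothesis crd_inj : forall x y, (forall i, crd i x = crd i y) -> x = y.

Local Notation T := (malg (seq Y) F).
Local Notation TC := (malg (seq C) F).
Local Notation idx := {ffun 'I_nu -> nat}.
Implicit Types (i j : 'I_nu) (a b : idx) (z : T) (A : {set Y}) (s : seq {set Y}).

Lemma tauC i j y : tau i (tau j y) = tau j (tau i y).
Proof. by apply: crd_inj => k; rewrite !crd_tau; case: ifP; case: ifP. Qed.

Lemma tau_p i y : iter p (tau i) y = y.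
Proof.
apply: crd_inj => k.
have iterE n : crd k (iter n (tau i) y) = if k == i then iter n sh (crd k y) else crd k y.
  by elim: n => [|n IH]; rewrite /= ?if_same // crd_tau IH; case: (k == i).
by rewrite iterE sh_p if_same.
Qed.

(* After the first [l] coordinates are used up, their generators act trivially. *)
Definition tauT (l : nat) i : T -> T := if (i < l)%N then id else map_ch (tau i).

Lemma iter_map_ch (X : choiceType) (g : X -> X) n (z : malg (seq X) F) :
  iter n (map_ch g) z = map_ch (iter n g) z.
Proof.
elim: n => [|n IH]; first by rewrite [RHS]map_id_ch.
by rewrite iterS IH map_comp_ch.
Qed.

Lemma tauT_lin l i : linear (tauT l i).
Proof. by rewrite /tauT; case: ifP => _; lin. Qed.

Lemma tauT_comm l i j z : tauT l i (tauT l j z) = tauT l j (tauT l i z).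
Proof.
rewrite /tauT; case: ifP => //; case: ifP => // _ _.
by rewrite !map_comp_ch; congr map_ch; apply/funext => y /=; rewrite tauC.
Qed.

Lemma tauT_p l i z : iter p (tauT l i) z = z.
Proof.
rewrite /tauT; case: ifP => _; first by elim: p.
rewrite iter_map_ch (_ : iter p (tau i) = id) ?map_id_ch //.
by apply/funext => y; exact: tau_p.
Qed.

Lemma tauT_bd l i z : bd (tauT l i z) = tauT l i (bd z).
Proof. by rewrite /tauT; case: ifP => // _; exact: bd_map. Qed.

Definition perm_inv (l : nat) s := forall i, (l <= i)%N ->
  perm_eq [seq tau i @^-1: A | A : {set Y} <- s] s.

Lemma tauT_restr l i s z : perm_inv l s ->
  restr (hits s) (tauT l i z) = tauT l i (restr (hits s) z).
Proof.
rewrite /tauT => sl; case: ltnP => // li; apply: restr_hits_map; exact: sl.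
Qed.

Lemma tauT_eps l i s z : perm_inv l s -> eps s (tauT l i z) = eps s z.
Proof.
rewrite /tauT => sl; case: ltnP => // li; apply: (eps_map_inv (p := p)) => //.
  exact: tau_p.
exact: sl.
Qed.

Definition bds s (z : T) := restr (hits s) (bd z).

Lemma bds_lin s : linear (bds s).
Proof. by rewrite /bds; lin. Qed.

Lemma tauT_bds l i s z : perm_inv l s -> bds s (tauT l i z) = tauT l i (bds s z).
Proof. by move=> sl; rewrite /bds tauT_bd tauT_restr. Qed.

Definition partition_seq s :=
  (forall y, once s y) /\ (forall A, A \in s -> exists y, y \in A).

Lemma spt_once s z : (forall y, once s y) -> spt (all (once s)) z.
Proof. by move=> os; apply: sptT => w; apply/allP => y _. Qed.

(* A map from the resolution to the complex of words hitting every block of [s]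
   (restricted to the multi-indices in S) that is detected only at index [b]. *)
Definition fam l s (S : idx -> Prop) b (v : F) (y : idx -> T) :=
  [/\ v != 0, forall a, S a -> restr (hits s) (y a) = y a,
      forall a, S a -> bds s (y a) = dtot p (tauT l) y a &
      forall a, S a -> eps s (y a) = if a == b then v else 0].

Lemma fam_perm l s t S b v y : perm_eq s t -> fam l s S b v y ->
  exists c : bool, fam l t S b ((-1) ^+ c * v) y.
Proof.
move=> st [v0 ys yd ye].
have hE : hits s = hits t by apply/funext => w; exact: hits_perm.
have /(@eps_perm F)[c cE] : perm_eq t s by rewrite perm_sym.
exists c; split.
- by rewrite mulf_neq0 // signr_eq0.
- by rewrite -hE.
- by rewrite /bds -hE.
by move=> a Sa; rewrite cE ye //; case: ifP; rewrite ?mulr0.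
Qed.

Lemma once_disj s : (forall y, once s y) -> disj s.
Proof. by move=> os y; rewrite (eqP (os y)). Qed.

Lemma lift_blocks l s (S : idx -> Prop) (g : idx -> T) r :
  partition_seq s -> perm_inv l s ->
  (forall a i, S a -> (0 < a i)%N -> S (decr i a)) ->
  (forall a, S a -> (mabs a < r)%N) ->
  (forall a, S a -> restr (hits s) (g a) = g a) ->
  (forall a, S a -> bds s (g a) = dtot p (tauT l) g a) ->
  (forall a, S a -> eps s (g a) = 0) ->
  exists h : idx -> T, forall a, S a -> restr (hits s) (h a) = h a /\
    bds s (h a) = g a - dtot p (tauT l) h a.
Proof.
move=> [os ne] sl Sd Sb gs gd ge.
apply: (@lift_family F p nu T (tauT l) (bds s) (eps s) charFp _ _ _ _ _ _ _
  (fun _ z => restr (hits s) z = z) r) => //.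
- exact: tauT_lin.
- exact: tauT_comm.
- exact: tauT_p.
- exact: bds_lin.
- by move=> i x; exact: tauT_bds.
- by move=> c x y; rewrite linearP.
- by move=> i x; exact: tauT_eps.
- by move=> n; rewrite linear0.
- by move=> n c x y ex ey; rewrite linearP /= ex ey.
- by move=> n i x ex; rewrite tauT_restr // ex.
move=> n z _ zs zd ze.
have zP : spt (fun w => hits s w /\ all (once s) w) z.
  apply: sptI; last exact: spt_once.
  by rewrite -zs; exact: spt_restrP.
have [u uP ud] := blocks_exact (once_disj os) ne zP zd ze.
exists u => //; rewrite restr_id //; apply: spt_sub uP => w [].
by [].
Qed.

Section Drop.
Variables (l : 'I_nu) (s : seq {set Y}) (S : idx -> Prop) (b : idx) (v : F).
Variables (y : idx -> T) (r : nat).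
Hypothesis s_part : partition_seq s.
Hypothesis s_inv : perm_inv l s.
Hypothesis S_down : forall a i, S a -> (0 < a i)%N -> S (decr i a).
Hypothesis S_bnd : forall a, S a -> (mabs a < r)%N.
Hypothesis y_fam : fam l s S b v y.
Variable om : T -> F^o.
Hypothesis om_lin : linear om.
Hypothesis om_tau : forall i z, om (map_ch (tau i) z) = om z.
Hypothesis om_bds : forall z, om (bds s z) = 0.

(** Where [a l < b l] the family is not detected by [eps s], so it has a null-homotopy [h] there.
    Extending [h] by zero and subtracting [bds s (h' a) + dtot p (tauT l) h' a] gives a family that
    vanishes for [a l < b l]. For [a l <= b l] the differential in direction [l] then reads only
    zeros, and the action of [tau l] may be replaced by the identity. Neither [eps s] nor [om] sees
    the correction, as both are invariant and kill boundaries. *)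
Lemma drop_level : exists2 y', fam l.+1 s (fun a => S a /\ (a l <= b l)%N) b v y' &
  forall a, S a -> om (y' a) = om (y a).
Proof.
have [v0 ys yd ye] := y_fam.
have TL := tauT_lin l; have TC' := tauT_comm l; have TP := tauT_p l.
have decr_l a i : (0 < a i)%N -> (decr i a l <= a l)%N by rewrite ffunE leq_subr.
have [||||| h hP] := @lift_blocks l s (fun a => S a /\ (a l < b l)%N) y r s_part s_inv.
- by move=> a i [Sa al] ai; split; [exact: S_down|exact: leq_ltn_trans (decr_l _ _ ai) al].
- by move=> a [/S_bnd].
- by move=> a [/ys].
- by move=> a [/yd].
- move=> a [/ye-> al]; case: eqP => // e; by rewrite e ltnn in al.
pose h' a := if `[< S a /\ (a l < b l)%N >] then h a else 0.
pose y' a := y a - bds s (h' a) - dtot p (tauT l) h' a.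
have h's a : restr (hits s) (h' a) = h' a.
  by rewrite /h'; case: asboolP => [H|_]; [case: (hP _ H)|rewrite linear0].
have omT i x : om (tauT l i x) = om x by rewrite /tauT; case: ifP.
have omB x z : om (x - z) = om x - om z by rewrite addrC -scaleN1r om_lin scaleN1r addrC.
have dtot_bds (f : idx -> T) a : bds s (dtot p (tauT l) f a) = dtot p (tauT l) (bds s \o f) a.
  apply: dtot_morph; first exact: bds_lin.
  by move=> i x; exact: tauT_bds.
have bdsB x z : bds s (x - z) = bds s x - bds s z.
  by rewrite addrC -scaleN1r bds_lin scaleN1r addrC.
have bds_bds z : bds s (bds s z) = 0 by rewrite /bds restr_bd_restr bd_bd linear0.
have y'0 a : S a -> (a l < b l)%N -> y' a = 0.
  move=> Sa al; rewrite /y' /h'; case: asboolP => [Sal|[]//].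
  have [_ ->] := hP a Sal; rewrite opprB addrCA subrr addr0.
  rewrite (_ : dtot p (tauT l) _ a = dtot p (tauT l) h a).
    by rewrite subrr.
  apply: eq_dtot => i ai; case: asboolP => // -[]; split; first exact: S_down.
  exact: leq_ltn_trans (decr_l _ _ ai) al.
exists y'; last first.
  move=> a Sa; rewrite /y' !omB om_bds subr0 (@dtot_morph _ p _ _ _ _ (fun _ => id)) //.
  by rewrite dtot_id // subr0.
split=> // a [Sa al].
- rewrite /y' !linearB /= ys // {1}/bds restr_restr.
  rewrite (_ : restr _ (bd (h' a)) = bds s (h' a)); last by apply: eq_restr => w; rewrite andbb.
  congr (_ - _); rewrite (@dtot_morph _ p _ _ _ _ (tauT l)).
  + by congr (dtot p (tauT l) _ a); apply/funext => c; exact: h's.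
  + by lin.
  + by move=> i x; exact: tauT_restr.
- transitivity (dtot p (tauT l) y' a); last first.
    apply: eq_bigr => i _; congr (_ *: _); have [->|ai] := posnP (a i); first by [].
    have [il|il] := eqVneq i l.
      subst i; rewrite y'0; [|exact: S_down|by rewrite decr_eq prednK].
      by rewrite !theta0 //; exact: tauT_lin.
    rewrite /theta /tauT (_ : (i < l.+1)%N = (i < l)%N) //.
    by rewrite ltnS leq_eqVlt (negbTE (il : i != l :> nat)).
  rewrite /y' !dtotB // dtot_dtot // subr0 !bdsB bds_bds subr0 yd // dtot_bds.
  by [].
rewrite /y' !linearB /= ye // /bds eps_restr eps_bd ?subr0; last by apply: spt_once; case: s_part.
rewrite (@dtot_morph _ p _ _ _ _ (fun _ => id)) ?dtot_id ?subr0 //; first by lin.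
by move=> i x; exact: tauT_eps.
Qed.

End Drop.

(** Frobenius gives (-1)^p = -1 for odd and even p alike, hence (-1)^(p-1) = 1. *)
Lemma sign_div n : (p.-1 %| n)%N -> (-1) ^+ n = 1 :> F.
Proof.
have p0 := prime_gt0 p_prime.
have e : (-1) ^+ p.-1 = 1 :> F.
  have : (-1) ^+ p = -1 :> F by rewrite -pFrobenius_autE rmorphN1.
  by rewrite -{1}(prednK p0) exprS mulN1r => /oppr_inj.
by move=> /dvdnP[k ->]; rewrite mulnC exprM e expr1n.
Qed.

(** For odd p a multiple of p - 1 preserves parity. For p = 2 the two maps coincide, the norm 1 + T
    being T - 1. Degree 0 is excluded, since [theta] is zero there. *)
Lemma theta_shift (M : lmodType F) (U : 'I_nu -> M -> M) i k m x :
  (p.-1 %| m)%N -> (0 < k)%N -> theta p U i (k + m) x = theta p U i k x.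
Proof.
move=> pm k0; rewrite /theta !gtn_eqF ?addn_gt0 ?k0 //.
have [p2|p_odd] := even_prime p_prime.
  have N2 (z : M) : \sum_(j < p) iter j (U i) z = U i z - z.
    rewrite p2 !big_ord_recl big_ord0 addr0 /= addrC; congr (_ + _).
    by apply/eqP; rewrite -addr_eq0 -mulr2n -scaler_nat -p2 pcharf0 // scale0r.
  by rewrite !N2 !if_same.
have m_even : odd m = false.
  move: pm => /dvdnP[q ->]; rewrite oddM; apply/negP => /andP[_].
  by rewrite -subn1 oddB ?p_odd //; exact: prime_gt0.
by rewrite oddD m_even addbF.
Qed.

Local Notation ptC := [seq iter k sh o | k <- iota 0 p].

Lemma perm_inv_pt : perm_eq (map (invF sh_inj) ptC) ptC.
Proof.
have ptP := pt_perm cardC pt_inj.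
apply: perm_trans (perm_map _ ptP) _; rewrite perm_sym; apply: perm_trans ptP _.
apply: uniq_perm; rewrite ?enum_uniq //.
  by rewrite map_inj_uniq ?enum_uniq //; exact: can_inj (f_invF sh_inj).
move=> c; rewrite mem_enum; apply/esym/mapP; exists (sh c); first by rewrite mem_enum.
by rewrite invF_f.
Qed.

Definition children i A : seq {set Y} := [seq [set y in A | crd i y == c]%SET | c <- ptC].

Section Split.
Variables (l : 'I_nu) (A : {set Y}) (s' : seq {set Y}) (S : idx -> Prop) (b : idx) (v : F).
Variables (y : idx -> T) (r : nat).
Let s := rcons s' A.
Hypothesis s_part : partition_seq s.
Hypothesis s_inv : perm_inv l s.
Hypothesis A_inv : forall i, (l <= i)%N -> tau i @^-1: A = A.
Hypothesis S_down : forall a i, S a -> (0 < a i)%N -> S (decr i a).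
Hypothesis S_bnd : forall a, S a -> (mabs a < r)%N.
Hypothesis y_fam : fam l s S b v y.
Hypothesis s_div : (p.-1 %| size s')%N.
Hypothesis b_div : forall i, (p.-1 %| b i)%N.

Let s'_notA B x : B \in s' -> x \in B -> x \notin A.
Proof.
move=> Bs xB; apply/negP => xA; have /eqP := s_part.1 x; rewrite /s -cats1 count_cat /= xA addn0 addn1 => -[] /eqP.
by rewrite -leqn0 leqNgt (count_gt0 Bs xB).
Qed.

(* Contracting the other blocks leaves words in A, which are read in Z/p through
   coordinate [l]; this reduces the splitting of A to the case of one factor. *)
Let chi (z : T) : TC := map_ch (crd l) (restr (all (mem A)) (iotas s' z)).

Let chi_lin : linear chi. Proof. by rewrite /chi; lin. Qed.

Let hitsC (w : seq C) : hits [:: [set: C]%SET] w = (w != [::]).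
Proof. by case: w => //= c w; rewrite finset.in_setT. Qed.

Let hits_s w : hits s w = has (mem A) w && hits s' w.
Proof. by rewrite /hits /s all_rcons. Qed.

Let chi_hits z : restr (hits [:: [set: C]%SET]) (chi z) = chi (restr (hits s) z).
Proof.
move: z; apply: lin_ext => [||w]; [rewrite /chi; lin|rewrite /chi; lin|].
have hasA u : spt (fun x => has (mem A) x) u -> spt (fun x => has (mem A) x) (iotas s' u).
  apply: spt_iotas => B w1 x w2 Bs; rewrite !has_cat /= => + xB.
  by rewrite (negbTE (s'_notA Bs xB)).
have nhasA u : spt (fun x => ~~ has (mem A) x) u -> spt (fun x => ~~ has (mem A) x) (iotas s' u).
  apply: spt_iotas => B w1 x w2 Bs; rewrite !has_cat /= => + xB.
  by rewrite (negbTE (s'_notA Bs xB)).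
rewrite restr_gen hits_s; case: (boolP (has _ w)) => [hA|nA] /=; last first.
  rewrite [in RHS]/chi !linear0 restr0 ?/chi //.
  apply: (spt_map (P := fun x => ~~ has (mem A) x /\ all (mem A) x)).
    by case=> [|x u] /=; [|move=> [+ /andP[xA _]]; rewrite xA].
  by apply: spt_restr; apply: nhasA; exact: spt_gen.
case: ifP => [_|/negbT hs'].
  rewrite restr_id //; apply: (spt_map (P := fun x => has (mem A) x /\ all (mem A) x)).
    by move=> [|x u] [] // _ _; rewrite hitsC.
  by apply: spt_restr; apply: hasA; exact: spt_gen.
by rewrite /chi iotas_nothit ?linear0 //; exact: spt_gen.
Qed.

Let restr_iotaA z : restr (all (mem A)) (iota_ch (ind A) z) = bd (restr (all (mem A)) z).
Proof.
move: z; apply: lin_ext => [||w]; [lin|lin|].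
rewrite restr_gen; case: ifP => [wA|/negbT wA].
  have -> : iota_ch (ind A) (gen w) = bd (F := F) (gen w).
    elim: w wA => [|x w IH] /=; first by rewrite bd_nil iota_nil.
    by move=> /andP[xA /IH e]; rewrite -cons_gen iota_cons bd_cons e /ind xA scale1r.
  rewrite restr_id //; apply: (spt_bd (P := all (mem A))); last exact: spt_gen.
  by move=> w1 x w2; rewrite !all_cat /= => /and3P[-> _ ->].
rewrite linear0 restr0 //; apply: (spt_iota (P := fun x => ~~ all (mem A) x)); last exact: spt_gen.
by move=> w1 x w2; rewrite !all_cat /= => H /ind_neq0 xA; move: H; rewrite xA.
Qed.

Let iotas_bd z : iotas s' (bd z) = iota_ch (ind A) (iotas s' z).
Proof.
rewrite (bd_iota (s := s)); last by apply: spt_once; case: s_part.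
rewrite /s -cats1 big_cat /= big_seq1 linearD linear_sum /= big_seq big1 ?add0r.
  (* Moving the contraction by [A] past those of [s'] costs (-1)^|s'|, which is 1 by [s_div]. *)
  by rewrite iotas_anti sign_div // scale1r.
by move=> B Bs; rewrite iotas_iota.
Qed.

Let chi_bds z : bd1 (chi z) = chi (bds s z).
Proof.
rewrite /bds -chi_hits /bd1; congr restr.
by rewrite /chi iotas_bd restr_iotaA bd_map.
Qed.

Let eps_chi z : eps [:: [set: C]%SET] (chi z) = eps s z.
Proof.
rewrite /eps /s -cats1 iotas_cat /=.
have -> : iota_ch (ind [set: C]%SET) (chi z) = bd (chi z).
  by apply: eq_iota => c; rewrite /ind finset.in_setT.
rewrite /chi bd_map -restr_iotaA cnil_map.
move: (iota_ch _ _); apply: lin_ext => [||w]; [lin|lin|].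
rewrite restr_gen; case: ifP => // wA; rewrite linear0 cnil_gen.
by case: w wA.
Qed.

Definition tauC' i : TC -> TC := if i == l then map_ch sh else id.

Let s'_inv i : (l <= i)%N -> perm_eq [seq tau i @^-1: B | B : {set Y} <- s'] s'.
Proof.
move=> li; have := s_inv li; rewrite /s map_rcons A_inv //.
by rewrite -!cats1 perm_cat2r.
Qed.

Let chi_tau i z : chi (tauT l i z) = tauC' i (chi z).
Proof.
rewrite /tauT /tauC'; case: ltnP => li.
  by rewrite ifN //; apply: contraTneq li => ->; rewrite ltnn.
rewrite /chi (iotas_map_inv (p := p) _ charFp) //; last 2 first.
- exact: tau_p.
- exact: s'_inv.
have -> u : restr (all (mem A)) (map_ch (F := F) (tau i) u) = map_ch (tau i) (restr (all (mem A)) u).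
  move: u; apply: lin_ext => [||w]; [lin|lin|].
  rewrite map_gen !restr_gen all_map (eq_all (a2 := mem A)).
    by case: ifP; rewrite ?map_gen ?linear0.
  by move=> x /=; rewrite -[in RHS](A_inv li) inE.
rewrite map_comp_ch; case: ifP => [/eqP il|il].
  rewrite map_comp_ch; congr map_ch; apply/funext => x /=.
  by rewrite crd_tau il eqxx.
by congr map_ch; apply/funext => x /=; rewrite crd_tau eq_sym il.
Qed.

Let s2 := s' ++ children l A.
Hypothesis s2_inv : perm_inv l s2.

(** A letter outside [A] that survives the contraction by [s'] lies in no child of [A]; on words in
    [A] the children are the fibres of [crd l]. *)
Let eps_s2 z : eps s2 z = eps (singles o sh 0 p) (chi z).
Proof.
rewrite [LHS]/eps iotas_cat -/(eps _ _); set u := iotas s' z.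
rewrite /chi eps_map -/u [in LHS](chain_split (all (mem A)) u) linearD /=.
rewrite [X in _ + X]eps_outside ?addr0; last first.
  apply: spt_sub (spt_restrP (P := fun w => ~~ all (mem A) w) (z := u)) => w.
  rewrite -has_predC; apply: sub_has => x /= xA; apply/allP => B /mapP[c _ ->].
  by rewrite inE negb_and xA.
rewrite /children /singles -!map_comp; apply: eps_eq_ind.
apply: spt_sub (spt_restrP (P := all (mem A)) (z := u)) => w; apply: sub_all => x /= xA.
by apply/allP => k _; rewrite /= !inE xA.
Qed.

Let s2_hits w : hits s2 w -> hits s w.
Proof.
rewrite /s2 hits_s /hits all_cat => /andP[-> hc]; rewrite andbT.
have /(allP hc)/hasP[x xw] : [set x in A | crd l x == o]%SET \in children l A.
  apply/mapP; exists o => //; apply/mapP; exists 0%N => //.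
  by rewrite mem_iota add0n prime_gt0.
by rewrite !inE => /andP[xA _]; apply/hasP; exists x.
Qed.

Let off a := [forall i, (i != l) ==> (a i == b i)] && (b l <= a l)%N.

(** The comparison family: the explicit family for Z/p, placed on the ray that starts at [b] in
    direction [l]. It has the same augmentation as the image of [y] under [chi], so the two are
    homotopic. *)
Let E a : TC := if off a then v *: cyc F o sh (a l - b l) else 0.

Let tauC'_lin i : linear (tauC' i).
Proof. by rewrite /tauC'; case: ifP => _; lin. Qed.

Let E_bd a : bd1 (E a) = dtot p tauC' E a.
Proof.
rewrite /dtot (bigD1 l) //= [X in _ + X]big1 ?addr0; last first.
  move=> i il; rewrite (_ : theta _ _ _ _ _ = theta p (fun _ => id) i (a i) (E (decr i a))).
    by rewrite theta_id // scaler0.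
  by rewrite /theta /tauC' (negbTE il).
have bd1Z (c : F) (z : TC) : bd1 (c *: z) = c *: bd1 z by rewrite /bd1 !linearZ.
have [al|al] := ltnP (b l) (a l).
  have dl : (b l <= decr l a l)%N by rewrite decr_eq -ltnS prednK // (leq_trans _ al).
  have -> : E (decr l a) = if off a then v *: cyc F o sh (a l - b l).-1 else 0.
    rewrite /E /off dl (ltnW al) !andbT decr_eq -!subn1 subnAC.
    rewrite (_ : [forall i, _] = [forall i, (i != l) ==> (a i == b i)]) //.
    by apply: eq_forallb => i; case: eqVneq => //= il; rewrite decr_neq.
  rewrite /E; case: ifP => [/andP[/forallP offa _]|_]; last first.
    by rewrite theta0 ?scaler0 ?/bd1 ?linear0.
  (* [cyc] has index [a l - b l] while [theta] uses [a l]; the shift [b l] is a multiple of p - 1.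
     On the ray so is the exponent of the sign [sg l a], a sum of entries of [b]. *)
  rewrite bd1Z thetaZ // -[in theta p tauC' l (a l)](subnK (ltnW al)) theta_shift ?subn_gt0 //.
  rewrite (bd1_cyc cardC pt_inj sh_inj (U := tauC') (i := l)); last first.
    by move=> z; rewrite /tauC' eqxx.
  rewrite /sg (_ : (\sum_(j < nu | (j < l)%N) a j = \sum_(j < nu | (j < l)%N) b j)%N).
    by rewrite sign_div ?scale1r //; apply: (big_ind (fun n => p.-1 %| n)%N) => // ? ?; exact: dvdn_add.
  apply: eq_bigr => j jl; apply/eqP; apply: (implyP (offa j)).
  by apply: contraTneq jl => ->; rewrite ltnn.
have -> : theta p tauC' l (a l) (E (decr l a)) = 0.
  have [->|a0] := posnP (a l); first by [].
  rewrite /E /off decr_eq (_ : (b l <= _)%N = false) ?andbF ?theta0 //.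
  by apply/negbTE; rewrite -ltnNge prednK.
rewrite scaler0 /E /off; case: ifP => [/andP[_ bl]|_]; last by rewrite /bd1 !linear0.
have -> : (a l - b l = 0)%N by apply/eqP; rewrite subn_eq0.
rewrite bd1Z (bd1_cyc cardC pt_inj sh_inj (U := tauC') (i := l)).
  by rewrite /theta /= scaler0.
by move=> z; rewrite /tauC' eqxx.
Qed.

Let hitE a : restr (hits [:: [set: C]%SET]) (E a) = E a.
Proof.
apply: restr_id; rewrite /E; case: ifP => _; last exact: spt0.
apply: sptZ; apply: spt_sub (spt_size_cyc (k := a l - b l)) => w.
by rewrite hitsC; case: w.
Qed.

Let offE a : (off a && (a l == b l)) = (a == b).
Proof.
apply/andP/eqP => [[/andP[/forallP H _] /eqP e]|->].
  apply/ffunP => i; have [->//|il] := eqVneq i l; exact/eqP/(implyP (H i)).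
by split=> //; rewrite /off leqnn andbT; apply/forallP => i; rewrite eqxx implybT.
Qed.

Let eps1E a : eps [:: [set: C]%SET] (E a) = if a == b then v else 0.
Proof.
rewrite -offE /E; case: ifP => [/andP[_ bl] /=|]; last by rewrite linear0.
rewrite linearZ /=; have [e|ne] := eqVneq (a l) (b l).
  rewrite e subnn -[eps _ _]/(cnil (iota_ch _ (cons_ch o (gen [::])))).
  rewrite iota_cons iota_nil linear0 subr0 /ind finset.in_setT scale1r cnil_gen.
  by rewrite /GRing.scale /= mulr1.
rewrite eps_size ?scaler0 //; apply: spt_sub (spt_size_cyc (k := a l - b l)) => w ->.
by rewrite eqSS subn_eq0 -ltnNge ltn_neqAle eq_sym ne.
Qed.

(** The detected class of [cyc] has index p - 1, counted from [b l]. *)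
Let incr : idx := [ffun i => (b i + (i == l) * p.-1)%N].

(** By [eps_s2] the new value is read off from [chi (y a)]. This differs from [E a] by
    [bd1 (h a) + dtot p tauC' h a], and the functional of the p singletons kills both terms. What
    remains is [eps_cyc] on the ray, scaled by the old value [v]. *)
Lemma split_block : exists2 v', v' != 0 &
  fam l s2 S incr v' (fun a => restr (hits s2) (y a)).
Proof.
have [v0 ys yd ye] := y_fam.
have [v1 v1_neq0 cycE] := eps_cyc p_prime charFp pt_inj sh_inj.
exists (v * v1); first exact: mulf_neq0.
have s2_s z : restr (hits s2) z = restr (hits s2) (restr (hits s) z).
  rewrite restr_restr; apply: eq_restr => w; case: (boolP (hits s2 w)) => //= h2.
  by rewrite s2_hits.
split.
- exact: mulf_neq0.
- by move=> a Sa; rewrite restr_restr; apply: eq_restr => w; rewrite andbb.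
- move=> a Sa; rewrite /bds restr_bd_restr s2_s -/(bds s _) yd //.
  rewrite (@dtot_morph _ p _ _ _ _ (tauT l)) //; first by lin.
  by move=> i x; exact: tauT_restr.
move=> a Sa; rewrite eps_restr eps_s2.
have UC i j (z : TC) : tauC' i (tauC' j z) = tauC' j (tauC' i z).
  by rewrite /tauC'; case: (i == l); case: (j == l).
have Up i (z : TC) : iter p (tauC' i) z = z.
  rewrite /tauC'; case: ifP => _; last by elim: p.
  rewrite iter_map_ch (_ : iter p sh = id) ?map_id_ch //.
  by apply/funext => c; exact: sh_p.
have eps_tauC' t i (z : TC) : perm_eq [seq sh @^-1: B | B : {set C} <- t] t ->
    eps t (tauC' i z) = eps t z.
  rewrite /tauC' => tP; case: ifP => // _; exact: (eps_map_inv (p := p)).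
have inv1 : perm_eq [seq sh @^-1: B | B : {set C} <- [:: [set: C]%SET]] [:: [set: C]%SET].
  by rewrite /= (_ : sh @^-1: _ = [set: C]%SET) //; apply/setP => c; rewrite !inE.
pose G c := chi (y c) - E c.
have [h hP] : exists h : idx -> TC, forall a, S a ->
    restr (hits [:: [set: C]%SET]) (h a) = h a /\
    bd1 (h a) = G a - dtot p tauC' h a.
  apply: (@lift_family F p nu TC tauC' (bd1 (F := F) (C := C)) (eps [:: [set: C]%SET]) charFp
    tauC'_lin UC Up _ _ _ _ (fun _ (u : TC) => restr (hits [:: [set: C]%SET]) u = u) r
    _ _ _ _ S S_down S_bnd G) => //.
  - by rewrite /bd1; lin.
  - rewrite /bd1 /tauC' => i u; case: ifP => // _.
    by rewrite bd_map restr_hits_map.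
  - by move=> c u w; rewrite linearP.
  - by move=> i u; exact: eps_tauC'.
  - by move=> n; rewrite linear0.
  - by move=> n c u w eu ew; rewrite linearP /= eu ew.
  - by move=> n i u eu; rewrite /tauC'; case: ifP => // _; rewrite restr_hits_map // eu.
  - move=> n z _ zs zd ze.
    have zP : spt (fun w => hits [:: [set: C]%SET] w /\ all (once [:: [set: C]%SET]) w) z.
      apply: sptI; first by rewrite -zs; exact: spt_restrP.
      by apply: sptT => w; apply/allP => c _; rewrite /once /= finset.in_setT.
    have [||u uP ud] := blocks_exact _ _ zP zd ze.
    + by move=> c; rewrite /= addn0; case: (c \in _).
    + by move=> B; rewrite inE => /eqP ->; exists o; rewrite finset.in_setT.
    by exists u => //; rewrite restr_id //; apply: spt_sub uP => w [].
  - by move=> c Sc; rewrite /G linearB /= hitE chi_hits ys.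
  - move=> c Sc; rewrite /G {1}/bd1 !linearB /= -/(bd1 _) -/(bd1 (E c)) chi_bds E_bd.
    rewrite yd // (@dtot_morph _ p _ _ _ _ tauC') // dtotB //.
  - by move=> c Sc; rewrite /G linearB /= eps_chi eps1E ye // subrr.
have [_ hd] := hP a Sa.
have p_gt0 := prime_gt0 p_prime.
have once_singles c : once (singles o sh 0 p) c.
  rewrite /once /singles count_map (eq_count (a2 := preim (fun k => iter k sh o) (pred1 c))).
    rewrite -count_map (seq.permP (pt_perm cardC pt_inj)) count_uniq_mem ?enum_uniq //.
    by rewrite mem_enum.
  by move=> k /=; rewrite finset.in_set1 eq_sym.
have inv2 : perm_eq [seq sh @^-1: B | B : {set C} <- singles o sh 0 p] (singles o sh 0 p).
  have -> : singles o sh 0 p = [seq [set c]%SET | c <- ptC] by rewrite /singles -map_comp.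
  rewrite -map_comp (eq_map (g := (fun c => [set c]%SET) \o invF sh_inj)); last first.
    by move=> c /=; apply/setP => d; rewrite !inE -[RHS](inj_eq sh_inj) f_invF.
  by rewrite map_comp; apply: perm_map; exact: perm_inv_pt.
have eps_bd1 (z : TC) : eps (singles o sh 0 p) (bd1 z) = 0.
  rewrite /bd1 -[RHS](eps_bd (s := singles o sh 0 p) (z := z)); last first.
    by apply: sptT => w; apply/allP => c _; exact: once_singles.
  rewrite [in RHS](chain_split (hits [:: [set: C]%SET]) (bd z)) linearD /=.
  (* [bd1] and [bd] differ by a multiple of the empty word, whose length is not p. *)
  rewrite [X in _ = _ + X]eps_size ?addr0 //.
  apply: spt_sub (spt_restrP (P := fun w => ~~ hits [:: [set: C]%SET] w) (z := bd z)) => w.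
  by rewrite hitsC negbK => /eqP ->; rewrite size_map size_iota ltn_eqF.
have -> : eps (singles o sh 0 p) (chi (y a)) = eps (singles o sh 0 p) (E a).
  apply/eqP; rewrite -subr_eq0 -linearB /=.
  have -> : chi (y a) - E a = bd1 (h a) + dtot p tauC' h a by rewrite hd subrK.
  rewrite linearD /= eps_bd1 add0r (@dtot_morph _ p _ _ _ _ (fun _ => id)); last 2 first.
  - by lin.
  - by move=> i z; exact: eps_tauC'.
  by rewrite dtot_id.
rewrite /E; case: ifP => [offa|offa]; last first.
  rewrite linear0 ifN //; apply: contraFN offa => /eqP ->.
  rewrite /off /incr ffunE eqxx leq_addr andbT; apply/forallP => i; apply/implyP => il.
  by rewrite ffunE (negbTE il) addn0.
rewrite linearZ /= cycE (_ : (_ == p.-1) = (a == incr)).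
  by case: ifP => _; rewrite /GRing.scale /= ?mulr0.
case/andP: offa => /forallP offa bl; apply/eqP/eqP => [e|->].
  apply/ffunP => i; rewrite ffunE; case: eqVneq => [->|il].
    by rewrite mul1n -e subnKC.
  by rewrite addn0; apply/eqP; exact: (implyP (offa i)).
by rewrite ffunE eqxx mul1n addKn.
Qed.

End Split.

Lemma mem_pt c : c \in ptC.
Proof. by rewrite (perm_mem (pt_perm cardC pt_inj)) mem_enum. Qed.

Lemma count_children i A y : count (fun B : {set Y} => y \in B) (children i A) = (y \in A).
Proof.
rewrite /children count_map (eq_count (a2 := fun c => (y \in A) && (c == crd i y))); last first.
  by move=> c /=; rewrite inE eq_sym.
case: (y \in A) => /=; last by rewrite count_pred0.
rewrite (seq.permP (pt_perm cardC pt_inj)) (eq_count (a2 := pred1 (crd i y))) //.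
by rewrite count_uniq_mem ?enum_uniq // mem_enum.
Qed.

Lemma count_split i y d : count (fun B : {set Y} => y \in B) (flatten (map (children i) d)) =
  count (fun B : {set Y} => y \in B) d.
Proof. by elim: d => [//|A d IH] /=; rewrite count_cat count_children IH. Qed.

Lemma children_perm i j A : (i <= j)%N -> tau j @^-1: A = A ->
  perm_eq [seq tau j @^-1: B | B : {set Y} <- children i A] (children i A).
Proof.
move=> ij Aj; have [e|ne] := eqVneq i j; last first.
  rewrite (_ : map _ _ = children i A) // /children -map_comp; apply: eq_map => c /=.
  by apply/setP => y; rewrite !inE crd_tau (negbTE ne) -[in RHS]Aj inE.
subst j; rewrite /children -map_comp (eq_map (g := (fun c => [set y in A | crd i y == c]%SET) \o invF sh_inj)).
  by rewrite map_comp; apply: perm_map; exact: perm_inv_pt.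
move=> c /=; apply/setP => y; rewrite !inE crd_tau eqxx -[in RHS]Aj inE.
by rewrite -[in RHS](inj_eq sh_inj) f_invF.
Qed.

Lemma children_nonempty i A B : tau i @^-1: A = A -> (exists y, y \in A) ->
  B \in children i A -> exists y, y \in B.
Proof.
move=> Ai [y yA] /mapP[c _ ->].
have /mapP[m0 + m0E] := mem_pt (crd i y); have /mapP[m _ mE] := mem_pt c.
rewrite mem_iota add0n => /andP[_ m0p].
(* The first p - m0 steps bring coordinate [i] from its m0-th value back to [o]; m further steps
   lead to [c]. *)
exists (iter (p - m0 + m) (tau i) y); rewrite inE; apply/andP; split.
  by elim: (_ + _)%N => [//|n IH]; rewrite iterS -[A]Ai inE Ai in IH *.
have -> n : crd i (iter n (tau i) y) = iter n sh (crd i y).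
  by elim: n => [//|n IH]; rewrite !iterS crd_tau eqxx IH.
by rewrite m0E -iterD addnAC subnK ?(ltnW m0p) // addnC iterD sh_p -mE.
Qed.

(** The last clause makes the blocks singletons at level [nu], because the coordinates separate
    points. *)
Definition level_ok (l : nat) s :=
  [/\ forall y, once s y, forall A, A \in s -> exists y, y \in A,
      forall A i, A \in s -> (l <= i)%N -> tau i @^-1: A = A, size s = (p ^ l)%N &
      forall A x y i, A \in s -> x \in A -> y \in A -> (i < l)%N -> crd i x = crd i y].

Lemma level_step i s : level_ok i s -> level_ok i.+1 (flatten (map (children i) s)).
Proof.
move=> [os ne inv sz cst]; split.
- by move=> y; rewrite /once count_split; exact: os.
- move=> B /flatten_mapP[A As]; apply: children_nonempty; [exact: inv|exact: ne].
- move=> B j /flatten_mapP[A As /mapP[c _ ->]] ij; apply/setP => y.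
  rewrite !inE crd_tau ifN; last by rewrite -val_eqE /= ltn_eqF.
  by rewrite -[in RHS](inv A j As (ltnW ij)) inE.
- rewrite size_flatten /shape -map_comp (eq_map (g := fun=> p)).
    by rewrite sumnE big_map big_const_seq count_predT iter_addn_0 sz expnS.
  by move=> A /=; rewrite /children !size_map size_iota.
move=> B x y j /flatten_mapP[A As /mapP[c _ ->]]; rewrite !inE => /andP[xA /eqP xc] /andP[yA /eqP yc].
rewrite ltnS leq_eqVlt => /orP[/eqP/val_inj ->|]; first by rewrite xc yc.
exact: cst As xA yA.
Qed.

Lemma fam_subS l s (S S' : idx -> Prop) b v y :
  (forall a, S' a -> S a) -> fam l s S b v y -> fam l s S' b v y.
Proof. by move=> sub [v0 ys yd ye]; split=> // a /sub; [exact: ys|exact: yd|exact: ye]. Qed.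

Section Levels.
Variables (r : nat) (om : T -> F^o) (kap : idx -> T).
Hypothesis om_lin : linear om.
Hypothesis om_tau : forall i z, om (map_ch (tau i) z) = om z.
Hypothesis om_bd : forall z, om (bd z) = 0.
Hypothesis om_restr : forall s z, (forall A, A \in s -> exists y, y \in A) ->
  om (restr (hits s) z) = om z.

Definition dom (l : nat) b a : Prop :=
  (mabs a < r)%N /\ forall i, (i < l)%N -> (a i <= b i)%N.

Let dom_down l b a i : dom l b a -> (0 < a i)%N -> dom l b (decr i a).
Proof.
move=> [ar ab] ai; split; first by rewrite -ltnS (mabs_decr ai); exact: leqW.
by move=> j jl; apply: leq_trans (ab j jl); rewrite ffunE leq_subr.
Qed.

(** The equation for [mabs b] holds since both sides grow by p - 1 at each cut; at the last level it
    puts [b] just inside the range |a| < r. The functional [om] is carried along so that the final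
    nonzero value can be read on the original family [kap]. *)
Definition stage l s := exists b v y,
  [/\ fam l s (dom l b) b v y, forall i, (p.-1 %| b i)%N, (mabs b).+1 = size s &
      forall a, dom l b a -> om (y a) = om (kap a)].

Let stage_perm l s t : perm_eq s t -> stage l s -> stage l t.
Proof.
move=> st [b [v [y [/(fam_perm st)[c yf] bd bs yo]]]].
by exists b, ((-1) ^+ c * v), y; split=> //; rewrite bs; exact: perm_size.
Qed.

Let split_one i A s' : partition_seq (A :: s') -> perm_inv i (A :: s') ->
  (forall j, (i <= j)%N -> tau j @^-1: A = A) ->
  stage i (A :: s') -> stage i (children i A ++ s').
Proof.
move=> [os ne] inv Ai st.
(* [split_block] expects the block to be cut in last position, after the contractions by the
   others. *)
have pP : perm_eq (A :: s') (rcons s' A) by rewrite perm_sym perm_rcons.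
have [b [v [y [yf bdiv bs yo]]]] := stage_perm pP st.
have part : partition_seq (rcons s' A).
  split=> [x|B]; first by rewrite /once -(seq.permP pP); exact: os.
  by rewrite -(perm_mem pP); exact: ne.
have invr : perm_inv i (rcons s' A).
  move=> j ij; apply: perm_trans (perm_trans (inv j ij) pP).
  by apply: perm_map; rewrite perm_sym.
have inv' : perm_inv i (s' ++ children i A).
  move=> j ij; rewrite map_cat; apply: perm_cat; last by apply: children_perm => //; exact: Ai.
  by have := inv j ij; rewrite /= Ai // perm_cons.
have sdiv : (p.-1 %| size s')%N.
  move: bs; rewrite size_rcons => -[<-].
  by apply: (big_ind (fun n => p.-1 %| n)%N) => // ? ?; exact: dvdn_add.
have dd a j := @dom_down i b a j.
have dr a : dom i b a -> (mabs a < r)%N by case.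
have [v' v'0 yf'] := split_block part invr Ai dd dr yf sdiv bdiv inv'.
apply: (stage_perm (s := s' ++ children i A)); first by rewrite perm_catC.
set b' := finfun _ in yf'.
have b'E j : (j < i)%N -> b' j = b j.
  by move=> ji; rewrite ffunE -val_eqE /= ltn_eqF // addn0.
have domE a : dom i b' a -> dom i b a.
  by move=> [ar ab]; split=> // j ji; rewrite -b'E //; exact: ab.
exists b', v', (fun a => restr (hits (s' ++ children i A)) (y a)); split.
- exact: fam_subS yf'.
- by move=> j; rewrite ffunE dvdn_add //; case: eqP => _; rewrite ?mul1n ?mul0n.
- rewrite size_cat /children !size_map size_iota.
  move: bs; rewrite size_rcons => -[<-].
  rewrite -[in RHS](prednK (prime_gt0 p_prime)) addnS; congr S.
  rewrite /mabs (eq_bigr (fun j : 'I_nu => b j + (j == i) * p.-1)%N); last by move=> j _; rewrite ffunE.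
  rewrite big_split /=; congr addn; rewrite (bigD1 i) //= eqxx mul1n big1 ?addn0 //.
  by move=> j /negbTE ->.
move=> a /domE da; rewrite om_restr ?yo // => B; rewrite mem_cat => /orP[Bs|].
  by apply: ne; rewrite inE Bs orbT.
by apply: children_nonempty; [exact: Ai|apply: ne; exact: mem_head].
Qed.

Let split_all i s : level_ok i s -> stage i s -> stage i (flatten (map (children i) s)).
Proof.
move=> [os ne inv _ _].
(* [t] lists the blocks still to be cut, [d] those already cut. *)
suff main t d : perm_eq (t ++ d) s -> stage i (t ++ flatten (map (children i) d)) ->
    stage i (flatten (map (children i) (catrev t d))).
  move=> st; have := main s [::]; rewrite cats0 => /(_ (perm_refl s)).
  rewrite ?cats0 => /(_ st); apply: stage_perm.
  by apply: perm_flatten; apply: perm_map; rewrite perm_rev.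
elim: t d => [|A t IH] d //= tds st.
apply: IH; first by apply: perm_trans tds; rewrite perm_catC /= perm_cons perm_catC.
rewrite /= catA; apply: (stage_perm (s := children i A ++ (t ++ flatten (map (children i) d)))).
  by rewrite catA perm_cat2r perm_catC.
have inv1 B j : B \in A :: t ++ d -> (i <= j)%N -> tau j @^-1: B = B.
  by rewrite (perm_mem tds); exact: inv.
apply: split_one st; last by move=> j; apply: inv1; exact: mem_head.
- split=> [y|B].
    have := os y; rewrite /once -(seq.permP tds) /= !count_cat count_split.
    by [].
  rewrite inE mem_cat => /or3P[/eqP ->|Bt|/flatten_mapP[B' B'd]].
  + by apply: ne; rewrite -(perm_mem tds) mem_head.
  + by apply: ne; rewrite -(perm_mem tds) inE mem_cat Bt orbT.
  + apply: children_nonempty.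
      by move=> *; apply: inv1; rewrite // inE mem_cat B'd !orbT.
    by apply: ne; rewrite -(perm_mem tds) inE mem_cat B'd !orbT.
- move=> j ij; rewrite /= inv1 ?mem_head // perm_cons map_cat; apply: perm_cat.
    rewrite (_ : [seq _ | A0 <- t] = t) //.
    rewrite -[RHS]map_id; apply/eq_in_map => B Bt.
    by apply: inv1; rewrite // inE mem_cat Bt orbT.
  have : {subset d <= A :: t ++ d} by move=> B Bd; rewrite inE mem_cat Bd !orbT.
  elim: {tds} d (A :: t ++ d) inv1 => [//|B d IHd] u invu sub /=.
  rewrite map_cat; apply: perm_cat; last first.
    by apply: (IHd u) => // B' B'd; apply: sub; rewrite inE B'd orbT.
  by apply: children_perm => //; apply: invu => //; apply: sub; exact: mem_head.
Qed.

Let level_inv i s : level_ok i s -> perm_inv i (flatten (map (children i) s)).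
Proof.
move=> [_ _ inv _ _] j ij; elim: s inv => [//|A s IH] inv /=.
rewrite map_cat; apply: perm_cat.
  by apply: children_perm => //; apply: inv => //; exact: mem_head.
by apply: IH => B k Bs; apply: inv; rewrite inE Bs orbT.
Qed.

Let next_stage i s : level_ok i s -> stage i s ->
  stage i.+1 (flatten (map (children i) s)).
Proof.
move=> ok /(split_all ok)[b [v [y [yf bdiv bs yo]]]].
have [os ne _ _ _] := level_step ok.
have dd a j := @dom_down i b a j.
have dr a : dom i b a -> (mabs a < r)%N by case.
have omb z : om (bds (flatten (map (children i) s)) z) = 0 by rewrite om_restr.
have [y' yf' yo'] := drop_level (conj os ne) (level_inv ok) dd dr yf om_lin om_tau omb.
have domE a : dom i.+1 b a -> dom i b a /\ (a i <= b i)%N.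
  move=> [ar ab]; split; last exact: ab.
  by split=> // j ji; apply: ab; exact: ltnW.
exists b, v, y'; split=> //; first exact: fam_subS yf'.
by move=> a /domE[da _]; rewrite yo' // yo.
Qed.

Lemma stages : stage 0 [:: [set: Y]%SET] -> (exists y : Y, True) ->
  exists2 s, level_ok nu s & stage nu s.
Proof.
move=> st [y0 _].
suff main l : (l <= nu)%N -> exists2 s, level_ok l s & stage l s by exact: main.
elim: l => [_|l IH lnu]; last first.
  have [s sok sst] := IH (ltnW lnu).
  exists (flatten (map (children (Ordinal lnu)) s)); first exact: (level_step (i := Ordinal lnu)).
  exact: (next_stage (i := Ordinal lnu)).
exists [:: [set: Y]%SET] => //; split=> //.
- by move=> y; rewrite /once /= finset.in_setT.
- by move=> A; rewrite inE => /eqP ->; exists y0; rewrite finset.in_setT.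
- by move=> A i; rewrite inE => /eqP -> _; apply/setP => y; rewrite !inE.
Qed.

End Levels.

Let sfin : seq {set Y} := [seq [set y]%SET | y <- enum Y].

Let sfin_once y : once sfin y.
Proof.
rewrite /once count_map (eq_count (a2 := pred1 y)); last first.
  by move=> x /=; rewrite finset.in_set1 eq_sym.
by rewrite count_uniq_mem ?enum_uniq // mem_enum.
Qed.

Let singletons_perm s : (forall y, once s y) -> (forall A, A \in s -> exists y, y \in A) ->
  (forall A x y, A \in s -> x \in A -> y \in A -> x = y) -> perm_eq s sfin.
Proof.
move=> os ne sing; have sE A y : A \in s -> y \in A -> A = [set y]%SET.
  move=> As yA; apply/setP => x; rewrite inE; apply/idP/eqP => [xA|->//].
  exact: sing As xA yA.
apply: uniq_perm.
- apply: count_mem_uniq => A; have [As|/count_memPn ->//] := boolP (A \in s).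
  have [y yA] := ne A As; apply/eqP; rewrite eqn_leq -has_count has_pred1 As andbT.
  rewrite -[X in (_ <= X)%N](eqP (os y)); apply: sub_count => B /= /eqP ->; exact: yA.
- by rewrite map_inj_uniq ?enum_uniq //; exact: set1_inj.
move=> A; apply/idP/mapP => [As|[y _ ->]].
  by have [y yA] := ne A As; exists y; [rewrite mem_enum|exact: sE].
have /eqP e := os y; have /hasP[B Bs yB] : has (fun B : {set Y} => y \in B) s by rewrite has_count e.
by rewrite -(sE B).
Qed.

Let tau_bij i x : exists y, tau i y = x.
Proof.
exists (iter p.-1 (tau i) x); rewrite -iterS prednK ?prime_gt0 //; exact: tau_p.
Qed.

Let tau_inj i : injective (tau i).
Proof. by move=> x y e; rewrite -(tau_p i x) -(tau_p i y) -(prednK (prime_gt0 p_prime)) !iterSr e. Qed.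

Let sfin_perm i : perm_eq [seq tau i @^-1: A | A : {set Y} <- sfin] sfin.
Proof.
apply: singletons_perm.
- move=> y; rewrite /once count_map; have := sfin_once (tau i y); rewrite /once.
  by congr (_ == _); apply: eq_count => A /=; rewrite inE.
- move=> A /mapP[B /mapP[x _ ->] ->]; have [y yx] := tau_bij i x.
  by exists y; rewrite !inE yx.
move=> A x y /mapP[B /mapP[z _ ->] ->]; rewrite !inE => /eqP <- /eqP.
by move/tau_inj.
Qed.

(** A Borsuk-Ulam statement in chain form: [kap] is an equivariant chain map from the truncated
    resolution, augmented by [bd (kap 0) = gen [::]]. At the last level the nonzero value of [eps]
    at [b] is, up to sign, that of [eps sfin] on [kap b], and [eps sfin] sees only words that hit
    all singletons. *)
Theorem full_word (r : nat) (kap : idx -> T) : r = (p ^ nu)%N -> (exists y : Y, True) ->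
  (forall a, (mabs a < r)%N -> spt (fun w => w != [::]) (kap a)) ->
  (forall a, (mabs a < r)%N -> (0 < mabs a)%N ->
     bd (kap a) = dtot p (fun i => map_ch (tau i)) kap a) ->
  bd (kap [ffun=> 0%N]) = gen [::] ->
  exists a w, [/\ (mabs a < r)%N, mcoeff w (kap a) != 0 & forall y, y \in w].
Proof.
move=> rE y_ex kap_ne kap_bd kap0; apply: contrapT => nofull.
have setT_hits w : hits [:: [set: Y]%SET] w = (w != [::]).
  by case: w => //= y w; rewrite finset.in_setT.
have bdE z : iota_ch (ind [set: Y]%SET) z = bd z :> T.
  by apply: eq_iota => y; rewrite /ind finset.in_setT.
have kap_id a : (mabs a < r)%N -> restr (hits [:: [set: Y]%SET]) (kap a) = kap a.
  by move=> ar; apply: restr_id; apply: spt_sub (kap_ne a ar) => w; rewrite setT_hits.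
have mabs0 a : (mabs a == 0%N) = (a == [ffun=> 0%N]).
  apply/eqP/eqP => [a0|->]; last by rewrite /mabs big1 // => i _; rewrite ffunE.
  by apply/ffunP => i; rewrite ffunE; apply/eqP; rewrite -leqn0 -a0 /mabs (bigD1 i) //= leq_addr.
pose tauE := fun i => map_ch (F := F) (tau i).
have kap_fam : fam 0 [:: [set: Y]%SET] (fun a => (mabs a < r)%N) [ffun=> 0%N] 1 kap.
  have dtot_kap a : (mabs a < r)%N ->
      restr (hits [:: [set: Y]%SET]) (dtot p tauE kap a) = dtot p tauE kap a.
    move=> ar; rewrite (@dtot_morph _ p _ _ _ _ tauE); last 2 first.
    - by lin.
    - move=> i x; apply: restr_hits_map.
      by rewrite /= (_ : _ @^-1: _ = [set: Y]%SET) //; apply/setP => y; rewrite !inE.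
    apply: eq_dtot => i ai /=; apply: kap_id.
    by rewrite -ltnS (mabs_decr ai) ltnS ltnW.
  split=> //; first exact: oner_neq0.
    move=> a ar; rewrite /bds; have [a0|a0] := posnP (mabs a).
      have /eqP -> : a == [ffun=> 0%N] by rewrite -mabs0 a0.
      rewrite kap0 restr_gen setT_hits /= /dtot big1 // => i _.
      by rewrite ffunE /theta /= scaler0.
    by rewrite kap_bd // dtot_kap.
  move=> a ar; rewrite /eps /= bdE; have [a0|a0] := posnP (mabs a).
    have /eqP -> : a == [ffun=> 0%N] by rewrite -mabs0 a0.
    by rewrite kap0 cnil_gen !eqxx.
  rewrite -mabs0 (gtn_eqF a0) kap_bd // -dtot_kap // cnil0 //.
  by apply: spt_sub (spt_restrP (P := hits [:: [set: Y]%SET]) (z := dtot p tauE kap a)) => w; rewrite setT_hits.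
have st0 : stage r (eps sfin) kap 0 [:: [set: Y]%SET].
  exists [ffun=> 0%N], 1, kap; split=> //.
  - by apply: fam_subS kap_fam => a [].
  - by move=> i; rewrite ffunE dvdn0.
  - by rewrite (_ : mabs _ = 0%N) //; apply/eqP; rewrite mabs0.
have sfin_hits w : hits sfin w -> forall y, y \in w.
  move=> /allP h y; have /h/hasP[x xw] : [set y]%SET \in sfin.
    by apply/mapP; exists y => //; rewrite mem_enum.
  by rewrite inE finset.in_set1 => /eqP <-.
have [||||s [os ne _ sz cst] [b [v [y [yf _ bs yo]]]]] :=
  @stages r (eps sfin) kap _ _ _ _ st0 y_ex.
- by move=> c u w; rewrite linearP.
- by move=> i z; exact: (eps_map_inv z charFp (tau_p i) (sfin_perm i)).
- by move=> z; apply: eps_bd; exact: spt_once.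
(* A word that hits all singletons hits every nonempty block, so the words removed by the
   restriction have value zero. *)
- move=> s z ne; rewrite [in RHS](chain_split (hits s) z) linearD /= [X in _ + X]eps_nothit ?addr0 //.
  apply: spt_sub (spt_restrP (P := fun w => ~~ hits s w) (z := z)) => w.
  apply: contra => /sfin_hits w_full; apply/allP => A /ne[x xA].
  by apply/hasP; exists x.
have sP : perm_eq s sfin.
  apply: singletons_perm => // A x x' As xA x'A; apply: crd_inj => i.
  exact: cst As xA x'A (ltn_ord i).
have br : (mabs b < r)%N by rewrite bs sz rE.
have db : dom r nu b b by split.
have [v0 _ _ ye] := yf.
have [c cE] := eps_perm F sP.
have : eps s (y b) = v by rewrite ye // eqxx.
rewrite cE yo // eps_nothit ?mulr0; first by move=> e; rewrite -e eqxx in v0.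
move=> w kw; apply/negP => /sfin_hits wf; apply: nofull.
by exists b, w; split.
Qed.

End Coordinates.

(** * Exactness of the complex of injective words *)

Section InjectiveWords.
Local Open Scope ring_scope.
Variables (F : fieldType) (Y : finType).
Local Notation T := (malg (seq Y) F).
Implicit Types (z : T) (y : Y) (u v w : seq Y) (S : {set Y}).

Definition inj_word S n w := [/\ uniq w, {subset w <= S} & size w = n].

Definition quot v : T -> T := lift (fun w => if prefix v w then gen (drop (size v) w) else 0).
HB.instance Definition _ v := GRing.Linear.on (quot v).

Definition cons_word v z : T := foldr (fun y => cons_ch y) z v.

Lemma cons_word_linear v : linear (cons_word v).
Proof. by elim: v => [//|y v IH] a x z /=; rewrite IH linearP. Qed.
HB.instance Definition _ v :=
  GRing.isLinear.Build F T T *:%R (cons_word v) (cons_word_linear v).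

Lemma cons_word_gen v w : cons_word v (gen w) = gen (v ++ w) :> T.
Proof. by elim: v => [//|y v IH] /=; rewrite IH cons_gen. Qed.

Lemma quot_gen v w : quot v (gen w) = if prefix v w then gen (drop (size v) w) else 0.
Proof. exact: lift_gen. Qed.

Lemma quot_cons x v y z : quot (x :: v) (cons_ch y z) = if x == y then quot v z else 0.
Proof.
move: z; apply: lin_ext => [||w]; first by lin.
  by case: (x == y); lin.
by rewrite cons_gen !quot_gen prefix_cons; case: (x == y).
Qed.

Lemma quot_nil z : quot [::] z = z.
Proof.
move: z; apply: lin_ext => [||w]; [lin|lin|].
by rewrite quot_gen prefix0s drop0.
Qed.

Lemma spt_cons_word (P Q : seq Y -> Prop) v z :
  (forall w, P w -> Q (v ++ w)) -> spt P z -> spt Q (cons_word v z).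
Proof.
move=> H; move: z; apply: chain_ind => [|a w z Pw IH]; first by rewrite linear0; exact: spt0.
rewrite linearP /= cons_word_gen; apply: sptD => //; apply: sptZ; apply: spt_gen; exact: H.
Qed.

(* Deleting a letter of the prefix [rcons u a] either removes [a] or moves it
   to the left, so only the deletions behind the prefix are seen by [quot]. *)
Lemma quot_bd a u w : uniq w -> (a \in w -> (index a w <= size u)%N) ->
  quot (rcons u a) (bd (gen w)) = (-1) ^+ (size u).+1 *: bd (quot (rcons u a) (gen w)).
Proof.
elim: u w => [|x u IH] [|y w] /=.
- by rewrite bd_nil !linear0 quot_gen /= linear0 scaler0.
- move=> /andP[yw uw]; rewrite inE => H; rewrite -cons_gen bd_cons linearB /= !quot_cons.
  rewrite quot_gen ifN ?sub0r.
    by rewrite expr1 scaleN1r; case: (a == y); rewrite ?quot_nil // ?linear0 ?oppr0 ?linear0.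
  apply/negP => /prefixP[t wE]; have aw : a \in w by rewrite wE mem_head.
  move: H; rewrite aw orbT => /(_ isT); case: eqVneq => [ya|//] _.
  by move: yw; rewrite ya aw.
- by rewrite bd_nil !linear0 quot_gen /= linear0 scaler0.
move=> /andP[yw uw]; rewrite inE => H; rewrite -cons_gen bd_cons linearB /= !quot_cons.
have aw : a \in w -> (index a w <= size u)%N.
  move=> aw; move: H; rewrite aw orbT; case: eqVneq => [ya|]; last by move=> _ /(_ isT).
  by move: yw; rewrite ya aw.
rewrite quot_gen ifN ?sub0r.
  case: eqP => _; last by rewrite raddf0 raddf0 scaler0.
  by rewrite IH // [in RHS]exprS mulN1r scaleNr.
apply/negP => /prefixP[t]; rewrite -rcons_cons => wE; have aiw : a \in w by rewrite wE mem_cat mem_rcons mem_head.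
move: (aw aiw); rewrite wE index_cat mem_rcons mem_head.
have auw : uniq (rcons (x :: u) a) by move: uw; rewrite wE cat_uniq => /andP[].
rewrite -cats1 index_cat ifN /= ?eqxx ?addn0 ?ltnn //.
by move: auw; rewrite rcons_uniq => /andP[].
Qed.

(** The Leibniz rule for a prefix: the error consists of the words in which a letter of [v] was
    deleted, and [P] records where these lie. *)
Lemma bd_cons_word (P Q : seq Y -> Prop) v z :
  (forall v1 y v2 w, v = v1 ++ y :: v2 -> Q w -> P (v1 ++ v2 ++ w)) -> spt Q z ->
  spt P (bd (cons_word v z) - (-1) ^+ size v *: cons_word v (bd z)).
Proof.
move=> H Qz; elim: v P H => [|y v IH] P H /=.
  by rewrite scale1r subrr; exact: spt0.
rewrite bd_cons exprS mulN1r scaleNr opprK -addrA addrC.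
rewrite (_ : - cons_ch y _ + _ = - cons_ch y (bd (cons_word v z) - (-1) ^+ size v *: cons_word v (bd z))).
  apply: sptD.
    apply: sptN; apply: (spt_cons (P := fun t => P (y :: t))) => //.
    by apply: IH => v1 x v2 w vE Qw; apply: (H (y :: v1) x v2 w) => //; rewrite vE.
  apply: (spt_cons_word (P := Q)) => // w Qw; exact: (H [::] y v w).
by rewrite linearB linearZ /= opprB addrC.
Qed.

(* Kerz's argument: for a fixed letter [a], a cycle is pushed, by filling in its
   parts behind the prefixes ending in [a], to words where [a] occurs earlier,
   and finally to words without [a]; these bound the cone with apex [a]. *)
Lemma inj_exact S n z : (n < #|S|)%N -> spt (inj_word S n) z -> bd z = 0 ->
  exists2 u, spt (inj_word S n.+1) u & bd u = z.
Proof.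
have [m] := ubnP #|S|; elim: m S n z => [//|m IHm] S n z Sm nS.
have /card_gt0P[a aS] : (0 < #|S|)%N by exact: leq_ltn_trans nS.
suff main i z' : spt (fun w => inj_word S n w /\ (a \in w -> (index a w < i)%N)) z' ->
    bd z' = 0 -> exists2 u, spt (inj_word S n.+1) u & bd u = z'.
  move=> zP zb; apply: (main n) => //; apply: spt_sub zP => w [uw wS sz].
  by split=> // aw; rewrite -sz index_mem.
elim: i z' => [|i IHi] {}z zP zb.
  exists (cons_ch a z); last by rewrite bd_cons zb linear0 subr0.
  apply: spt_cons zP => w [[uw wS sz] aw]; split=> /=; last by rewrite sz.
    by rewrite uw andbT; apply/negP => /aw.
  by move=> y; rewrite inE => /orP[/eqP ->|/wS].
pose good (u : i.-tuple Y) := uniq u && all (mem (S :\ a)) u.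
have zq (u : i.-tuple Y) : spt (fun t => good u /\
    inj_word (S :\: [set y in rcons u a]) (n - i.+1) t) (quot (rcons u a) z).
  apply: spt_lift zP => w [[uw wS sz] _]; case: ifP => [|_]; last exact: spt0.
  case/prefixP => t wE; rewrite wE drop_size_cat //; apply: spt_gen.
  move: uw; rewrite wE cat_uniq rcons_uniq => /and3P[/andP[au uu] hut ut].
  split.
    rewrite /good uu /=; apply/allP => y yu; rewrite /= !inE.
    rewrite (contraNneq _ au) //; last by move=> <-.
    by apply: wS; rewrite wE mem_cat mem_rcons inE yu orbT.
  split=> // [y yt|]; last by rewrite -sz wE size_cat size_rcons size_tuple addKn.
  rewrite !inE (hasPn hut) //; apply: wS.
  by rewrite wE mem_cat yt orbT.
have zqb (u : i.-tuple Y) : bd (quot (rcons u a) z) = 0.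
  have : quot (rcons u a) (bd z) = (-1) ^+ (size u).+1 *: bd (quot (rcons u a) z).
    move: z zP {zb zq}; apply: lin_extP => [||w [[uw _ _] aw]]; [lin|lin|].
    by apply: quot_bd => // /aw; rewrite size_tuple ltnS.
  rewrite zb linear0 => /esym/eqP; rewrite scaler_eq0 signr_eq0 /=.
  by move/eqP.
have step (u : i.-tuple Y) : exists x,
    spt (fun t => [/\ good u, (i < n)%N & inj_word (S :\: [set y in rcons u a]) (n - i.+1).+1 t]) x /\
    bd x = quot (rcons u a) z.
  have zero : quot (rcons u a) z = 0 -> exists x,
    spt (fun t => [/\ good u, (i < n)%N & inj_word (S :\: [set y in rcons u a]) (n - i.+1).+1 t]) x /\
    bd x = quot (rcons u a) z.
    by move=> ->; exists 0; split; [exact: spt0|rewrite linear0].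
  have [gu|ngu] := pselect (good u); last first.
    by apply: zero; apply: spt_eq0; apply: spt_sub (zq u) => t [/ngu].
  (* For n <= i no word of length n has a prefix of length i + 1. The case is separate because
     [n - i.+1] is truncated. *)
  have [lin|/negP nlin] := pselect (i < n)%N; last first.
    rewrite -leqNgt in nlin; apply: zero; apply: spt_eq0; move: (z) zP; rewrite /quot.
    move=> z0; apply: spt_lift => w [[uw wS sz] _]; case: ifP => [|_]; last exact: spt0.
    by move/size_prefix; rewrite size_rcons size_tuple sz ltnNge nlin.
  have cS : #|S :\: [set y in rcons u a]| = (#|S| - i.+1)%N.
    rewrite cardsD (finset.setIidPr _); last first.
      apply/fintype.subsetP => y; rewrite inE mem_rcons inE => /orP[/eqP ->//|yu].
      by case/andP: gu => _ /allP/(_ _ yu); rewrite /= !inE => /andP[].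
    congr (_ - _)%N; rewrite cardsE; apply/eqP; rewrite -[X in _ == X](size_tuple [tuple of rcons u a]).
    apply/eqP/card_uniqP; rewrite /= rcons_uniq; case/andP: gu => -> /allP gu; rewrite andbT.
    by apply/negP => /gu /=; rewrite !inE eqxx.
  have [||||x xP xb] := IHm (S :\: [set y in rcons u a]) (n - i.+1)%N (quot (rcons u a) z).
  - by rewrite cS -ltnS; apply: leq_trans Sm; rewrite ltnS ltn_subrL (leq_ltn_trans _ nS).
  - by rewrite cS ltn_sub2r // (leq_ltn_trans lin).
  - by apply: spt_sub (zq u) => t [].
  - exact: zqb.
  by exists x; split=> //; apply: spt_sub xP => t.
have [x xP] := choice step.
(* Compensates the sign of moving the boundary past a prefix of length i + 1. *)
pose c : F := (-1) ^+ i.+1.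
pose b : T := \sum_(u : i.-tuple Y) cons_word (rcons u a) (x u).
have good_cons (u : i.-tuple Y) t : good u -> (i < n)%N -> inj_word (S :\: [set y in rcons u a]) (n - i.+1).+1 t ->
    [/\ uniq (rcons u a ++ t), {subset rcons u a ++ t <= S} & size (rcons u a ++ t) = n.+1].
  move=> /andP[uu /allP us] lin [ut tS st]; split.
  - rewrite cat_uniq rcons_uniq uu ut !andbT; apply/andP; split.
      by apply/negP => /us /=; rewrite !inE eqxx.
    by apply/hasPn => y /tS; rewrite !inE => /andP[].
  - move=> y; rewrite mem_cat mem_rcons inE => /orP[/orP[/eqP ->//|/us]|/tS].
      by rewrite /= !inE => /andP[].
    by rewrite inE => /andP[].
  by rewrite size_cat size_rcons size_tuple st addnS subnKC.
have bP : spt (inj_word S n.+1) (c *: b).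
  apply: sptZ; apply: spt_sum => u _; have [xu _] := xP u.
  by apply: spt_cons_word xu => t [gu lin tP]; have [? ? ?] := good_cons u t gu lin tP.
pose z1 := z - bd (c *: b).
have [||y yP yb] := IHi z1.
(* The first bracket removes exactly the words with [a] at position i. The second collects the
   Leibniz errors, in which either [a] itself was deleted or an earlier letter, so that [a] moved to
   a smaller position. *)
- have -> : z1 = (z - \sum_(u : i.-tuple Y) cons_word (rcons u a) (quot (rcons u a) z))
      - c *: \sum_(u : i.-tuple Y) (bd (cons_word (rcons u a) (x u))
           - (-1) ^+ size (rcons u a) *: cons_word (rcons u a) (bd (x u))).
    rewrite /z1 (linearZZ (@bd F Y)) /b (linear_sum (@bd F Y)) /= sumrB scalerBr opprB addrA.
    rewrite [X in _ = _ + X - _](_ : _ = \sum_(u : i.-tuple Y) cons_word (rcons u a) (quot (rcons u a) z)).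
      by rewrite subrK.
    rewrite scaler_sumr; apply: eq_bigr => u _; have [_ ->] := xP u.
    by rewrite scalerA size_rcons size_tuple -expr2 sqrr_sign scale1r.
  apply: sptB.
    move: z zP {zb zq zqb x step xP b bP z1}; apply: chain_ind => [|e w z1 [[uw wS sz] aw] IH].
      rewrite [X in _ - X]big1 ?subr0 => [|u _]; first exact: spt0.
      by rewrite !raddf0.
    rewrite (_ : _ - _ = e *: (gen w - \sum_(u : i.-tuple Y) cons_word (rcons u a) (quot (rcons u a) (gen w)))
       + (z1 - \sum_(u : i.-tuple Y) cons_word (rcons u a) (quot (rcons u a) z1))); last first.
      rewrite scalerBr addrACA -opprD; congr (_ - _).
      rewrite scaler_sumr -big_split /=; apply: eq_bigr => u _.
      by rewrite linearP /= linearP.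
    apply: sptD => //; apply: sptZ.
    have [[aiw ai]|nai] := pselect (a \in w /\ index a w = i).
      have iw : size (take i w) == i by rewrite size_take -ai index_mem aiw.
      have wE : w = rcons (take i w) a ++ drop i.+1 w.
        by rewrite -{1}(cat_take_drop i w) -[in LHS]ai drop_index // ai cat_rcons.
      rewrite (bigD1 (Tuple iw)) //= big1 ?addr0; last first.
        move=> u uN; rewrite quot_gen; case: ifP => [/prefixP[t wE']|_]; last exact: linear0.
        case/eqP: uN; apply/val_inj => /=.
        by rewrite wE' -cats1 -catA take_size_cat ?size_tuple.
      have pw : prefix (rcons (take i w) a) w by rewrite [X in prefix _ X]wE prefix_prefix.
      rewrite quot_gen /= pw cons_word_gen.
      rewrite (_ : _ ++ _ = w) ?subrr; first exact: spt0.
      by rewrite [in RHS]wE size_rcons (eqP iw).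
    rewrite big1 ?subr0.
      apply: spt_gen; split=> // aiw; have := aw aiw; rewrite ltnS leq_eqVlt => /orP[/eqP e'|//].
      by case: nai.
    move=> u _; rewrite quot_gen; case: ifP => [/prefixP[t wE]|_]; last exact: linear0.
    case: nai; split; first by rewrite wE mem_cat mem_rcons mem_head.
    move: uw; rewrite wE cat_uniq rcons_uniq => /andP[/andP[au _] _].
    by rewrite index_cat mem_rcons mem_head -cats1 index_cat (negbTE au) /= eqxx size_tuple addn0.
  apply: sptZ; apply: spt_sum => u _; have [xu _] := xP u.
  apply: (bd_cons_word (Q := fun t => [/\ good u, (i < n)%N & inj_word (S :\: [set y in rcons u a]) (n - i.+1).+1 t])) => //.
  move=> v1 y v2 t vE [gu lin tP]; have [uq sb sz] := good_cons u t gu lin tP.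
  have sbs : subseq (v1 ++ v2 ++ t) (rcons u a ++ t).
    by rewrite vE -catA /= cat_subseq // ?subseq_refl // -cat1s suffix_subseq // suffix_suffix.
  split.
    split; first exact: subseq_uniq sbs uq.
      by move=> q /(mem_subseq sbs); exact: sb.
    by apply: succn_inj; rewrite -sz vE !size_cat /= addnS addSn addnA.
  move=> aq; case: (lastP v2) vE sbs aq => [|v3 q] vE sbs aq.
    have yE : y = a by move: vE; rewrite cats1 => /rcons_inj[].
    move: uq; rewrite cat_uniq rcons_uniq => /and3P[/andP[au _] ant _].
    have uE : tval u = v1 by move: vE; rewrite cats1 => /rcons_inj[].
    move: aq; rewrite mem_cat -uE (negbTE au) /= => at'.
    by move/hasPn: ant => /(_ _ at'); rewrite mem_rcons mem_head.
  move: vE; rewrite -rcons_cons -rcons_cat => /rcons_inj[uE qE].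
  move: uq; rewrite cat_uniq rcons_uniq => /and3P[/andP[au _] _ _].
  have sv : (size v1 + size v3 < i)%N by rewrite -(size_tuple u) uE size_cat /= addnS.
  rewrite -qE -cats1 -!catA catA index_cat ifN; last first.
    by apply: contra au; rewrite uE !mem_cat inE => /orP[->|->]; rewrite ?orbT.
  by rewrite /= eqxx addn0 size_cat.
- by rewrite linearB /= zb bd_bd subr0.
exists (y + c *: b); first by apply: sptD.
by rewrite linearD /= yb subrK.
Qed.

End InjectiveWords.

(** * Full words in the image of an equivariant chain map *)

Section EquivariantChainMap.
Local Open Scope ring_scope.
Variables (F : fieldType) (p : nat).
Hypothesis p_prime : prime p.
Hypothesis charFp : p \in [pchar F].
Variables (C : finType) (o : C) (sh : C -> C).
Hypothesis cardC : #|C| = p.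
Hypothesis pt_inj : forall k l, (k < p)%N -> (l < p)%N ->
  (iter k sh o == iter l sh o) = (k == l).
Hypothesis sh_inj : injective sh.
Hypothesis sh_p : forall c, iter p sh c = c.
Variables (nu : nat) (Y : finType) (tau : 'I_nu -> Y -> Y) (crd : 'I_nu -> Y -> C).
Hypothesis crd_tau : forall i j y,
  crd i (tau j y) = if i == j then sh (crd i y) else crd i y.
Hypothesis crd_inj : forall x y, (forall i, crd i x = crd i y) -> x = y.
Hypothesis cardY : #|Y| = (p ^ nu)%N.

Local Notation T := (malg (seq Y) F).
Local Notation idx := {ffun 'I_nu -> nat}.
Local Notation tauE := (fun i => map_ch (F := F) (tau i)).

(** A single point [[:: y0]] in degree 0 extends to a chain map because the resolution is free and
    injective words are exact in the range. [lift_family] solves the homotopy equation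
    [bd h = g - dtot h]; it is applied to the obstruction [g] of [x0], concentrated in degree 1, and
    the factor (-1)^|a| turns its solution into a chain map. The augmentation is the zero
    functional, since the empty word already belongs to the complex. *)
Lemma inj_family : exists x : idx -> T,
  [/\ forall a, (mabs a < #|Y|)%N -> spt (inj_word [set: Y]%SET (mabs a).+1) (x a),
      forall a, (mabs a < #|Y|)%N -> (0 < mabs a)%N -> bd (x a) = dtot p tauE x a &
      bd (x [ffun=> 0%N]) = gen [::]].
Proof.
have TL i : linear (tauE i) by lin.
have TC i j z : tauE i (tauE j z) = tauE j (tauE i z).
  by rewrite !map_comp_ch; congr map_ch; apply/funext => y /=; rewrite (tauC crd_tau crd_inj).
have TP i z : iter p (tauE i) z = z.
  have := tauT_p (F := F) sh_p crd_tau crd_inj 0 i z.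
  by rewrite /tauT.
have /card_gt0P[y0 _] : (0 < #|Y|)%N by rewrite cardY expn_gt0 prime_gt0.
have mabs0 (a : idx) : (mabs a == 0%N) = (a == [ffun=> 0%N]).
  apply/eqP/eqP => [a0|->]; last by rewrite /mabs big1 // => i _; rewrite ffunE.
  by apply/ffunP => i; rewrite ffunE; apply/eqP; rewrite -leqn0 -a0 /mabs (bigD1 i) //= leq_addr.
have mdec (a : idx) i : (0 < a i)%N -> mabs (decr i a) = (mabs a).-1.
  by move=> ai; rewrite -(mabs_decr ai).
pose x0 (a : idx) : T := if mabs a == 0%N then gen [:: y0] else 0.
pose g (a : idx) : T := if mabs a == 1%N then - dtot p tauE x0 a else 0.
have theta_nil i k : theta p tauE i k (gen [::] : T) = 0.
  rewrite /theta; case: eqP => // _; case: (odd k); first by rewrite map_gen subrr.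
  rewrite (eq_bigr (fun=> gen [::])) => [|j _].
    by rewrite sumr_const card_ord -scaler_nat pcharf0 // scale0r.
  by elim: (j : nat) => [//|m IH]; rewrite iterS IH map_gen.
have tau_inj i : injective (tau i).
  move=> y z e; have tp := tau_p sh_p crd_tau crd_inj i.
  by rewrite -(tp y) -(tp z) -(prednK (prime_gt0 p_prime)) !iterSr e.
have degT n i z : spt (inj_word [set: Y]%SET n) z -> spt (inj_word [set: Y]%SET n) (tauE i z).
  apply: spt_map => w [uw _ sw]; split; rewrite ?size_map ?map_inj_uniq //.
  by move=> y; rewrite finset.in_setT.
have [h hP] : exists h : idx -> T, forall a, (mabs a < #|Y|)%N ->
    spt (inj_word [set: Y]%SET (mabs a).+1) (h a) /\ bd (h a) = g a - dtot p tauE h a.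
  apply: (@lift_family F p nu T tauE (@bd F Y) (fun=> 0) charFp TL TC TP _ _ _ _
    (fun n => spt (inj_word [set: Y]%SET n)) #|Y| _ _ degT _
    (fun a => (mabs a < #|Y|)%N) _ _ g).
  - by lin.
  - by move=> i z; exact: bd_map.
  - exact: linear_zerof.
  - by [].
  - by move=> n; exact: spt0.
  - by move=> n c u v Pu Pv; apply: sptD => //; exact: sptZ.
  - by move=> n z nY zP zb _; apply: inj_exact => //; rewrite cardsT.
  - by move=> a i ay ai; rewrite -ltnS (mabs_decr ai); exact: leqW.
  - by [].
  - move=> a _; rewrite /g; case: eqP => [a1|_]; last exact: spt0.
    apply: sptN; apply: spt_sum => i _; apply: sptZ.
    have [->|ai] := posnP (a i); first exact: spt0.
    have x0P : spt (inj_word [set: Y]%SET (mabs a)) (x0 (decr i a)).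
      rewrite /x0; case: eqP => [e|_]; last exact: spt0.
      by apply: spt_gen; split; rewrite ?a1 // => y; rewrite finset.in_setT.
    rewrite /theta; case: eqP => _; first exact: spt0.
    case: (odd _); first by apply: sptB => //; exact: degT.
    by apply: spt_sum => j _; elim: (j : nat) => [//|m IH]; rewrite iterS; exact: degT.
  - move=> a _; have [a1|a1] := eqVneq (mabs a) 1%N.
      have -> : dtot p tauE g a = 0.
        rewrite -(dtot0 p TL a); apply: eq_dtot => i ai.
        by rewrite /g mdec // a1.
      rewrite /g a1 eqxx linearN /= (@dtot_morph _ p _ _ _ _ tauE); last 2 first.
      - by lin.
      - by move=> i z; exact: bd_map.
      rewrite /dtot big1 ?oppr0 // => i _; rewrite /= /x0.
      case: ifP => _; last by rewrite linear0 theta0 // scaler0.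
      rewrite -[gen [:: y0]]cons_gen bd_cons bd_nil linear0 subr0.
      by rewrite theta_nil scaler0.
    have ga0 : g a = 0 by rewrite /g (negbTE a1).
    rewrite ga0 linear0.
    have [a2|a2] := eqVneq (mabs a) 2%N; last first.
      rewrite -(dtot0 p TL a); apply: eq_dtot => i ai.
      rewrite /g mdec //.
      by case: (mabs a) a1 a2 => [|[|[|m]]].
    have -> : dtot p tauE g a = dtot p tauE (fun b => 0 - dtot p tauE x0 b) a.
      by apply: eq_dtot => i ai; rewrite /g mdec // a2 sub0r.
    by rewrite dtotB // dtot0 // dtot_dtot // subrr.
  by [].
exists (fun a => x0 a + (-1) ^+ mabs a *: h a); split.
- move=> a aY; apply: sptD; last by apply: sptZ; case: (hP a aY).
  rewrite /x0; case: eqP => [->|_]; last exact: spt0.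
  by apply: spt_gen; split=> // y; rewrite finset.in_setT.
- move=> a aY a0; rewrite linearD linearZ /= /x0 gtn_eqF // linear0 add0r.
  have [_ ->] := hP a aY.
  have -> : dtot p tauE (fun b => x0 b + (-1) ^+ mabs b *: h b) a =
     dtot p tauE x0 a - (-1) ^+ mabs a *: dtot p tauE h a.
    rewrite -scaleNr -[LHS]addr0 -[0](subrr (dtot p tauE x0 a)) addrCA; congr (_ + _).
    rewrite -dtotB // scaler_sumr; apply: eq_bigr => i _.
    have [->|ai] := posnP (a i); first by rewrite !theta_k0 !scaler0.
    rewrite addrC addKr mdec // thetaZ // !scalerA; congr (_ *: _).
    by rewrite mulrC -[in RHS](mabs_decr ai) mdec // exprS mulN1r opprK.
  rewrite scalerBr; congr (_ - _).
  have [a1|a1] := eqVneq (mabs a) 1%N.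
    by rewrite /g a1 eqxx expr1 scaleN1r opprK.
  have -> : g a = 0 by rewrite /g (negbTE a1).
  rewrite scaler0 -(dtot0 p TL a); apply: eq_dtot => i ai; rewrite /x0 mdec // ifN //.
  by move: a0 a1; case: (mabs a) => [|[|m]].
have z0 : mabs ([ffun=> 0%N] : idx) = 0%N by apply/eqP; rewrite mabs0.
have [|_] := hP [ffun=> 0%N]; first by rewrite z0 cardY expn_gt0 prime_gt0.
move=> hb; rewrite linearD linearZ /= {}hb /x0 /g z0 /= scale1r sub0r.
rewrite -[gen [:: y0]]cons_gen bd_cons bd_nil linear0 subr0 /dtot big1 ?oppr0 ?addr0 // => i _.
by rewrite ffunE theta_k0 scaler0.
Qed.

Theorem inj_full_word (phi : seq Y -> T) :
  phi [::] = gen [::] ->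
  (forall w, uniq w -> bd (phi w) = lift phi (bd (gen w))) ->
  (forall i w, uniq w -> phi (map (tau i) w) = map_ch (tau i) (phi w)) ->
  (forall w, uniq w -> spt (fun u => size u = size w) (phi w)) ->
  exists u w, [/\ uniq u, mcoeff w (phi u) != 0 & forall y, y \in w].
Proof.
move=> phi0 phi_bd phi_tau phi_size.
have [x [x_inj x_bd x0]] := inj_family.
have tau_inj i : injective (tau i).
  move=> y z e; have tp := tau_p sh_p crd_tau crd_inj i.
  by rewrite -(tp y) -(tp z) -(prednK (prime_gt0 p_prime)) !iterSr e.
(* Setting the map to zero off injective words makes its linear extension equivariant on all
   chains. *)
pose phi' w := if uniq w then phi w else 0.
have liftE z : spt (fun w => uniq w) z -> lift phi z = lift phi' z.
  move: z; apply: lin_extP => [||w uw]; [lin|lin|].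
  by rewrite !lift_gen /phi' uw.
have x_uniq a : (mabs a < #|Y|)%N -> spt (fun w => uniq w) (x a).
  by move=> /x_inj; apply: spt_sub => w [].
have bd_uniq (z : T) : spt (fun w => uniq w) z -> spt (fun w => uniq w) (bd z).
  apply: spt_bd => w1 y w2; apply: subseq_uniq.
  by rewrite cat_subseq ?subseq_refl // -cat1s suffix_subseq // suffix_suffix.
have phi'_tau i z : lift phi' (map_ch (tau i) z) = map_ch (tau i) (lift phi' z).
  move: z; apply: lin_ext => [||w]; [lin|lin|].
  rewrite map_gen !lift_gen /phi' map_inj_uniq //; case: ifP => [uw|_]; last by rewrite linear0.
  exact: phi_tau.
have phi'_bd z : spt (fun w => uniq w) z -> bd (lift phi' z) = lift phi' (bd z).
  move: z; apply: lin_extP => [||w uw]; [lin|lin|].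
  by rewrite lift_gen /phi' uw phi_bd // liftE //; apply: bd_uniq; exact: spt_gen.
have [y0 _] : exists y : Y, True.
  have /card_gt0P[y _] : (0 < #|Y|)%N by rewrite cardY expn_gt0 prime_gt0.
  by exists y.
have [|||a [w [aY wn wf]]] := full_word p_prime charFp cardC pt_inj sh_inj sh_p crd_tau crd_inj
    (kap := fun a => lift phi' (x a)) cardY (ex_intro _ y0 I).
- move=> a aY; apply: spt_lift (x_inj a aY) => u [uu _ su]; rewrite /phi' uu.
  by apply: spt_sub (phi_size u uu) => w; rewrite su; case: w.
- move=> a aY a0; rewrite phi'_bd; last exact: x_uniq.
  rewrite x_bd //.
  have lh : linear (lift phi') by lin.
  exact: (@dtot_morph _ p _ _ _ tauE tauE (lift phi') x a lh phi'_tau).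
- have z0 : (mabs ([ffun=> 0%N] : idx) < #|Y|)%N.
    rewrite /mabs big1 => [|i _]; last by rewrite ffunE.
    by rewrite cardY expn_gt0 prime_gt0.
  rewrite phi'_bd; last exact: x_uniq z0.
  by rewrite x0 lift_gen /phi' phi0.
have : spt (fun w => exists u, uniq u /\ mcoeff w (phi u) != 0) (lift phi' (x a)).
  by apply: spt_lift (x_inj a aY) => u [uu _ _] v vu; exists u; move: vu; rewrite /phi' uu.
by move=> /(_ w wn)[u [uu uw]]; exists u, w.
Qed.

End EquivariantChainMap.

(** * Barycentric subdivision *)

Section Subdivision.
Local Open Scope ring_scope.
Variables (F : fieldType) (R : realFieldType).

Section Bary.
Variable E : lmodType R.
Local Notation T := (malg (seq E) F).
Implicit Types (w : seq E) (z : T).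

Definition bary w : E := (size w)%:R^-1 *: \sum_(v <- w) v.

(** Closure under barycentres of words, the form of convexity that subdivision uses. *)
Definition bconvex (P : E -> Prop) : Prop :=
  forall w, w != [::] -> (forall v, v \in w -> P v) -> P (bary w).

(* Barycentric subdivision; [n] is the size of the word. *)
Fixpoint sdn (n : nat) w : T :=
  if n is m.+1 then cons_ch (bary w) (lift (sdn m) (bd (gen w))) else gen w.

Definition sd : T -> T := lift (fun w => sdn (size w) w).
HB.instance Definition _ := GRing.Linear.on sd.

Lemma sd_nil : sd (gen [::]) = gen [::].
Proof. exact: lift_gen. Qed.

Lemma spt_size_bd n z : spt (fun w => size w = n.+1) z -> spt (fun w => size w = n) (bd z).
Proof.
by apply: spt_bd => w1 y w2; rewrite !size_cat /= addnS => -[].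
Qed.

Lemma sd_gen w : w != [::] -> sd (gen w) = cons_ch (bary w) (sd (bd (gen w))).
Proof.
rewrite /sd lift_gen; case sw: (size w) => [|n]; first by case: w sw.
move=> _ /=; congr cons_ch.
have : spt (fun w => size w = n) (bd (gen w : T)).
  by apply: spt_size_bd; exact: spt_gen.
move: (bd _); apply: lin_extP => [||u su]; [lin|lin|].
by rewrite !lift_gen su.
Qed.

Lemma bd_sd z : bd (sd z) = sd (bd z).
Proof.
suff H n w : size w = n -> bd (sd (gen w)) = sd (bd (gen w)).
  by move: z; apply: lin_ext => [||w]; [lin|lin|exact: H].
elim: n w => [|n IH] w sw.
  by case: w sw => // _; rewrite sd_nil bd_nil linear0.
rewrite sd_gen; last by case: (w) sw.
rewrite bd_cons.
have -> : bd (sd (bd (gen w))) = sd (bd (bd (gen w))).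
  have : spt (fun w => size w = n) (bd (gen w : T)).
    by apply: spt_size_bd; exact: spt_gen.
  by move: (bd (gen w)); apply: lin_extP => [||u su]; [lin|lin|exact: IH].
by rewrite bd_bd (linear0 sd) linear0 subr0.
Qed.

(** The simplices of the subdivision are flags: barycentres of successive words, each obtained from
    the one before by deleting a letter. *)
Lemma sd_ind (Q : seq E -> seq E -> Prop) :
  Q [::] [::] ->
  (forall w w1 v w2 u, w = w1 ++ v :: w2 -> Q (w1 ++ w2) u -> Q w (bary w :: u)) ->
  forall w, spt (Q w) (sd (gen w)).
Proof.
move=> Q0 QS w; have [n sw] : exists n, size w = n by exists (size w).
elim: n w sw => [|n IH] w sw; first by case: w sw => // _; rewrite sd_nil; exact: spt_gen.
rewrite sd_gen; last by case: (w) sw.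
apply: (spt_cons (P := fun u => exists w1 v w2, w = w1 ++ v :: w2 /\ Q (w1 ++ w2) u)).
  by move=> u [w1 [v [w2 [we qu]]]]; exact: QS we qu.
apply: (spt_lift (P := fun x => exists w1 v w2, w = w1 ++ v :: w2 /\ x = w1 ++ w2)).
  move=> x [w1 [v [w2 [we xe]]]].
  have sx : size x = n by move: sw; rewrite we xe !size_cat /= addnS => -[].
  have := IH x sx; rewrite /sd lift_gen; apply: spt_sub => u Qu.
  by exists w1, v, w2; rewrite -xe.
apply: (spt_bd (P := fun x => x = w)); last exact: spt_gen.
by move=> w1 v w2 <-; exists w1, v, w2.
Qed.

Lemma spt_sd (P Q : seq E -> Prop) z :
  (forall w, P w -> spt Q (sd (gen w))) -> spt P z -> spt Q (sd z).
Proof.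
by move=> H; apply: spt_lift => w /H; rewrite /sd lift_gen.
Qed.

Lemma sd_size n z : spt (fun w => size w = n) z -> spt (fun w => size w = n) (sd z).
Proof.
apply: spt_sd => w <-; apply: (sd_ind (Q := fun w u => size u = size w)) => //.
by move=> ? w1 v w2 u -> /= ->; rewrite !size_cat /= addnS.
Qed.

Lemma sd_hull (P : E -> Prop) z : bconvex P ->
  spt (fun w => forall v, v \in w -> P v) z ->
  spt (fun w => forall v, v \in w -> P v) (sd z).
Proof.
move=> cP; apply: spt_sd => w Pw.
have : spt (fun u : seq E => (forall v, v \in w -> P v) -> forall v, v \in u -> P v)
    (sd (gen w)); last by apply: spt_sub => u Hu; exact: Hu.
apply: (sd_ind (Q := fun w u => (forall v, v \in w -> P v) ->
  forall v, v \in u -> P v)) => // {Pw}w w1 x w2 u we IH Pw v.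
rewrite inE => /predU1P[->|]; first by apply: cP => //; rewrite we; case: (w1).
apply: IH => y; rewrite mem_cat => yw; apply: Pw.
by rewrite we mem_cat inE orbCA yw orbT.
Qed.

Lemma bconvexI P Q : bconvex P -> bconvex Q -> bconvex (fun v => P v /\ Q v).
Proof.
by move=> cP cQ w w0 H; split; [apply: cP|apply: cQ] => // v /H[].
Qed.

Lemma bconvex_all (I : Type) (P : I -> E -> Prop) :
  (forall i, bconvex (P i)) -> bconvex (fun v => forall i, P i v).
Proof. by move=> cP w w0 H i; apply: cP => // v /H. Qed.

Lemma bary_lin (f : E -> R) w : linear (f : E -> R^o) ->
  f (bary w) = (size w)%:R^-1 * \sum_(v <- w) f v.
Proof.
move=> lf; pose h : {linear E -> R^o} := HB.pack (f : E -> R^o)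
  (GRing.isLinear.Build R E R^o *:%R f lf).
by rewrite -[f]/(h : E -> R) /bary linearZ (linear_sum h).
Qed.

Lemma bconvex_le (f : E -> R) c : linear (f : E -> R^o) -> bconvex (fun v => f v <= c).
Proof.
move=> lf w w0 H; rewrite bary_lin //.
have n0 : 0 < (size w)%:R :> R by rewrite ltr0n lt0n size_eq0.
rewrite mulrC ler_pdivrMr // big_seq (le_trans (ler_sum _ H)) // -big_seq.
by rewrite big_const_seq count_predT iter_addr_0 mulr_natr.
Qed.

Lemma bconvex_ge (f : E -> R) c : linear (f : E -> R^o) -> bconvex (fun v => c <= f v).
Proof.
move=> lf w w0 H; have lN : linear (fun v => - f v : R^o) by exact: linear_oppf lf.
rewrite -lerN2; apply: (bconvex_le (c := - c) lN) => // v /H.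
by rewrite lerN2.
Qed.

Lemma bconvex_eq (f : E -> R) c : linear (f : E -> R^o) -> bconvex (fun v => f v = c).
Proof.
move=> lf w w0 H; apply/eqP; rewrite eq_le; apply/andP; split.
  by apply: (bconvex_le (c := c) lf) => // v /H ->.
by apply: (bconvex_ge (c := c) lf) => // v /H ->.
Qed.

(** The size of a simplex is measured by one linear functional at a time, later a coordinate, in
    place of a norm. *)
Definition mesh (f : E -> R) (D : R) w := forall x y, x \in w -> y \in w -> f x - f y <= D.

Variable r : nat.
Hypothesis r0 : (0 < r)%N.
Let q : R := 1 - r%:R^-1.

Lemma q_ge0 : 0 <= q.
Proof. by rewrite subr_ge0 invf_le1 ?ltr0n // ler1n. Qed.

(** The difference is an average of [size w] differences, one of which is zero; this gives the
    factor (n - 1)/n <= 1 - 1/r for n = [size w]. *)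
Lemma mesh_bary (f : E -> R) D w x : linear (f : E -> R^o) -> (size w <= r)%N -> 0 <= D ->
  mesh f D w -> x \in w -> `|f (bary w) - f x| <= q * D.
Proof.
move=> lf swr D0 mw xw; rewrite bary_lin //.
have n0 : (0 < size w)%N by case: (w) xw.
have nR : 0 < (size w)%:R :> R by rewrite ltr0n.
have -> : (size w)%:R^-1 * \sum_(v <- w) f v - f x =
    (size w)%:R^-1 * \sum_(v <- rem x w) (f v - f x).
  have -> : \sum_(v <- rem x w) (f v - f x) = \sum_(v <- w) (f v - f x).
    by rewrite [RHS](perm_big _ (perm_to_rem xw)) big_cons /= subrr add0r.
  rewrite big_split /= big_const_seq count_predT iter_addr_0 mulrDr mulrnAr -mulrnAl.
  by rewrite -[_^-1 *+ _]mulr_natr mulVf ?gt_eqF // mul1r.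
rewrite normrM normfV normr_nat -ler_pdivlMl ?invr_gt0 // invrK.
apply: (@le_trans _ _ (((size w).-1)%:R * D)).
  rewrite -(size_rem xw) (le_trans (ler_norm_sum _ _ _)) // big_seq.
  apply: (@le_trans _ _ (\sum_(v <- rem x w | v \in rem x w) D)).
    apply: ler_sum => v /mem_rem vw; rewrite ler_norml lerNl opprB.
    by rewrite !mw.
  by rewrite -big_seq big_const_seq count_predT iter_addr_0 mulr_natl.
rewrite mulrA ler_wpM2r // /q mulrBr mulr1 -subn1 natrB // lerD2l lerN2.
by rewrite ler_pdivrMr ?ltr0n // mul1r ler_nat.
Qed.

(** The induction also carries the hull property: it bounds the distance from the barycentre of [w]
    to those of all its faces by the distance to the vertices of [w]. *)
Lemma mesh_word (f : E -> R) D w : linear (f : E -> R^o) -> (size w <= r)%N -> 0 <= D ->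
  mesh f D w -> spt (mesh f (q * D)) (sd (gen w)).
Proof.
move=> lf swr D0 mw.
have : spt (fun u : seq E => (size w <= r)%N -> mesh f D w ->
   (forall P, bconvex P -> (forall v, v \in w -> P v) -> forall v, v \in u -> P v) /\
   mesh f (q * D) u) (sd (gen w)); last by apply: spt_sub => u /(_ swr mw)[].
apply: (sd_ind (Q := fun w u => (size w <= r)%N -> mesh f D w ->
   (forall P, bconvex P -> (forall v, v \in w -> P v) -> forall v, v \in u -> P v) /\
   mesh f (q * D) u)) => // {swr mw}w w1 x w2 u we IH swr mw.
have sub y : y \in w1 ++ w2 -> y \in w.
  by rewrite we !mem_cat inE orbCA => ->; rewrite orbT.
have [||hull mu] := IH.
- by rewrite (leq_trans _ swr) // we !size_cat /= addnS.
- by move=> y z /sub yw /sub zw; exact: mw.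
have w0 : w != [::] by rewrite we; case: (w1).
split=> [P cP Pw v|].
  rewrite inE => /predU1P[->|]; first exact: cP.
  by apply: (hull P cP) => y /sub; exact: Pw.
have near v : v \in u -> `|f (bary w) - f v| <= q * D.
  apply: (hull (fun v => `|f (bary w) - f v| <= q * D)) => [|y /sub yw]; last exact: mesh_bary.
  have cle := bconvex_ge (c := f (bary w) - q * D) lf.
  have cge := bconvex_le (c := f (bary w) + q * D) lf.
  move=> s s0 H; have [|] := (bconvexI cle cge) s s0 _.
    by move=> y /H; rewrite ler_norml => /andP[]; lra.
  by rewrite ler_norml; lra.
move=> y z; rewrite !inE => /predU1P[->|yu] /predU1P[->|zu].
- by rewrite subrr mulr_ge0 // q_ge0.
- by rewrite (le_trans (ler_norm _)) // near.
- by rewrite (le_trans (ler_norm _)) // distrC near.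
- exact: mu.
Qed.

Lemma sd_mesh (f : E -> R) D z : linear (f : E -> R^o) -> 0 <= D ->
  spt (fun w => (size w <= r)%N /\ mesh f D w) z ->
  spt (fun w => mesh f (q * D) w) (sd z).
Proof. by move=> lf D0; apply: spt_sd => w [sw mw]; exact: mesh_word. Qed.

Lemma iter_sd_lin N : linear (iter N sd).
Proof. by elim: N => [//|N IH] a x y; rewrite !iterS IH linearP. Qed.

Lemma bd_iter_sd N z : bd (iter N sd z) = iter N sd (bd z).
Proof. by elim: N => [//|N IH]; rewrite !iterS bd_sd IH. Qed.

Lemma iter_sd_size N n z :
  spt (fun w => size w = n) z -> spt (fun w => size w = n) (iter N sd z).
Proof. by move=> H; elim: N => [//|N IH]; rewrite iterS; exact: sd_size. Qed.

Lemma iter_sd_hull N (P : E -> Prop) z : bconvex P ->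
  spt (fun w => forall v, v \in w -> P v) z ->
  spt (fun w => forall v, v \in w -> P v) (iter N sd z).
Proof. by move=> cP H; elim: N => [//|N IH]; rewrite iterS; exact: sd_hull. Qed.

Lemma iter_sd_mesh N (f : E -> R) n z : linear (f : E -> R^o) -> (n <= r)%N ->
  spt (fun w => size w = n) z -> spt (mesh f 1) z ->
  spt (mesh f (q ^+ N)) (iter N sd z).
Proof.
move=> lf nr sz mz; elim: N => [//|N IH]; rewrite iterS exprS.
apply: sd_mesh => //; first exact/exprn_ge0/q_ge0.
apply: sptI IH; apply: spt_sub (iter_sd_size sz).
by move=> w ->.
Qed.

End Bary.

Lemma sd_map (E E' : lmodType R) (f : E -> E') z :
  (forall w, f (bary w) = bary (map f w)) -> sd (map_ch f z) = map_ch f (sd z).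
Proof.
move=> fb; move: z; apply: lin_ext => [||w]; [lin|lin|].
have [n sw] : exists n, size w = n by exists (size w).
elim: n w sw => [|n IH] w sw.
  by case: w sw => // _; rewrite !(map_gen, sd_nil).
have w0 : w != [::] by case: (w) sw.
rewrite map_gen !sd_gen //; last by case: (w) w0.
rewrite map_cons fb -map_gen bd_map; congr cons_ch.
have : spt (fun w => size w = n) (bd (gen w : malg (seq E) F)).
  by apply: spt_size_bd; exact: spt_gen.
by move: (bd _); apply: lin_extP => [||u /IH //]; lin.
Qed.

End Subdivision.

Section SubdivisionMore.
Local Open Scope ring_scope.
Variables (F : fieldType) (R : realFieldType).

Lemma bary_map (E E' : lmodType R) (f : E -> E') w : linear f ->
  f (bary w) = bary (map f w).
Proof.
move=> lf; pose h : {linear E -> E'} := HB.pack f (GRing.isLinear.Build R E E' *:%R f lf).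
by rewrite -[f]/(h : E -> E') /bary linearZ (linear_sum h) size_map big_map.
Qed.

Lemma iter_sd_map (E E' : lmodType R) (f : E -> E') N (z : malg (seq E) F) : linear f ->
  iter N (@sd F R E') (map_ch f z) = map_ch f (iter N (@sd F R E) z).
Proof.
move=> lf; elim: N => [//|N IH]; rewrite !iterS IH sd_map // => w.
exact: bary_map.
Qed.

Lemma spt_linear (K K' : choiceType) (P : K -> Prop) (Q : K' -> Prop)
    (f : malg K F -> malg K' F) z : linear f ->
  (forall k, P k -> spt Q (f (gen k))) -> spt P z -> spt Q (f z).
Proof.
move=> lf H Pz; have -> : f z = lift (fun k => f (gen k)) z.
  by move: (z); apply: lin_ext => [||k]; [lin|lin|rewrite lift_gen].
exact: spt_lift Pz.
Qed.

End SubdivisionMore.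

(** * The labelling chain map *)

Section Labelling.
Local Open Scope ring_scope.
Variables (F : fieldType) (R : realFieldType) (aT : finGroupType) (Pi : finType).
Variables (to : {action aT &-> Pi}) (b0 : Pi) (k : Pi -> aT).
Hypothesis k_act : forall a h, k (to a h) = (k a * h)%g.
Local Notation E1 := {ffun Pi -> R^o}.
Local Notation E2 := (E1 * E1)%type.
Variables (m : nat) (lam : seq Pi -> E1 -> 'I_m -> Pi).
Hypothesis m_gt0 : (0 < m)%N.

Definition actf h (t : E1) : E1 := [ffun i => t (to i h^-1%g)].

Hypothesis lam_equiv : forall w t j h, w != [::] ->
  lam (map (to^~ h) w) (actf h t) j = to (lam w t j) h.

Definition actf_pair h (e : E2) : E2 := (actf h e.1, actf h e.2).
Definition dlt (i : Pi) : E1 := [ffun x => (x == i)%:R].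
(** Tiles of length zero are dropped, so a point of a common face gives the same configuration for
    every word that has this face. *)
Definition pos (w : seq Pi) (t : E1) := [seq i <- w | 0 < t i].
(* The average over the columns of the unit vectors of the labels. *)
Definition yv w (t : E1) : E1 :=
  [ffun i => #|[set j | lam (pos w t) t j == i]%SET|%:R / m%:R].
(** The point is kept beside its average so that the second subdivision still knows the face, which
    [lab] uses to break ties equivariantly. *)
Definition att w (t : E1) : E2 := (t, yv w t).
(* A largest coordinate; moving the first plate to the base plate before the
   choice makes the tie-breaking equivariant. *)
Definition lab w (e : E2) : Pi :=
  let a := head b0 (pos w e.1) in
  to [arg max_(i > b0) (actf (k a)^-1%g e.2 i)]%O (k a).

Definition in_splx (w : seq Pi) (t : E1) : Prop :=
  (forall i, 0 <= t i) /\ (\sum_i t i = 1 /\ forall i, i \notin w -> t i = 0).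

Variables N M : nat.
Local Notation sdN := (iter N (@sd F R E1)).
Local Notation sdM := (iter M (@sd F R E2)).

Definition phi w : malg (seq Pi) F :=
  map_ch (lab w) (sdM (map_ch (att w) (sdN (map_ch dlt (gen w))))).

Lemma actf_lin h : linear (actf h).
Proof. by move=> a x y; apply/ffunP => i; rewrite !ffunE. Qed.

Lemma actf_pair_lin h : linear (actf_pair h).
Proof. by move=> a x y; rewrite /actf_pair /= !actf_lin. Qed.

Lemma actfM g h t : actf h (actf g t) = actf (g * h)%g t.
Proof. by apply/ffunP => i; rewrite !ffunE invMg actM. Qed.

Lemma actf_act h t i : actf h t (to i h) = t i.
Proof. by rewrite ffunE actK. Qed.

Lemma coord_lin (i : Pi) : linear (fun t : E1 => t i : R^o).
Proof. by move=> a x y; rewrite !ffunE. Qed.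

Lemma sum_coord_lin (P : pred Pi) : linear (fun t : E1 => \sum_(i | P i) t i : R^o).
Proof. by apply: linear_sumf => i; exact: coord_lin. Qed.

Lemma in_splx_bconvex w : bconvex (in_splx w).
Proof.
apply: bconvexI; first by apply: bconvex_all => i; apply: bconvex_ge; exact: coord_lin.
apply: bconvexI; first by apply: bconvex_eq; exact: sum_coord_lin.
apply: bconvex_all => i; case: (boolP (i \in w)) => iw.
  by move=> s _ _.
move=> s s0 H _; apply: (bconvex_eq (c := 0) (coord_lin i)) => // v /H; exact.
Qed.

Lemma sum_dlt i : \sum_x dlt i x = 1.
Proof.
rewrite (bigD1 i) //= big1 ?addr0 ?ffunE ?eqxx // => x xi.
by rewrite ffunE (negbTE xi).
Qed.

Lemma dlt_splx w i : i \in w -> in_splx w (dlt i).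
Proof.
move=> iw; split=> [x|]; first by rewrite ffunE ler0n.
split=> [|x xw]; first exact: sum_dlt.
by rewrite ffunE; case: eqP => // xi; rewrite xi iw in xw.
Qed.

Lemma sdN_splx w :
  spt (fun s : seq E1 => forall t, t \in s -> in_splx w t) (sdN (map_ch dlt (gen w))).
Proof.
apply: iter_sd_hull; first exact: in_splx_bconvex.
rewrite map_gen; apply: spt_gen => t /mapP[i iw ->]; exact: dlt_splx.
Qed.

Lemma pos_sub w w' t : uniq w -> subseq w' w -> in_splx w' t -> pos w t = pos w' t.
Proof.
move=> uw /(subseq_uniqP uw) -> [_ [_ t0]]; rewrite /pos -filter_predI.
apply: eq_in_filter => i iw /=; case: (boolP (i \in w')) => iw'; rewrite ?andbT //.
have -> : t i = 0 by apply: t0; rewrite mem_filter (negbTE iw').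
by rewrite ltxx.
Qed.

Lemma pos_neq0 w t : in_splx w t -> pos w t != [::].
Proof.
move=> [t0 [t1 tw]]; apply/eqP => e.
suff : \sum_i t i = 0 by rewrite t1 => /eqP; rewrite oner_eq0.
apply: big1 => i _; have [iw|/tw //] := boolP (i \in w).
have : i \notin pos w t by rewrite e.
rewrite mem_filter iw andbT -leNgt => ti; apply/eqP; by rewrite eq_le ti t0.
Qed.

Lemma sdM_splx w w' :
  spt (fun u : seq E2 => forall e, e \in u -> in_splx w' e.1)
    (sdM (map_ch (att w) (sdN (map_ch dlt (gen w'))))).
Proof.
apply: iter_sd_hull.
  move=> s s0 H; have -> : (bary s).1 = bary (map fst s) by apply: bary_map.
  apply: in_splx_bconvex; first by case: (s) s0.
  by move=> v /mapP[e es ->]; exact: H.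
apply: (spt_map _ (@sdN_splx w')) => s H e /mapP[t ts ->]; exact: H.
Qed.

(** Average and label depend on the word only through [pos], which agrees for [w] and a subword
    whose simplex contains the point. This compatibility with faces makes [phi] a chain map. *)
Lemma phi_sub w w' : uniq w -> subseq w' w ->
  map_ch (lab w) (sdM (map_ch (att w) (sdN (map_ch dlt (gen w'))))) = phi w'.
Proof.
move=> uw sw; rewrite /phi.
rewrite (eq_map_ch (g' := lab w') _ (@sdM_splx w w')) => [|u H e /H eP]; last first.
  by rewrite /lab (pos_sub uw sw).
congr (map_ch _ (sdM _)); apply: eq_map_ch (@sdN_splx w') => s H t /H tP.
by rewrite /att /yv (pos_sub uw sw).
Qed.

Lemma phi_bd w : uniq w -> bd (phi w) = lift phi (bd (gen w)).
Proof.
move=> uw; rewrite bd_map bd_iter_sd bd_map bd_iter_sd bd_map.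
have : spt (fun w' => subseq w' w) (bd (gen w : malg (seq Pi) F)).
  apply: (spt_bd (P := fun u => u = w)); last exact: spt_gen.
  by move=> w1 y w2 <-; rewrite cat_subseq ?subseq_refl // -cat1s suffix_subseq // suffix_suffix.
move: (bd (gen w)); apply: lin_extP => [||w' sw]; last by rewrite lift_gen phi_sub.
- move=> a x y; rewrite !(iter_sd_lin, linearP) //=.
- lin.
Qed.

Lemma phi_nil : phi [::] = gen [::].
Proof.
have H (E : lmodType R) n : iter n (@sd F R E) (gen [::]) = gen [::].
  by elim: n => [//|n IH]; rewrite iterS IH sd_nil.
by rewrite /phi !(map_gen, H).
Qed.

Lemma phi_size w : spt (fun u => size u = size w) (phi w).
Proof.
apply: (spt_map (P := fun u : seq E2 => size u = size w)); first by move=> u; rewrite size_map.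
apply: iter_sd_size; apply: (spt_map (P := fun u : seq E1 => size u = size w)).
  by move=> u; rewrite size_map.
by apply: iter_sd_size; rewrite map_gen; apply: spt_gen; rewrite size_map.
Qed.

Lemma pos_act h w t : pos (map (to^~ h) w) (actf h t) = map (to^~ h) (pos w t).
Proof.
by rewrite /pos filter_map; congr map; apply: eq_filter => i /=; rewrite actf_act.
Qed.

Lemma att_act h w t : in_splx w t -> att (map (to^~ h) w) (actf h t) = actf_pair h (att w t).
Proof.
move=> tw; rewrite /att /actf_pair /=; congr pair; apply/ffunP => i; rewrite !ffunE.
congr (_%:R / _); apply: eq_card => j; rewrite !finset.in_set pos_act.
by rewrite lam_equiv ?pos_neq0 // -(inj_eq (act_inj to h^-1%g)) actK.
Qed.

Lemma lab_act h w e : in_splx w e.1 -> lab (map (to^~ h) w) (actf_pair h e) = to (lab w e) h.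
Proof.
move=> ew; rewrite /lab /= pos_act.
have -> : head b0 (map (to^~ h) (pos w e.1)) = to (head b0 (pos w e.1)) h.
  by case: (pos w e.1) (pos_neq0 ew).
by rewrite k_act actfM invMg mulKVg actM.
Qed.

Lemma phi_act h w : phi (map (to^~ h) w) = map_ch (to^~ h) (phi w).
Proof.
rewrite /phi.
have -> : map_ch dlt (gen (map (to^~ h) w)) =
    map_ch (actf h) (map_ch dlt (gen w)) :> malg (seq E1) F.
  rewrite !map_gen -!map_comp; congr gen; apply: eq_map => i; apply/ffunP => x.
  by rewrite !ffunE /= -(inj_eq (act_inj to h^-1%g)) actK.
rewrite (iter_sd_map _ _ (@actf_lin h)).
rewrite (map_comp_ch (att _) (actf h)).
have -> : map_ch (att (map (to^~ h) w) \o actf h) (sdN (map_ch dlt (gen w))) =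
    map_ch (actf_pair h) (map_ch (att w) (sdN (map_ch dlt (gen w)))).
  rewrite (map_comp_ch (actf_pair h) (att w)); apply: eq_map_ch (@sdN_splx w).
  by move=> s H t /H /=; exact: att_act.
rewrite (iter_sd_map _ _ (@actf_pair_lin h)).
rewrite (map_comp_ch (lab _) (actf_pair h)) (map_comp_ch (to^~ h) (lab w)).
apply: eq_map_ch (@sdM_splx w w) => u H e /H /=; exact: lab_act.
Qed.

Let r := #|Pi|.
Let q : R := 1 - r%:R^-1.

Lemma r_gt0 : (0 < r)%N. Proof. by apply/card_gt0P; exists b0. Qed.

Lemma in_splx_le1 w t i : in_splx w t -> t i <= 1.
Proof.
by move=> [t0 [<- _]]; rewrite (bigD1 i) //= lerDl sumr_ge0.
Qed.

Lemma sum_yv w t (I : {set Pi}) : \sum_(i in I) yv w t i =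
  #|[set j | lam (pos w t) t j \in I]%SET|%:R / m%:R.
Proof.
under eq_bigr do rewrite ffunE; rewrite -mulr_suml -natr_sum; congr (_%:R / _).
rewrite -sum1_card (partition_big (fun j => lam (pos w t) t j) (mem I)) /=; last first.
  by move=> j; rewrite finset.in_set.
apply: eq_bigr => i iI; rewrite -sum1_card; apply: eq_bigl => j; rewrite !finset.in_set.
by case: eqP => [->|]; rewrite ?iI ?andbF.
Qed.

Lemma yv_splx w t : in_splx (enum Pi) (yv w t).
Proof.
split=> [i|]; first by rewrite ffunE divr_ge0 ?ler0n.
split=> [|i]; last by rewrite mem_enum.
have := sum_yv w t [set: Pi]%SET.
under eq_bigl do rewrite finset.in_setT.
move=> ->; under eq_finset do rewrite finset.in_setT.
by rewrite cardsT card_ord divff // pnatr_eq0 -lt0n.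
Qed.

Lemma lab_max w (e : E2) i : e.2 i <= e.2 (lab w e).
Proof.
rewrite /lab; set a := head _ _; case: arg_maxP => // l _ H.
have := H (to i (k a)^-1%g) isT; rewrite !ffunE invgK.
by rewrite actKV.
Qed.

(** A vertex labelled i has its largest coordinate at i, hence at least 1/r there. As all labels
    occur and coordinates vary by at most q^M, a single vertex has every coordinate at least 1/r -
    q^M. Summing over [I] gives |I| (1/r - q^M) <= c/(r + 1), where c counts the columns using a
    label in [I]; the bound 1/(r(r + 1)) on q^M is what yields c > |I|. *)
Lemma phi_rainbow_hall w v : uniq w -> mcoeff v (phi w) != 0 -> (forall i, i \in v) ->
  q ^+ M < (r * r.+1)%:R^-1 -> m = r.+1 ->
  exists s : seq E1, [/\ forall t, t \in s -> in_splx w t,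
    forall i, mesh (fun t : E1 => t i) (q ^+ N) s &
    forall I : {set Pi}, I != finset.set0 ->
      (#|I| < #|[set j | has (fun t => lam (pos w t) t j \in I) s]%SET|)%N].
Proof.
move=> uw vphi vall qM mE.
have swr : (size w <= r)%N by rewrite -(card_uniqP uw) max_card.
(* [s] is a simplex of the first subdivision and [u] one of the second inside it; the quantifier
   over [bconvex] conditions says that [u] lies in the hull of the points [att w t]. *)
have : spt (fun v => exists s u, [/\ forall t, t \in s -> in_splx w t,
    forall i, mesh (fun t : E1 => t i) (q ^+ N) s,
    forall P, bconvex P -> (forall t, t \in s -> P (att w t)) -> forall e, e \in u -> P e,
    forall i, mesh (fun e : E2 => e.2 i) (q ^+ M) u & v = map (lab w) u]) (phi w).
  apply: (spt_map (P := fun u : seq E2 => exists s : seq E1,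
    [/\ forall t, t \in s -> in_splx w t,
    forall i, mesh (fun t : E1 => t i) (q ^+ N) s,
    forall P, bconvex P -> (forall t, t \in s -> P (att w t)) -> forall e, e \in u -> P e &
    forall i, mesh (fun e : E2 => e.2 i) (q ^+ M) u])).
    by move=> u [s [s1 s2 s3 s4]]; exists s, u.
  apply: (spt_linear (f := fun z => sdM (map_ch (att w) z))
    (P := fun s : seq E1 => [/\ forall t, t \in s -> in_splx w t,
    forall i, mesh (fun t : E1 => t i) (q ^+ N) s & size s = size w])).
  - by move=> a x y; rewrite linearP iter_sd_lin.
  - move=> s [s1 s2 s3]; rewrite map_gen => u uP; exists s; split=> //.
      move=> P cP Ps; move: u uP; apply: iter_sd_hull cP _.
      by apply: spt_gen => e /mapP[t ts ->]; exact: Ps.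
    move=> i; move: u uP; apply: (@iter_sd_mesh F R E2 r r_gt0 M _ (size w) _ _ swr).
    + by move=> a x y; rewrite !ffunE.
    + by apply: spt_gen; rewrite size_map.
    + apply: spt_gen => _ _ /mapP[t _ ->] /mapP[t' _ ->] /=.
      have := in_splx_le1 i (yv_splx w t); have [/(_ i)] := yv_splx w t'.
      by lra.
  apply: spt_sub (sptI (@sdN_splx w) (sptI _ _)).
  - by move=> s [s1 [s2 s3]]; split; [exact: s1|exact: s2|exact: s3].
  - move=> s sP i; move: s sP; apply: (@iter_sd_mesh F R E1 r r_gt0 N _ (size w) _ (coord_lin i) swr).
    + by rewrite map_gen; apply: spt_gen; rewrite size_map.
    + rewrite map_gen; apply: spt_gen => _ _ /mapP[t _ ->] /mapP[t' _ ->] /=.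
      rewrite !ffunE lerBlDr (@le_trans _ _ 1) ?lerDl ?ler0n //.
      by rewrite -[1]/(1%:R) ler_nat leq_b1.
  - by apply: iter_sd_size; rewrite map_gen; apply: spt_gen; rewrite size_map.
move=> /(_ v vphi) [s [u [s1 s2 hull mu ve]]]; exists s; split=> // I I0.
have [x xu] : exists x, x \in u.
  by have := vall b0; rewrite ve => /mapP[e eu _]; exists e.
have rR : 0 < r%:R :> R by rewrite ltr0n r_gt0.
have mR : 0 < m%:R :> R by rewrite ltr0n.
have xge i : r%:R^-1 - q ^+ M <= x.2 i.
  have := vall i; rewrite ve => /mapP[e eu ie].
  have e1 : \sum_l e.2 l = 1.
    apply: (hull (fun e : E2 => \sum_l e.2 l = 1)) eu.
      apply: (bconvex_eq (f := fun e : E2 => \sum_l e.2 l)).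
      by apply: linear_sumf => l a y z; rewrite !ffunE.
    by move=> t _; have [_ []] := yv_splx w t.
  have ei : r%:R^-1 <= e.2 i.
    rewrite -[_^-1]mul1r ler_pdivrMr // -[leLHS]e1 mulr_natr.
    rewrite -sumr_const; apply: ler_sum => l _; rewrite ie; exact: lab_max.
  have := mu i e x eu xu; lra.
have : \sum_(i in I) x.2 i <= #|[set j | has (fun t => lam (pos w t) t j \in I) s]%SET|%:R / m%:R.
  apply: (hull (fun e : E2 => \sum_(i in I) e.2 i <= _)) xu.
    apply: (bconvex_le (f := fun e : E2 => \sum_(l in I) e.2 l)).
    by apply: linear_sumf => l a y z; rewrite !ffunE.
  move=> t ts; rewrite sum_yv ler_pM2r ?invr_gt0 // ler_nat.
  apply: subset_leq_card; apply/fintype.subsetP => j; rewrite !finset.in_set => jI.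
  by apply/hasP; exists t.
set c := #|_|; move=> xle; rewrite -(ltr_nat R).
have I1 : 0 < #|I|%:R :> R by rewrite ltr0n card_gt0.
have : #|I|%:R * (r%:R^-1 - q ^+ M) <= c%:R / m%:R.
  apply: le_trans xle; rewrite mulr_natl -sumr_const; apply: ler_sum => l _; exact: xge.
rewrite ler_pdivlMr // => /(lt_le_trans _); apply.
rewrite -mulrA -[ltLHS]mulr1 ltr_pM2l // mE.
apply: (@le_lt_trans _ _ ((r%:R^-1 - (r * r.+1)%:R^-1) * r.+1%:R)); last first.
  by rewrite ltr_pM2r ?ltr0n // ltrD2l ltrN2.
rewrite natrM -natr1; have : r%:R + 1 != 0 :> R by rewrite gt_eqF // addr_gt0.
by move=> r1; rewrite le_eqVlt; apply/orP; left; apply/eqP; field; rewrite r1 gt_eqF.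
Qed.

End Labelling.

(** * Trees from the strengthened Hall condition *)

Section HallTree.
Variables (Pi V : finType).
Implicit Types (N : Pi -> {set V}) (I J : {set Pi}) (i : Pi) (x y z : V).

Definition nbr N I : {set V} := (\bigcup_(i in I) N i)%SET.

Definition expanding N := forall I, I != finset.set0 -> #|I| < #|nbr N I|.

Lemma nbrU N I J : nbr N (I :|: J)%SET = (nbr N I :|: nbr N J)%SET.
Proof. exact: finset.bigcup_setU. Qed.

Lemma nbr1 N i : nbr N (finset.set1 i) = N i.
Proof. exact: big_set1. Qed.

Lemma mem_nbr N I x : reflect (exists2 i, i \in I & x \in N i) (x \in nbr N I).
Proof. exact: finset.bigcupP. Qed.

Definition shrink N i x : Pi -> {set V} := fun l => if l == i then (N i :\ x)%SET else N l.

Lemma nbr_shrink_notin N i x I : i \notin I -> nbr (shrink N i x) I = nbr N I.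
Proof.
move=> iI; apply: eq_bigr => l lI; rewrite /shrink ifN //.
by apply: contraNneq iI => <-.
Qed.

(** A set violating the condition after the removal must contain [i]; the witness is that set
    without [i]. It is nonempty because [N i] keeps at least two elements. *)
Lemma shrink_fail N i x : expanding N -> 3 <= #|N i| -> ~ expanding (shrink N i x) ->
  exists I, [/\ i \notin I, I != finset.set0 & #|nbr N I :|: (N i :\ x)|%SET <= #|I|.+1].
Proof.
move=> eN N3 /existsNP[J /not_implyP[J0 /negP]]; rewrite -leqNgt => Jle.
have iJ : i \in J.
  apply: contraLR Jle => iJ; rewrite -ltnNge nbr_shrink_notin //; exact: eN.
have JE : J = (finset.set1 i :|: (J :\ i))%SET by rewrite finset.setD1K.
move: Jle; rewrite {1}JE nbrU nbr1 nbr_shrink_notin ?finset.setD11 //.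
rewrite {1}/shrink eqxx finset.setUC (cardsD1 i) iJ add1n => Jle.
exists (J :\ i)%SET; split=> //; first by rewrite finset.setD11.
apply/eqP => J'0; move: Jle; rewrite J'0 cards0 /nbr big_set0 finset.set0U.
by move: N3; rewrite (cardsD1 x (N i)); lia.
Qed.

(* If no element of N i can be removed, two of them are blocked by tight sets I
   and J; submodularity of the neighbourhood contradicts this. *)
Lemma shrinkable N i : expanding N -> 3 <= #|N i| ->
  exists2 x, x \in N i & expanding (shrink N i x).
Proof.
move=> eN N3; apply: contrapT => H.
have bad x : x \in N i -> ~ expanding (shrink N i x) by move=> xi ex; apply: H; exists x.
have /card_gt0P[x xi] : 0 < #|N i| by lia.
have /card_gt0P[y] : 0 < #|(N i :\ x)%SET| by move: N3; rewrite (cardsD1 x) xi; lia.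
rewrite finset.in_setD1 => /andP[yx yi].
have [I [iI I0 Ile]] := shrink_fail eN N3 (bad x xi).
have [J [iJ J0 Jle]] := shrink_fail eN N3 (bad y yi).
(* As x and y differ, A :|: B contains all neighbours of [i], I and J, at least |I :|: J| + 2 of
   them. A :&: B contains the neighbours of I :&: J, or [N i] without x and y if this intersection
   is empty, so at least |I :&: J| + 1. The sum contradicts |A| + |B| <= |I| + |J| + 2. *)
set A := (_ :|: _)%SET in Ile; set B := (_ :|: _)%SET in Jle.
have AB : #|A :|: B|%SET >= (#|I :|: J|%SET).+2.
  have -> : (#|I :|: J|%SET).+1 = #|i |: (I :|: J)|%SET.
    by rewrite cardsU1 finset.in_setU (negbTE iI) (negbTE iJ).
  apply: leq_trans (eN _ _) _; first by apply/finset.set0Pn; exists i; rewrite finset.setU11.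
  apply: subset_leq_card; apply/fintype.subsetP => z /mem_nbr[l].
  rewrite !finset.inE => /or3P[/eqP ->|lI|lJ] zl.
  - by have [->|zx] := eqVneq z x; rewrite ?zl ?orbT //= eq_sym yx xi !orbT.
  - by have -> : z \in nbr N I by apply/mem_nbr; exists l.
  - by have -> : z \in nbr N J by [apply/mem_nbr; exists l]; rewrite !orbT.
have : #|A :&: B|%SET >= (#|I :&: J|%SET).+1.
  have [IJ0|IJ0] := eqVneq (I :&: J)%SET finset.set0.
    rewrite IJ0 cards0; apply: (@leq_trans #|(N i :\ x) :\ y|%SET).
      by move: N3; rewrite (cardsD1 x) xi (cardsD1 y (_ :\ x)%SET) !finset.inE yx yi; lia.
    apply: subset_leq_card; apply/fintype.subsetP => z; rewrite !finset.inE.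
    by case/and3P=> -> -> ->; rewrite !orbT.
  apply: leq_trans (eN _ IJ0) _; apply: subset_leq_card.
  apply/fintype.subsetP => z /mem_nbr[l]; rewrite !finset.inE => /andP[lI lJ] zl.
  have -> : z \in nbr N I by apply/mem_nbr; exists l.
  by have -> : z \in nbr N J by apply/mem_nbr; exists l.
have := cardsUI A B; have := cardsUI I J; lia.
Qed.

(** Sets with three or more elements are shrunk one element at a time; the condition on singletons
    keeps every size at least 2. *)
Lemma reduce_to_edges N : expanding N ->
  exists u v : Pi -> V, [/\ forall i, u i \in N i, forall i, v i \in N i,
    forall i, u i != v i & expanding (fun i => [set u i; v i]%SET)].
Proof.
have [n nN] := ubnP (\sum_i #|N i|); elim: n N nN => [//|n IH] N nN eN.
have N2 i : 2 <= #|N i|.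
  by have := eN (finset.set1 i); rewrite nbr1 cards1; apply; apply/finset.set0Pn; exists i; rewrite finset.in_set1.
have [/existsP[i N3]|/existsPn N3] := boolP [exists i, 3 <= #|N i|].
  have [x xi es] := shrinkable eN N3.
  have sub l : {subset shrink N i x l <= N l}.
    move=> z; rewrite /shrink; case: eqP => [->|//].
    by rewrite finset.in_setD1 => /andP[].
  have [|u [v [uN vN uv euv]]] := IH (shrink N i x) _ es.
    rewrite -ltnS; apply: leq_trans nN; rewrite ltnS [X in X < _](bigD1 i) // [X in _ < X](bigD1 i) //=.
    rewrite -addSn leq_add //; first by rewrite /shrink eqxx [X in _ < X](cardsD1 x) xi.
    by apply: leq_sum => l li; rewrite /shrink (negbTE li).
  by exists u, v; split=> // l; apply: sub.
have Nuv i : exists uv : V * V, uv.1 != uv.2 /\ N i = [set uv.1; uv.2]%SET.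
  have /cards2P[a [b [ab ->]]] : #|N i| == 2 by rewrite eqn_leq N2 andbT leqNgt N3.
  by exists (a, b).
have [f fP] := choice Nuv.
exists (fst \o f), (snd \o f); split=> [i|i|i|I I0].
- by have [_ ->] := fP i; rewrite finset.in_set2 eqxx.
- by have [_ ->] := fP i; rewrite finset.in_set2 eqxx orbT.
- by have [] := fP i.
rewrite (_ : (fun i => _) = N); first exact: eN.
by apply/funext => i; have [_ ->] := fP i.
Qed.

Variables u v : Pi -> V.
Hypothesis uv : forall i, u i != v i.
Hypothesis euv : expanding (fun i => [set u i; v i]%SET).
Hypothesis cardV : #|V| = #|Pi|.+1.
Let E : {set {set V}} := [set [set u i; v i]%SET | i : Pi]%SET.

(** The edges of a cycle of length at least 3 are distinct, so they come from as many plates as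
    there are vertices on the cycle, against expansion. *)
Lemma edge_cycle s : ucycle (edge_rel E) s -> size s < 3.
Proof.
move=> /andP[cs us]; rewrite ltnNge; apply/negP => s3.
have edge x : exists i, x \in s -> [set x; next s x]%SET = [set u i; v i]%SET.
  have [xs|xs] := boolP (x \in s).
    by have /andP[_ /finset.imsetP[i _ ->]] := next_cycle cs xs; exists i.
  have /card_gt0P[i _] : 0 < #|Pi|.
    rewrite -ltnS -cardV (leq_trans _ (max_card (mem s))) // (card_uniqP us).
    exact: leq_trans s3.
  by exists i.
have [f fP] := choice edge.
have f_inj : {in s &, injective f}.
  move=> x y xs ys fxy; apply/eqP; apply: contraT => xy.
  have := fP x xs; rewrite fxy -(fP y ys) => /finset.setP e.
  have yx : y = next s x.
    by have := e y; rewrite !finset.inE eqxx /= eq_sym (negbTE xy) /= => /eqP.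
  have xy' : x = next s y.
    by have := e x; rewrite !finset.inE eqxx /= (negbTE xy) /= => /esym/eqP.
  have [k s' rs] := rot_to xs.
  have us' : uniq (x :: s') by rewrite -rs rot_uniq.
  have ss' : 3 <= size (x :: s') by rewrite -rs size_rot.
  move: xy'; rewrite yx -!(next_rot k us) rs.
  case: s' us' ss' {rs} => [|a [|b s']] //= us' _.
  rewrite !eqxx /=; case: eqP us' => [->|_ us' xb]; first by rewrite mem_head.
  by move: us'; rewrite -xb !inE eqxx !orbT.
have := euv (I := [set f x | x in s]%SET).
rewrite card_in_imset // (card_uniqP us) ltnNge.
have -> : #|nbr (fun i => [set u i; v i]%SET) [set f x | x in s]%SET| <= size s.
  rewrite -(card_uniqP us); apply: subset_leq_card; apply/fintype.subsetP => z.
  move=> /mem_nbr[_ /finset.imsetP[x xs ->]]; rewrite -fP // finset.in_set2.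
  by case/orP=> /eqP -> //; rewrite mem_next.
case: s s3 {cs us edge fP f_inj} => [//|x s] _ H.
have : ~~ true by apply: H; apply/finset.set0Pn; exists (f x); apply/imset_f; rewrite mem_head.
by [].
Qed.

(** Otherwise the plates split between a component and its complement, each with more vertices than
    plates, which requires at least |Pi| + 2 vertices. *)
Lemma edge_connect x y : connect (edge_rel E) x y.
Proof.
apply: contraT => xy.
pose S := [set z | connect (edge_rel E) x z]%SET.
have edge i : edge_rel E (u i) (v i) by rewrite /edge_rel /= uv; apply/imset_f.
have edge' i : edge_rel E (v i) (u i).
  by rewrite /edge_rel /= eq_sym uv finset.setUC; apply/imset_f.
have uvS i : (u i \in S) = (v i \in S).
  rewrite !finset.inE; apply/idP/idP => H.
    exact: connect_trans H (connect1 (edge i)).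
  exact: connect_trans H (connect1 (edge' i)).
pose I := [set i | u i \in S]%SET.
have I1 : #|I| < #|S|.
  have [->|I0] := eqVneq I finset.set0.
    by rewrite cards0 card_gt0; apply/finset.set0Pn; exists x; rewrite finset.in_set connect0.
  apply: leq_trans (euv I0) _; apply: subset_leq_card; apply/fintype.subsetP => z.
  move=> /mem_nbr[i]; rewrite finset.in_set finset.in_set2 => ui.
  by case/orP=> /eqP -> //; rewrite -uvS.
have I2 : #|~: I|%SET < #|~: S|%SET.
  have [->|I0] := eqVneq (~: I)%SET finset.set0.
    by rewrite cards0 card_gt0; apply/finset.set0Pn; exists y; rewrite finset.in_setC finset.in_set.
  apply: leq_trans (euv I0) _; apply: subset_leq_card; apply/fintype.subsetP => z.
  move=> /mem_nbr[i]; rewrite finset.in_setC finset.in_set finset.in_set2 finset.in_setC => ui.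
  by case/orP=> /eqP -> //; rewrite -uvS.
have := cardsC I; have := cardsC S; move: I1 I2; rewrite cardV; lia.
Qed.

Lemma edges_tree : is_tree E.
Proof.
split; [|exact: edge_connect|exact: edge_cycle].
by move=> e /finset.imsetP[i _ ->]; rewrite cards2 uv.
Qed.

End HallTree.

(** * Configurations as words with lengths *)

Section WordConfig.
Local Open Scope classical_set_scope.
Local Open Scope ring_scope.
Variables (R : realType) (r : nat) (Pi : finType) (b0 : Pi).
Hypothesis card_Pi : #|Pi| = r.
Local Notation E1 := {ffun Pi -> R^o}.
Implicit Types (w : seq Pi) (t : E1) (c : config R r Pi).

Definition psum w t (k : nat) : R := \sum_(i <- take k w) t i.

(* A relation instead of a function, to avoid casts between the tile numbers. *)
Definition is_conf w t c : Prop :=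
  [/\ ntiles c = size w,
      forall k : 'I_(ntiles c).+1, cutpt c k = psum w t k &
      forall k : 'I_(ntiles c), plate c k = nth b0 w k].

Lemma is_conf_uniq w t c c' : is_conf w t c -> is_conf w t c' -> c = c'.
Proof.
case: c c' => [n x a hn x0 x1 xi ai] [n' x' a' hn' x0' x1' xi' ai'] [/= e ex ea] [/= e' ex' ea'].
rewrite -e in e'; subst n'.
have xx' : x = x' by apply/funext => k; rewrite ex ex'.
have aa' : a = a' by apply/funext => k; rewrite ea ea'.
subst x' a'; congr Config; exact: Prop_irrelevance.
Qed.

Lemma sum_gt0 (s : seq Pi) t : s != [::] -> {in s, forall i, 0 < t i} ->
  0 < \sum_(i <- s) t i.
Proof.
case: s => [//|x s] _ H; rewrite big_cons ltr_pwDl //; first by apply: H; rewrite mem_head.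
by rewrite big_seq sumr_ge0 // => i si; rewrite ltW // H // inE si orbT.
Qed.

Lemma psum_lt w t k l : {in w, forall i, 0 < t i} -> (k < l <= size w)%N ->
  psum w t k < psum w t l.
Proof.
move=> H /andP[kl lw].
rewrite /psum -(cat_take_drop k (take l w)) take_takel 1?ltnW // big_cat /=.
rewrite ltrDl sum_gt0 //; first by rewrite -size_eq0 size_drop size_takel // -lt0n subn_gt0.
by move=> i /mem_drop/mem_take; exact: H.
Qed.

Lemma psum_le w t k l : (forall i, 0 <= t i) -> (k <= l)%N -> psum w t k <= psum w t l.
Proof.
move=> H kl; rewrite /psum -(cat_take_drop k (take l w)) take_takel // big_cat /=.
by rewrite lerDl sumr_ge0.
Qed.

Lemma sum_splx (s : seq Pi) t : uniq s -> in_splx s t -> \sum_(i <- s) t i = 1.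
Proof.
move=> us [_ [<- ts]]; rewrite big_uniq //= [RHS](bigID (mem s)) /=.
by rewrite [X in _ + X]big1 ?addr0 // => i /ts.
Qed.

Lemma sum_pos (s : seq Pi) t : (forall i, 0 <= t i) ->
  \sum_(i <- pos s t) t i = \sum_(i <- s) t i.
Proof.
move=> t0; rewrite big_filter [RHS](bigID (fun i => 0 < t i)) /=.
rewrite [X in _ + X]big1 ?addr0 // => i; rewrite -leNgt => ti.
by apply/eqP; rewrite eq_le ti t0.
Qed.

Lemma is_conf_ex w t : uniq w -> in_splx w t -> exists c, is_conf (pos w t) t c.
Proof.
move=> uw tw; set s := pos w t.
have us : uniq s by exact: filter_uniq.
have s0 : s != [::] := pos_neq0 tw.
have st : {in s, forall i, 0 < t i} by move=> i; rewrite mem_filter => /andP[].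
have hn : (1 <= size s <= r)%N.
  by rewrite lt0n size_eq0 s0 -card_Pi -(card_uniqP us) max_card.
have h0 : psum s t (ord0 : 'I_(size s).+1) = 0 by rewrite /psum take0 big_nil.
have h1 : psum s t (ord_max : 'I_(size s).+1) = 1.
  by rewrite /psum /= take_size sum_pos; [exact: sum_splx|case: tw].
have hi (k l : 'I_(size s).+1) : (k < l)%N -> psum s t k < psum s t l.
  by move=> kl; apply: psum_lt; rewrite // kl -ltnS ltn_ord.
have hp : injective (fun k : 'I_(size s) => nth b0 s k).
  by move=> k l /eqP; rewrite nth_uniq // => /eqP/val_inj.
by exists (Config hn h0 h1 hi hp); split.
Qed.

Lemma is_conf_act (aT : finGroupType) (to : {action aT &-> Pi}) h w t c :
  is_conf w t c -> is_conf (map (to^~ h) w) (actf to h t) (act_config to h c).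
Proof.
move=> [e cx cp]; split=> [|k|k] /=; first by rewrite size_map.
  rewrite cx /psum -map_take big_map; apply: eq_bigr => i _; by rewrite actf_act.
by rewrite cp (nth_map b0) // -e.
Qed.

(** Plates of length zero do not change partial sums, so a tile can be located in the fixed word [w]
    instead of [pos w t], whose length varies with [t]. This makes configurations with different
    tile numbers comparable. *)
Lemma plate_index w t c (j : 'I_(ntiles c)) : uniq w -> in_splx w t ->
    is_conf (pos w t) t c ->
  [/\ plate c j \in w, 0 < t (plate c j),
      tile_left j = psum w t (index (plate c j) w) &
      tile_right j = psum w t (index (plate c j) w).+1].
Proof.
move=> uw [t0 _] [e cx cp]; set g := plate c j.
have jlt : (j < size (pos w t))%N by rewrite -e.
have gpos : g \in pos w t by rewrite /g cp mem_nth.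
have [tg gw] : 0 < t g /\ g \in w by move: gpos; rewrite mem_filter => /andP[].
rewrite /tile_left /tile_right !cx /=.
have jE : index g (pos w t) = j by rewrite /g cp index_uniq // filter_uniq.
have wE := cat_take_drop (index g w) w.
rewrite (drop_nth b0) ?index_mem // nth_index // in wE.
have posE : pos w t = pos (take (index g w) w) t ++ g :: pos (drop (index g w).+1 w) t.
  by rewrite -[in LHS]wE /pos filter_cat /= tg.
have jE' : (j : nat) = size (pos (take (index g w) w) t).
  rewrite -jE [in LHS]posE index_cat /= eqxx addn0 ifN // mem_filter negb_and.
  by apply/orP; right; rewrite in_take // ltnn.
have s1 : psum (pos w t) t j = psum w t (index g w).
  by rewrite /psum jE' posE take_size_cat // sum_pos.
have s2 : psum (pos w t) t j.+1 = psum w t (index g w).+1.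
  rewrite /psum (take_nth b0) // (take_nth b0) ?index_mem // -!cats1 !big_cat /=.
  by rewrite -/(psum _ _ _) s1 nth_index // -cp.
by split.
Qed.

(** Zero lengths merely repeat cut points, which the set does not notice. *)
Lemma cutset_conf w t c : uniq w -> in_splx w t -> is_conf (pos w t) t c ->
  cutset c = [set psum w t k | k in setT].
Proof.
move=> uw tw cc; have [e cx cp] := cc; apply/seteqP; split=> [_ [k _ <-]|_ [k _ <-]].
  case: (unliftP ord0 k) => [j ->|->].
    have [_ _ _ jr] := plate_index j uw tw cc.
    by exists (index (plate c j) w).+1 => //; rewrite -jr.
  by exists 0%N => //; rewrite cx /psum !take0.
have posE : pos w t = pos (take k w) t ++ pos (drop k w) t.
  by rewrite -filter_cat cat_take_drop.
have kc : (size (pos (take k w) t) < (ntiles c).+1)%N.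
  by rewrite ltnS e posE size_cat leq_addr.
exists (Ordinal kc) => //; rewrite cx /psum /= posE take_size_cat //.
by rewrite sum_pos //; case: tw.
Qed.

Lemma psum_dist w t t' k : uniq w -> `|psum w t k - psum w t' k| <= \sum_i `|t i - t' i|.
Proof.
move=> uw; rewrite /psum -sumrB (le_trans (ler_norm_sum _ _ _)) //.
rewrite big_uniq ?take_uniq //= [leRHS](bigID (mem (take k w))) /=.
by rewrite lerDl sumr_ge0.
Qed.

(** Over a fixed word each partial sum moves by at most [d n], which bounds the Hausdorff distance.
    Once [d n] is below half of every positive limit length, the midpoint of a limit tile lies
    strictly inside the tile of the same plate. Tiles may shrink to length zero in the limit. *)
Lemma conf_cvg w (x : nat -> E1) t (c : nat -> config R r Pi) c' (d : nat -> R) :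
  uniq w -> (forall n, in_splx w (x n)) -> in_splx w t ->
  (forall n, is_conf (pos w (x n)) (x n) (c n)) -> is_conf (pos w t) t c' ->
  d @ \oo --> (0 : R) -> (forall n, \sum_i `|x n i - t i| <= d n) ->
  config_cvg c c'.
Proof.
move=> uw xw tw cn c'P d0 xd.
have d_ge0 n : 0 <= d n by apply: le_trans (xd n); rewrite sumr_ge0.
have close n : [set e : R | [/\ 0 <= e,
    forall a, cutset (c n) a -> exists2 b, cutset c' b & `|a - b| <= e &
    forall b, cutset c' b -> exists2 a, cutset (c n) a & `|a - b| <= e]] (d n).
  have H k : `|psum w (x n) k - psum w t k| <= d n.
    by apply: le_trans (xd n); exact: psum_dist.
  rewrite (cutset_conf uw (xw n) (cn n)) (cutset_conf uw tw c'P).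
  by split=> [//|_ [k _ <-]|_ [k _ <-]]; [exists (psum w t k)|exists (psum w (x n) k)].
split.
  apply: (squeeze_cvgr _ (cvg_cst 0) d0); apply: nearW => n; apply/andP; split.
    by apply: lb_le_inf; [exists (d n)|move=> e []].
  by apply: ge_inf (close n); exists 0 => e [].
have ev : \forall n \near \oo, forall i, 0 < t i -> d n < t i / 2.
  apply: filter_forall => i; have [ti|_] := ltP 0 (t i); last exact: nearW.
  have /cvgr0Pnorm_lt/(_ (t i / 2)) := d0; rewrite divr_gt0 // => /(_ isT).
  by apply: filterS => n; rewrite ger0_norm.
have [n0 _ n0P] := ev; exists n0 => n nn0 i j.
have [iw ti il ir] := plate_index i uw tw c'P.
have [jw tj jl jr] := plate_index j uw (xw n) (cn n).
rewrite /tile /midpoint /= il ir jl jr => /andP[lej rej].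
set a := plate c' i in iw ti il ir lej rej *; set b := plate (c n) j in jw tj jl jr lej rej *.
have H k : `|psum w (x n) k - psum w t k| <= d n.
  by apply: le_trans (xd n); exact: psum_dist.
pose ta : R := t a; have dn : d n < ta / 2 := n0P n nn0 a ti.
have aE : psum w t (index a w).+1 = psum w t (index a w) + ta.
  by rewrite /psum (take_nth b0) ?index_mem // -cats1 big_cat big_seq1 /= nth_index.
have x0 : forall l, 0 <= x n l by case: (xw n).
have [lt|gt|eq] := ltngtP (index b w) (index a w); last first.
- by rewrite -(nth_index b0 jw) eq nth_index.
- exfalso; have := psum_le w x0 gt; have := H (index a w).+1; rewrite ler_norml.
  move: lej rej dn; rewrite {}aE.
  move: (psum _ _ _) (psum _ _ _) (psum _ _ _) (psum _ _ _) ta (d n); clear=> ? ? ? ? ? ? ? ? ? /andP[? ?] ?; lra.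
- exfalso; have := psum_le w x0 lt; have := H (index a w); rewrite ler_norml.
  move: lej rej dn; rewrite {}aE.
  move: (psum _ _ _) (psum _ _ _) (psum _ _ _) (psum _ _ _) ta (d n); clear=> ? ? ? ? ? ? ? ? ? /andP[? ?] ?; lra.
Qed.

End WordConfig.

(** * Regular actions, pigeonhole and compactness *)

Lemma regular_action_coord (aT : finGroupType) (T : finType) (to : {action aT &-> T})
    (b0 : T) : free_action to -> [transitive [set: aT]%SET, on [set: T]%SET | to] ->
  exists k : T -> aT, (forall a, to b0 (k a) = a) /\
    (forall a h, k (to a h) = (k a * h)%g).
Proof.
move=> free trans.
have H a : exists g, to b0 g = a.
  have [g _ ->] := atransP2 trans (finset.in_setT b0) (finset.in_setT a).
  by exists g.
have [k kP] := choice H; exists k; split=> // a h.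
apply/eqP; rewrite eq_mulgV1; apply/eqP; apply: (free b0).
by rewrite actM kP -[in to a h](kP a) -(actM to b0) actK.
Qed.

Lemma infinite_fiber (T : finType) (P : nat -> T -> Prop) :
  (forall n, exists x, P n x) -> exists x, forall n, exists2 m, (n <= m)%N & P m x.
Proof.
move=> H; apply: contrapT => /forallNP nH.
have /choice[f fP] : forall x, exists n, forall m, (n <= m)%N -> ~ P m x.
  move=> x; have /existsNP[n nP] := nH x; exists n => m nm Pm.
  by apply: nP; exists m.
have [x Px] := H (\max_x f x)%N.
by apply: fP Px; exact: leq_bigmax.
Qed.

Section Cluster.
Local Open Scope classical_set_scope.
Local Open Scope ring_scope.

(** Tychonoff gives a cluster point of the sequence; since [I] is finite, closeness in all
    coordinates at once is a neighbourhood in the product topology. *)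
Lemma cube_cluster (R : realType) (I : finType) (z : nat -> I -> R) :
  (forall n i, 0 <= z n i <= 1) ->
  exists t : I -> R, forall e, 0 < e -> forall n, exists2 m, (n <= m)%N &
    forall i, `|z m i - t i| < e.
Proof.
move=> z01.
have cK := @tychonoff I (fun=> R : topologicalType) _ (fun=> @segment_compact R 0 1).
pose zz : nat -> prod_topology (fun _ : I => R) := z.
have [|t [_ tP]] := cK (zz @ \oo) _.
  by exists 0%N => // n _ i; rewrite /= in_itv /=.
exists t => e e0 n.
have C i : nbhs (t i) [set x | `|x - t i| < e].
  by apply/nbhs_ballP; exists e => //= x; rewrite /ball /= distrC.
pose PT := prod_topology (fun _ : I => R).
pose U i : set PT := [set f | `|f i - t i| < e].
have H i : nbhs (t : PT) (U i) := @proj_continuous I (fun=> R) i t _ (C i).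
have B : nbhs (t : PT) [set f | forall i, U i f].
  exact: (@filter_forall PT I U (nbhs (t : PT)) _ H).
have [|_ [[m nm <-] zm]] := tP [set zz m | m in [set m | (n <= m)%N]] _ _ B.
  by exists n => // m nm; exists m.
by exists m.
Qed.

End Cluster.

(** * Equivariant labels, approximate trees and the limit *)

Section Main.
Local Open Scope classical_set_scope.
Local Open Scope ring_scope.
Variables (R : realType) (p nu r : nat).
Hypotheses (p_prime : prime p) (r_def : r = (p ^ nu)%N).
Variables (Pi : finType).
Hypothesis card_Pi : #|Pi| = r.
Local Notation aT := 'rV['Z_p]_nu.
Variable to : {action aT &-> Pi}.
Variables (b0 : Pi) (k : Pi -> aT).
Hypothesis k_b0 : forall a, to b0 (k a) = a.
Hypothesis k_act : forall a h, k (to a h) = (k a * h)%g.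
Local Notation E1 := {ffun Pi -> R^o}.
Variable A : Pi -> 'I_r.+1 -> set (config R r Pi).
Hypothesis A_closed : forall i j, closed (A i j).
Hypothesis A_cover : forall j : 'I_r.+1,
     \bigcup_(i in [set: Pi]) A i j = [set: config R r Pi].
Hypothesis A_equiv : forall (s : aT) (i : Pi) (j : 'I_r.+1) (c : config R r Pi),
  A i j c <-> A (to i s) j (act_config to s c).

(** Labels are chosen arbitrarily after translating the first plate to [b0], then translated back.
    The translating element is unique, so the result is equivariant, and the symmetry of [A] keeps
    it valid. Words without a configuration get the default [b0]. *)
Lemma equivariant_labels : exists lam : seq Pi -> E1 -> 'I_r.+1 -> Pi,
  (forall w t j h, w != [::] -> lam (map (to^~ h) w) (actf to h t) j = to (lam w t j) h) /\
  (forall w t j c, is_conf b0 w t c -> A (lam w t j) j c).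
Proof.
have /choice[lam0 lam0P] : forall x : seq Pi * E1 * 'I_r.+1, exists i,
    forall c, is_conf b0 x.1.1 x.1.2 c -> A i x.2 c.
  move=> [[w t] j] /=; have [[c cP]|nc] := pselect (exists c, is_conf (r := r) b0 w t c).
    have : (\bigcup_(i in [set: Pi]) A i j) c by rewrite A_cover.
    by move=> [i _ Ai]; exists i => c' /(is_conf_uniq cP) <-.
  by exists b0 => c cP; case: nc; exists c.
pose lam w t j := let g := k (head b0 w) in
  to (lam0 (map (to^~ g^-1%g) w, actf to g^-1%g t, j)) g.
exists lam; split=> [w t j h w0|w t j c cP].
  rewrite /lam; have -> : head b0 (map (to^~ h) w) = to (head b0 w) h by case: (w) w0.
  rewrite k_act actM actfM invMg mulKVg -map_comp; congr (to (to (lam0 (_, _, _)) _) _).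
  by apply: eq_map => i /=; rewrite -actM mulKVg.
rewrite /lam; set g := k _.
have := lam0P (map (to^~ g^-1%g) w, actf to g^-1%g t, j) _ (is_conf_act to g^-1%g cP).
move/(A_equiv g) => /=.
have -> // : act_config to g (act_config to g^-1%g c) = c.
apply: (is_conf_uniq _ (cP)); have := is_conf_act to g (is_conf_act to g^-1%g cP).
rewrite actfM mulVg -map_comp (eq_map (g := id)) ?map_id => [|i /=]; last by rewrite actKV.
by have -> : actf to 1%g t = t by apply/ffunP => i; rewrite ffunE invg1 act1.
Qed.

Let q : R := 1 - r%:R^-1.

Lemma r_pos : (0 < r)%N. Proof. by rewrite r_def expn_gt0 prime_gt0. Qed.

Lemma mesh_factor_ge0 : 0 <= q. Proof. exact: q_ge0 r_pos. Qed.

Lemma mesh_factor_lt1 : `|q| < 1.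
Proof. by rewrite ger0_norm ?mesh_factor_ge0 // ltrBlDr ltrDl invr_gt0 ltr0n r_pos. Qed.

(** The depth M of the second subdivision depends on r alone; the depth N of the first stays free
    and controls the mesh of the simplex [s]. *)
Lemma hall_simplex (lam : seq Pi -> E1 -> 'I_r.+1 -> Pi) (N : nat) :
  (forall w t j h, w != [::] -> lam (map (to^~ h) w) (actf to h t) j = to (lam w t j) h) ->
  exists (w : seq Pi) (s : seq E1), [/\ uniq w, forall t, t \in s -> in_splx w t,
    forall i, mesh (fun t : E1 => t i) (q ^+ N) s &
    forall I : {set Pi}, I != finset.set0 ->
      (#|I| < #|[set j | has (fun t => lam (pos w t) t j \in I) s]%SET|)%N].
Proof.
move=> lam_equiv.
have [M qM] : exists M, q ^+ M < (r * r.+1)%:R^-1.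
  have e0 : 0 < (r * r.+1)%:R^-1 :> R by rewrite invr_gt0 ltr0n muln_gt0 r_pos.
  have /cvgr0Pnorm_lt/(_ _ e0)[M _ /(_ M (leqnn M))] := cvg_expr mesh_factor_lt1.
  by move=> /(le_lt_trans (ler_norm _)) ?; exists M.
have p_gt1 := prime_gt1 p_prime.
pose ph w := phi 'F_p to b0 k lam N M w.
have cC : #|{: 'Z_p}| = p by rewrite card_ord Zp_cast.
have iterE l (x : 'Z_p) : iter l (fun x => x + 1) x = x + l%:R.
  by elim: l => [|l IH]; rewrite ?addr0 //= IH -natr1 addrA.
have ptE l m : (l < p)%N -> (m < p)%N ->
    (iter l (fun x => x + 1) (0 : 'Z_p) == iter m (fun x => x + 1) 0) = (l == m).
  move=> lp mp; rewrite !iterE !add0r -val_eqE /= !val_Zp_nat // !modn_small //.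
have shp (c : 'Z_p) : iter p (fun x => x + 1) c = c.
  by rewrite iterE pchar_Zp // addr0.
(* Through [k] the plates become the vectors of (Z/p)^nu; the generators act by adding unit
   vectors. *)
have crdt i j y : k (to y (delta_mx 0 j)) 0 i = if i == j then k y 0 i + 1 else k y 0 i.
  rewrite k_act FinRing.zmodMgE mxE [delta_mx _ _ _ _]mxE eqxx /=.
  by case: (i == j); rewrite ?addr0.
have crdi x y : (forall i, k x 0 i = k y 0 i) -> x = y.
  by move=> e; rewrite -(k_b0 x) -(k_b0 y); congr (to _ _); apply/rowP.
have cY : #|Pi| = (p ^ nu)%N by rewrite card_Pi.
have [|w uw|i w uw|w uw|w [v [uw vw vall]]] := @inj_full_word 'F_p p p_prime (pchar_Fp p_prime)
    'Z_p 0 (fun x => x + 1) cC ptE (@addIr _ _) shp nu Pi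
    (fun j y => to y (delta_mx 0 j)) (fun i y => k y 0 i) crdt crdi cY ph.
- exact: phi_nil.
- exact: phi_bd.
- exact: phi_act.
- exact: phi_size.
have := phi_rainbow_hall (ltn0Sn r) uw vw vall; rewrite card_Pi => /(_ qM erefl)[s [s1 s2 s3]].
by exists w, s.
Qed.

(** Membership holds only at some point near [z]: the vertices of a small simplex use different
    labels. The represented configuration is quantified because [is_conf] is a relation. *)
Definition touches (w : seq Pi) (z : E1) (e : R) (i : Pi) (j : 'I_r.+1) : Prop :=
  exists x : E1, [/\ in_splx w x, forall l, `|x l - z l| <= e &
    forall c, is_conf b0 (pos w x) x c -> A i j c].

Definition tree_choice (uv : {ffun Pi -> 'I_r.+1 * 'I_r.+1}) : Prop :=
  (forall i, (uv i).1 != (uv i).2) /\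
  is_tree [set [set (uv i).1; (uv i).2]%SET | i : Pi]%SET.

Lemma approx_tree (N : nat) : exists (w : seq Pi) (uv : {ffun Pi -> 'I_r.+1 * 'I_r.+1}) (z : E1),
  [/\ uniq w, tree_choice uv, in_splx w z &
    forall i, touches w z (q ^+ N) i (uv i).1 /\ touches w z (q ^+ N) i (uv i).2].
Proof.
have [lam [lam_equiv lamA]] := equivariant_labels.
have [w [s [uw sw smesh hall]]] := hall_simplex N lam_equiv.
pose nb i := [set j | has (fun t => lam (pos w t) t j == i) s]%SET.
have nbE (I : {set Pi}) : nbr nb I = [set j | has (fun t => lam (pos w t) t j \in I) s]%SET.
  apply/finset.setP => j; rewrite finset.in_set; apply/mem_nbr/hasP => [[i iI]|[t ts tI]].
    by rewrite finset.in_set => /hasP[t ts /eqP e]; exists t; rewrite // e.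
  by exists (lam (pos w t) t j); rewrite // finset.in_set; apply/hasP; exists t.
have [u [v [uN vN uv euv]]] : exists u v : Pi -> 'I_r.+1, [/\ forall i, u i \in nb i,
    forall i, v i \in nb i, forall i, u i != v i & expanding (fun i => [set u i; v i]%SET)].
  by apply: reduce_to_edges => I /hall; rewrite nbE.
have [z zs] : exists z, z \in s.
  have := uN b0; rewrite finset.in_set => /hasP[t ts _]; by exists t.
have touch i j : j \in nb i -> touches w z (q ^+ N) i j.
  rewrite finset.in_set => /hasP[x xs /eqP <-]; exists x; split; first exact: sw.
    move=> l; rewrite ler_norml lerNl opprB; apply/andP.
    by split; [exact: (smesh l z x zs xs)|exact: (smesh l x z xs zs)].
  by move=> c /lamA.
exists w, [ffun i => (u i, v i)], z; split=> //.
- split=> [i|]; first by rewrite ffunE /= uv.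
  have -> : [set [set ([ffun i => (u i, v i)] i).1; ([ffun i => (u i, v i)] i).2]%SET | i : Pi]%SET
      = [set [set u i; v i]%SET | i : Pi]%SET.
    by apply: finset.eq_imset => i; rewrite ffunE.
  by apply: edges_tree => //; rewrite card_ord card_Pi.
- exact: sw.
- by move=> i; rewrite ffunE; split; apply: touch; [exact: uN|exact: vN].
Qed.

(** The word and the tree range over finite sets, so one pair occurs at arbitrarily fine scales. Its
    length vectors cluster at some [t] in the closed simplex, and closedness of the [A i j] carries
    all memberships to the configuration of [t]. *)
Lemma limit_tree : exists (uv : {ffun Pi -> 'I_r.+1 * 'I_r.+1}) (c : config R r Pi),
  tree_choice uv /\ forall i, A i (uv i).1 c /\ A i (uv i).2 c.
Proof.
(* Sequences of length at most r form a finite type, as the pigeonhole argument requires. *)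
pose P N (x : r.-bseq Pi * {ffun Pi -> 'I_r.+1 * 'I_r.+1}) := exists z : E1,
  [/\ uniq x.1, tree_choice x.2, in_splx x.1 z &
    forall i, touches x.1 z (q ^+ N) i (x.2 i).1 /\ touches x.1 z (q ^+ N) i (x.2 i).2].
have [[w uv] wuv] : exists x, forall n, exists2 N, (n <= N)%N & P N x.
  apply: infinite_fiber => N; have [w [uv [z [uw tuv wz H]]]] := approx_tree N.
  have sw : (size w <= r)%N by rewrite -card_Pi -(card_uniqP uw) max_card.
  by exists (Bseq sw, uv), z.
have /choice[z zP] : forall n, exists z : E1, [/\ uniq w, tree_choice uv, in_splx w z &
    forall i, touches w z (q ^+ n) i (uv i).1 /\ touches w z (q ^+ n) i (uv i).2].
  move=> n; have [N nN [y [/= uw tuv yw H]]] := wuv n.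
  have qle : q ^+ N <= q ^+ n by rewrite ler_wiXn2l ?mesh_factor_ge0 //; have := mesh_factor_lt1; rewrite ger0_norm ?mesh_factor_ge0 // => /ltW.
  exists y; split=> // i; have [[x [x1 x2 x3]] [x' [x1' x2' x3']]] := H i.
  by split; [exists x|exists x']; split=> // l; apply: le_trans qle.
have [uw tuv _ _] := zP 0%N.
have zw n : in_splx w (z n) by case: (zP n).
have [t0 t0P] := @cube_cluster R Pi (fun n i => z n i) (fun n i =>
  introT andP (conj ((zw n).1 i) (in_splx_le1 i (zw n)))).
pose t : E1 := [ffun i => t0 i].
have tw : in_splx w t.
  split=> [i|].
    rewrite ffunE; apply/ler_addgt0Pr => e e0; have [m _ /(_ i)] := t0P e e0 0%N.
    have [/(_ i)] := zw m; rewrite ltr_norml => zi _ /andP[]; lra.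
  split=> [|i iw].
    apply/eqP; rewrite -subr_eq0 -normr_le0; apply/ler_addgt0Pr => e e0; rewrite add0r.
    have er : 0 < e / r%:R by rewrite divr_gt0 // ltr0n r_pos.
    have [m _ mP] := t0P _ er 0%N; have [_ [<- _]] := zw m.
    rewrite -sumrB (le_trans (ler_norm_sum _ _ _)) //.
    apply: (@le_trans _ _ (\sum_(i : Pi) (e / r%:R))).
      by apply: ler_sum => i _; rewrite ffunE distrC ltW.
    by rewrite sumr_const cardT -cardE card_Pi -[_ / _ *+ _]mulr_natr divfK // pnatr_eq0 -lt0n r_pos.
  rewrite ffunE; apply/eqP; rewrite -normr_le0; apply/ler_addgt0Pr => e e0.
  have [m _ /(_ i)] := t0P e e0 0%N; have [_ [_ ->]] := zw m => //.
  by rewrite sub0r normrN add0r => /ltW.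
have [c cP] := is_conf_ex b0 card_Pi uw tw.
exists uv, c; split=> //.
have /choice[m mP] : forall n, exists m : nat, (n <= m)%N /\
    forall i, `|z m i - t i| <= n.+1%:R^-1.
  move=> n.
  have [|k0 nk H] := t0P n.+1%:R^-1 _ n; first by rewrite invr_gt0 ltr0n.
  by exists k0; split=> // i; rewrite ffunE ltW.
(* In each of the r coordinates a touching point is within q^n of [z (m n)], which is within 1/(n +
   1) of [t]. *)
pose d n : R := r%:R * (q ^+ n + n.+1%:R^-1).
have d0 : d @ \oo --> (0 : R).
  rewrite -(mulr0 r%:R); apply: cvgMl_tmp; rewrite -(addr0 0); apply: cvgD.
    exact: cvg_expr mesh_factor_lt1.
  exact: cvg_harmonic.
have lim i j : (forall n, touches w (z n) (q ^+ n) i j) -> A i j c.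
  move=> H; have [x xP] := choice (fun n => H (m n)).
  have xw n : in_splx w (x n) by case: (xP n).
  have [y yP] := choice (fun n => is_conf_ex b0 card_Pi uw (xw n)).
  apply: (iffLR (config_closedP (A i j)) (@A_closed i j) y); last by move=> n; case: (xP n) => _ _; apply; exact: yP.
  apply: (conf_cvg uw xw tw yP cP d0) => n.
  apply: (@le_trans _ _ (\sum_(l : Pi) (q ^+ n + n.+1%:R^-1))); last first.
    by rewrite sumr_const cardT -cardE card_Pi /d mulr_natl.
  apply: ler_sum => l _; rewrite (le_trans (ler_distD (z (m n) l) _ _)) // lerD //.
    have [_ /(_ l) xl _] := xP n; apply: le_trans xl _.
    rewrite ler_wiXn2l ?mesh_factor_ge0 ?(mP n).1 //.
    by have := mesh_factor_lt1; rewrite ger0_norm ?mesh_factor_ge0 // => /ltW.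
  exact: (mP n).2.
by move=> i; split; apply: lim => n; have [_ _ _ /(_ i)[]] := zP n.
Qed.

End Main.

Local Open Scope classical_set_scope.

Theorem theorem3p3 (R : realType) (p nu r : nat)
  (p_prime : prime p) (nu_gt0 : (1 <= nu)%N) (r_def : r = (p ^ nu)%N)
  (Pi : finType) (card_Pi : #|Pi| = r)
  (to : {action 'rV['Z_p]_nu &-> Pi})
  (to_free : free_action to)
  (to_trans : [transitive [set: 'rV['Z_p]_nu]%SET, on [set: Pi]%SET | to])
  (A : Pi -> 'I_r.+1 -> set (config R r Pi))
  (A_closed : forall (i : Pi) (j : 'I_r.+1), closed (A i j))
  (A_cover : forall j : 'I_r.+1,
     \bigcup_(i in [set: Pi]) A i j = [set: config R r Pi])
  (A_equiv : forall (s : 'rV['Z_p]_nu) (i : Pi) (j : 'I_r.+1)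
     (c : config R r Pi), A i j c <-> A (to i s) j (act_config to s c)) :
  exists u v : Pi -> 'I_r.+1,
    [/\ forall i : Pi, u i != v i,
        is_tree [set [set u i; v i]%SET | i : Pi]%SET &
        \bigcap_(i in [set: Pi]) (A i (u i) `&` A i (v i)) !=set0].
Proof.
have /card_gt0P[b0 _] : (0 < #|Pi|)%N by rewrite card_Pi r_def expn_gt0 prime_gt0.
have [k [k_b0 k_act]] := regular_action_coord b0 to_free to_trans.
have [uv [c [[uvN tuv] H]]] :=
  limit_tree p_prime r_def card_Pi k_b0 k_act A_closed A_cover A_equiv.
exists (fun i => (uv i).1), (fun i => (uv i).2); split=> //.
by exists c => i _; have [] := H i.
Qed.
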